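(* Suppose the system $\partial_t U=\mathcal A U+F$ satisfies assumptions (I), (P), (H) of the context and is semi-strictly hyperbolic, i.e. there is $d_0>0$ with $|D_{H,ii}-D_{H,jj}|\ge d_0$ on $Z_H$ for all $1\le i,j\le n$, $i\ne j$. Let $m_P\in\mathbb N_0$ be sufficiently large (depending on $a_P,B_P$), let $m_H\in\mathbb N$ be sufficiently large (depending on $\ell_*,B_H$), and let $\rho_0$ be sufficiently small (with respect to $m_P,m_H$). For a solution $U$ define $U_A,F_A:(0,T]\times\mathbb R^d\to\mathbb C^n$ by $$U_A|_{Z_P\setminus Z_I}:=\mathcal E_PQ_P^{(m_P)}M_PU,\quad U_A|_{Z_I}:=U,\quad U_A|_{Z_H\setminus Z_I}:=\mathcal E_HQ_H^{(m_H)}M_HU,$$ $$F_A|_{Z_P\setminus Z_I}:=\mathcal E_PQ_P^{(m_P)}M_PF,\quad F_A|_{Z_I}:=F,\quad F_A|_{Z_H\setminus Z_I}:=\mathcal E_HQ_H^{(m_H)}M_HF.$$ (Asymptotics) Given $u:\mathbb R^d\to\mathbb C^n$ and $F\in C((0,T]\times\mathbb R^d;\mathbb C^n)$, there is a unique solution $U$ of $\partial_tU=\mathcal AU+F$ with $U(T,\cdot)=u$. If moreover $\int_0^T|F_A(\tau,\xi)|\,d\tau<\infty$ for every $\xi\in\mathbb R^d$, then for every $\xi\in\mathbb R^d$ the limit $u_A(\xi):=\lim_{\tau\searrow0}U_A(\tau,\xi)$ exists and is finite, and for all $\xi\in\mathbb R^d$, $t_0\in(0,T]$, $$|u_A(\xi)|\lesssim|U_A(t_0,\xi)|+\int_0^{t_0}|F_A(\tau,\xi)|\,d\tau.$$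 (Scattering) Given $u_A:\mathbb R^d\to\mathbb C^n$ and $F\in C((0,T]\times\mathbb R^d;\mathbb C^n)$ with $\int_0^T|F_A(\tau,\xi)|\,d\tau<\infty$ for every $\xi\in\mathbb R^d$, there is a unique solution $U$ of $\partial_tU=\mathcal AU+F$ such that $\lim_{\tau\searrow0}U_A(\tau,\xi)=u_A(\xi)$ for all $\xi\in\mathbb R^d$. In addition, for all $\xi\in\mathbb R^d$, $t_0\in(0,T]$, $$|U_A(t_0,\xi)|\lesssim|u_A(\xi)|+\int_0^{t_0}|F_A(\tau,\xi)|\,d\tau.$$
   Context: Conventions. $\mathbb N=\{1,2,\dots\}$, $\mathbb N_0=\mathbb N\cup\{0\}$, $\imath=\sqrt{-1}$, $\langle\eta\rangle=(1+|\eta|^2)^{1/2}$; $\mathbb C^n\otimes\mathbb C^n$ denotes $n\times n$ complex matrices. $A\lesssim B$ means $A\le CB$ with $C$ independent of the times, of $\xi$ and of the solution and data ($C$ may depend on the system, $T$, $\rho_0$ and the orders $m_P,m_H$). Setting. $d,n\in\mathbb N$, $T>0$, $\ell\in(-1,\infty)^d$, $\ell_*=\min_i\ell_i$, $\alpha>0$. $\lambda:[0,T]\to\mathbb R^d\otimes\mathbb R^d$ has the form $\lambda=\lambda^0+\lambda^*(t)$ with $\lambda^0$ constant, $\lambda^*$ smooth on $(0,T]$, $|(t\partial_t)^k\lambda^*|\le C_kt^\alpha$ for every $k\in\mathbb N$. Put $\mathfrak H(t,\xi)=[\sum_{i,j}t^{\ell_i+\ell_j}\lambda_{ij}(t)\xi_i\xi_j]^{1/2}$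 and assume $\mathfrak H^2\ge\lambda_0\sum_it^{2\ell_i}\xi_i^2$ for some $\lambda_0>0$. The system is $\partial_tU=\mathcal AU+F$ on $(0,T]_t\times\mathbb R^d_\xi$, with $F\in C((0,T]\times\mathbb R^d;\mathbb C^n)$ and $\mathcal A:(0,T]\times\mathbb R^d\to\mathbb C^n\otimes\mathbb C^n$; it is an ODE in $t$ for each fixed $\xi$, and solutions are $C^1$ in $t\in(0,T]$ for each $\xi$. Rescaled time and zones. $\langle\langle\xi\rangle\rangle=\max_i\langle\xi_i\rangle^{1/(\ell_i+1)}$, $z=\langle\langle\xi\rangle\rangle t$, $\mathfrak Z=\langle\langle\xi\rangle\rangle^{-1}\mathfrak H$, $\partial_z=\langle\langle\xi\rangle\rangle^{-1}\partial_t$ (so $z\partial_z=t\partial_t$). For small $\rho_0\in(0,1)$, the zones are the subsets of $(0,T]\times\mathbb R^d$: $Z_P=\{z\le\rho_0\}$, $Z_I=\{\rho_0\le z\le\rho_0^{-1}\}$, $Z_H=\{z\ge\rho_0^{-1}\}$. All hypotheses on zones are understood to hold for all sufficiently small $\rho_0$, the objects for smaller $\rho_0$ being restrictions of those for larger $\rho_0$. Symbol classes. For $V\subseteq(0,T]\times\mathbb R^d$, a normed space $X$ and $a\in\mathbb R$, $\mathcal S^a(V;X)$ is the set of continuous $f:V\to X$, smooth in $t$ for each $\xi$, with $|(z\partial_z)^kf|\le C_kz^a$ on $V$ for all $k\in\mathbb N_0$; $\mathcal S^a_*(V;X)$ is defined likewise with bounds $C_kz^a(1+|\log z|)^p$ for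 some $p\in\mathbb N_0$ independent of $k$. Below $X=\mathbb C^n\otimes\mathbb C^n$. (I) $\langle\langle\xi\rangle\rangle^{-1}\mathcal A\in\mathcal S^0(Z_I;X)$. (P) On $Z_P$: $M_P\mathcal AM_P^{-1}+(\partial_tM_P)M_P^{-1}=t^{-1}B_P+\langle\langle\xi\rangle\rangle R_P$, with $M_P$ invertible, $M_P,M_P^{-1}\in\mathcal S^0(Z_P;X)$; $B_P\in\mathcal S^0(Z_P;X)$ independent of $t$ and everywhere in Jordan normal form (eigenvalues on the diagonal, ones on the superdiagonal within blocks); $R_P\in\mathcal S^{a_P}_*(Z_P;X)$ for some $a_P>-1$. (H) On $Z_H$: $M_H\mathcal AM_H^{-1}+(\partial_tM_H)M_H^{-1}=\imath\mathfrak HD_H+t^{-1}B_H+\langle\langle\xi\rangle\rangle R_H$, with $M_H$ invertible, $M_H,M_H^{-1}\in\mathcal S^0(Z_H;X)$; $B_H\in\mathcal S^0(Z_H;X)$ of the form $B_H(t,\xi)=B_{H,\infty}(t,\xi/|\xi|)$; $D_H\in\mathcal S^0(Z_H;X)$ everywhere diagonal and real-valued; $R_H\in\mathcal S^{a_H}(Z_H;X)$ for some $a_H<-1$. Renormalization on $Z_P$. Fix sequences, $m\in\mathbb N$: $D_P^{(m)}\in\mathcal S_*^{m(a_P+1)-1}(Z_P;X)$ everywhere diagonal, $N_P^{(m)}\in\mathcal S_*^{m(a_P+1)}(Z_P;X)$, $R_P^{(m)}\in\mathcal S_*^{m(a_P+1)+a_P}(Z_P;X)$, such that, with $Q_P^{(m)}=I_n+\sum_{k=1}^mN_P^{(k)}$,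 $$R_P^{(m)}=\sum_{k=1}^m\partial_zN_P^{(k)}+Q_P^{(m)}(z^{-1}B_P+R_P)-\Big(z^{-1}B_P+\sum_{k=1}^mD_P^{(k)}\Big)Q_P^{(m)};$$ also $Q_P^{(0)}=I_n$, $R_P^{(0)}=R_P$. Put $\mathcal E_P=\exp(-(\log z)B_P)$. Renormalization on $Z_H$. Fix sequences, $m\in\mathbb N$: $D_H^{(m)}\in\mathcal S^{-(m-1)(\ell_*+1)-1}(Z_H;X)$ diagonal with $D_H^{(1)}=\operatorname{diag}(z^{-1}B_{H,ii}+R_{H,ii})_{i=1}^n$, $N_H^{(m)}\in\mathcal S^{-m(\ell_*+1)}(Z_H;X)$, $R_H^{(m)}\in\mathcal S^{-m(\ell_*+1)-1}(Z_H;X)$, such that, with $Q_H^{(m)}=I_n+\sum_{k=1}^mN_H^{(k)}$, $$R_H^{(m)}=\sum_{k=1}^m\partial_zN_H^{(k)}+Q_H^{(m)}(\imath\mathfrak ZD_H+z^{-1}B_H+R_H)-\Big(\imath\mathfrak ZD_H+\sum_{k=1}^mD_H^{(k)}\Big)Q_H^{(m)}.$$ Put $b_{H,i}(t,\xi)=\int_{\langle\langle\xi\rangle\rangle^{-1}\rho_0^{-1}}^t\tau^{-1}B_{H,ii}(\tau,\xi)\,d\tau$ and $\mathcal E_H=\operatorname{diag}(e^{-b_{H,1}},\dots,e^{-b_{H,n}})$ on $Z_H$. *)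

(* Defs.v *)
From HB Require Import structures.
From mathcomp Require Import all_boot all_order all_algebra.
From mathcomp Require Import complex.
From mathcomp Require Import all_classical all_reals all_analysis.

Set Implicit Arguments.
Unset Strict Implicit.
Unset Printing Implicit Defensive.

Import Order.TTheory GRing.Theory Num.Theory.
Import numFieldNormedType.Exports.

Local Open Scope classical_set_scope.
Local Open Scope ring_scope.
Local Open Scope complex_scope.

(* R[i] carries the topology given by its modulus, via its numFieldType
   structure *)
HB.instance Definition _ (R : rcfType) :=
  NormedModule.copy R[i] (R[i] : numFieldType)^o.

Section Norms.
Context {R : realType}.

(* Euclidean (Frobenius) norm, with values in R rather than R[i] *)
Definition mxnorm {p q : nat} (A : 'M[R[i]]_(p, q)) : R :=
  Num.sqrt (\sum_i \sum_j (complex.Re (A i j) ^+ 2 + complex.Im (A i j) ^+ 2)).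

Definition enorm {d : nat} (xi : 'rV[R]_d) : R :=
  Num.sqrt (\sum_i xi 0 i ^+ 2).

Definition cexp (z : R[i]) : R[i] :=
  (expR (complex.Re z) * cos (complex.Im z))
  +i* (expR (complex.Re z) * sin (complex.Im z)).

Definition mexp {n : nat} (A : 'M[R[i]]_n) : 'M[R[i]]_n :=
  limn (fun N => \sum_(0 <= k < N) (k`!%:R^-1 : R[i]) *: (A ^+ k)).

(* Jordan normal form, blocks in an arbitrary order: the entry (i, i + 1) is 1
   inside a block and 0 between two consecutive blocks, and the diagonal is
   constant along each block *)
Definition is_jordan {n : nat} (B : 'M[R[i]]_n) : Prop :=
  forall i j : 'I_n,
    (nat_of_ord j != i -> nat_of_ord j != i.+1 -> B i j = 0) /\
    (nat_of_ord j = i.+1 -> B i j = 0 \/ (B i j = 1 /\ B i i = B j j)).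

End Norms.

Section Zones.
Context {R : realType} {d : nat}.
Variable ell : 'I_d -> R.

(* the index set is nonempty (d > 0) wherever ell_min is used *)
Definition ell_min : R := inf (range ell).

Definition jap (x : R) : R := Num.sqrt (1 + x ^+ 2).

(* <<xi>>; for d > 0 the default 1 is harmless since all terms are >= 1 *)
Definition jbr (xi : 'rV[R]_d) : R :=
  \big[Num.max/1]_(i < d) (jap (xi 0 i) `^ (ell i + 1)^-1).

Definition zeta (t : R) (xi : 'rV[R]_d) : R := jbr xi * t.

Definition strip (T : R) : set (R * 'rV[R]_d) := [set p | 0 < p.1 <= T].

Definition zoneP (T rho : R) : set (R * 'rV[R]_d) :=
  strip T `&` [set p | zeta p.1 p.2 <= rho].

Definition zoneI (T rho : R) : set (R * 'rV[R]_d) :=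
  strip T `&` [set p | rho <= zeta p.1 p.2 <= rho^-1].

Definition zoneH (T rho : R) : set (R * 'rV[R]_d) :=
  strip T `&` [set p | rho^-1 <= zeta p.1 p.2].

Definition frakH (lam : R -> 'M[R]_d) (t : R) (xi : 'rV[R]_d) : R :=
  Num.sqrt (\sum_i \sum_j
    t `^ (ell i + ell j) * lam t i j * xi 0 i * xi 0 j).

Definition frakZ (lam : R -> 'M[R]_d) (t : R) (xi : 'rV[R]_d) : R :=
  (jbr xi)^-1 * frakH lam t xi.

End Zones.

Section Symbols.
Context {R : realType} {d p q : nat}.
Implicit Types (V : set (R * 'rV[R]_d)) (f : R -> 'rV[R]_d -> 'M[R[i]]_(p, q)).

(* l is the t-derivative of f at (t, xi) relative to the slice of V at xi
   (one-sided at an end of the slice).  If the slice is reduced to {t}, every l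
   qualifies; the hypotheses below only assert the existence of derivatives, so
   such points carry no constraint. *)
Definition is_dt V f (t : R) (xi : 'rV[R]_d) (l : 'M[R[i]]_(p, q)) : Prop :=
  (fun h : R => (h^-1)%:C *: (f (t + h) xi - f t xi))
    @ within [set h | V (t + h, xi)] 0^' --> l.

(* f is smooth in t on V, and g k = (t d/dt)^k f = (z d/dz)^k f there *)
Definition zdz_tower V f (g : nat -> R -> 'rV[R]_d -> 'M[R[i]]_(p, q)) : Prop :=
  (forall t xi, V (t, xi) -> g 0%N t xi = f t xi) /\
  (forall k t xi, V (t, xi) ->
     is_dt V (g k) t xi ((t^-1)%:C *: g k.+1 t xi)).

Definition continuous_on V f : Prop :=
  {within V, continuous (fun x : R * 'rV[R]_d => f x.1 x.2)}.

(* S^a(V; X) *)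
Definition symbol (ell : 'I_d -> R) (a : R) V f : Prop :=
  continuous_on V f /\
  exists g, zdz_tower V f g /\
    forall k, exists C : R, forall t xi, V (t, xi) ->
      mxnorm (g k t xi) <= C * zeta ell t xi `^ a.

(* S^a_*(V; X) *)
Definition symbol_log (ell : 'I_d -> R) (a : R) V f : Prop :=
  continuous_on V f /\
  exists g, zdz_tower V f g /\
    exists r : nat, forall k, exists C : R, forall t xi, V (t, xi) ->
      mxnorm (g k t xi)
        <= C * zeta ell t xi `^ a * (1 + `|ln (zeta ell t xi)|) ^+ r.

End Symbols.

Section System.
Context {R : realType} {d n : nat}.
Local Notation mat := 'M[R[i]]_n.
Local Notation fld := (R -> 'rV[R]_d -> mat).
Variables (ell : 'I_d -> R) (T : R).

(* The real matrix lams is embedded in the complex ones, and the t-derivatives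
   are those of a function which does not depend on xi. *)
Definition coefficient_hyp (alpha c0 : R) (lam : R -> 'M[R]_d)
    (lam0 : 'M[R]_d) (lams : R -> 'M[R]_d) : Prop :=
  [/\ forall t, 0 <= t <= T -> lam t = lam0 + lams t,
      exists g, zdz_tower (strip T)
          (fun t (_ : 'rV[R]_d) => map_mx (real_complex R) (lams t)) g /\
        forall k, (0 < k)%N -> exists C : R, forall t (xi : 'rV[R]_d), 0 < t <= T ->
          mxnorm (g k t xi) <= C * t `^ alpha
    & forall t (xi : 'rV[R]_d), 0 < t <= T ->
        c0 * \sum_i t `^ (2 * ell i) * xi 0 i ^+ 2
          <= frakH ell lam t xi ^+ 2].

Definition hyp_I (rho : R) (A : fld) : Prop :=
  symbol ell 0 (zoneI ell T rho) (fun t xi => ((jbr ell xi)^-1)%:C *: A t xi).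

Record hyp_P (rho : R) (A MP : fld) (BP : 'rV[R]_d -> mat) (RP : fld) (aP : R)
    : Prop := HypP {
  MP_unit : forall t xi, zoneP ell T rho (t, xi) -> MP t xi \in unitmx;
  MP_sym : symbol ell 0 (zoneP ell T rho) MP;
  MPV_sym : symbol ell 0 (zoneP ell T rho) (fun t xi => invmx (MP t xi));
  BP_sym : symbol ell 0 (zoneP ell T rho) (fun _ xi => BP xi);
  BP_jordan : forall t xi, zoneP ell T rho (t, xi) -> is_jordan (BP xi);
  aP_gt : -1 < aP;
  RP_sym : symbol_log ell aP (zoneP ell T rho) RP;
  P_eq : forall t xi, zoneP ell T rho (t, xi) ->
    exists2 dM, is_dt (zoneP ell T rho) MP t xi dM &
      MP t xi *m A t xi *m invmx (MP t xi) + dM *m invmx (MP t xi)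
        = (t^-1)%:C *: BP xi + (jbr ell xi)%:C *: RP t xi
}.

Record hyp_H (rho : R) (lam : R -> 'M[R]_d)
    (A MH DH BH BHinf RH : fld) (aH : R) : Prop := HypH {
  MH_unit : forall t xi, zoneH ell T rho (t, xi) -> MH t xi \in unitmx;
  MH_sym : symbol ell 0 (zoneH ell T rho) MH;
  MHV_sym : symbol ell 0 (zoneH ell T rho) (fun t xi => invmx (MH t xi));
  BH_sym : symbol ell 0 (zoneH ell T rho) BH;
  BH_hom : forall t xi, zoneH ell T rho (t, xi) ->
    BH t xi = BHinf t ((enorm xi)^-1 *: xi);
  DH_sym : symbol ell 0 (zoneH ell T rho) DH;
  DH_diag : forall t xi, zoneH ell T rho (t, xi) -> is_diag_mx (DH t xi);
  DH_real : forall t xi i j, zoneH ell T rho (t, xi) -> complex.Im (DH t xi i j) = 0;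
  aH_lt : aH < -1;
  RH_sym : symbol ell aH (zoneH ell T rho) RH;
  H_eq : forall t xi, zoneH ell T rho (t, xi) ->
    exists2 dM, is_dt (zoneH ell T rho) MH t xi dM &
      MH t xi *m A t xi *m invmx (MH t xi) + dM *m invmx (MH t xi)
        = (0 +i* frakH ell lam t xi) *: DH t xi + (t^-1)%:C *: BH t xi
          + (jbr ell xi)%:C *: RH t xi
}.

Definition semi_strictly_hyperbolic (rho : R) (DH : fld) : Prop :=
  exists2 d0 : R, 0 < d0 &
    forall t xi (i j : 'I_n), zoneH ell T rho (t, xi) -> i != j ->
      d0 <= ComplexField.Normc.normc (DH t xi i i - DH t xi j j).

(* Q^(m) = I_n + N^(1) + ... + N^(m) *)
Definition renQ (N : nat -> fld) (m : nat) : fld :=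
  fun t xi => 1%:M + \sum_(1 <= k < m.+1) N k t xi.

(* R^(m) = sum_k d_z N^(k) + Q^(m) L - L' Q^(m), where d_z = <<xi>>^-1 d_t *)
Definition renorm_eq (V : set (R * 'rV[R]_d)) (N Rm : nat -> fld)
    (L : fld) (L' : nat -> fld) (m : nat) : Prop :=
  forall t xi, V (t, xi) ->
    exists2 dN : nat -> mat,
      forall k, (1 <= k <= m)%N -> is_dt V (N k) t xi (dN k) &
      Rm m t xi = \sum_(1 <= k < m.+1) ((jbr ell xi)^-1)%:C *: dN k
        + renQ N m t xi *m L t xi - L' m t xi *m renQ N m t xi.

Record renorm_P (rho : R) (BP : 'rV[R]_d -> mat) (RP : fld) (aP : R)
    (DPs NPs RPs : nat -> fld) : Prop := RenormP {
  DPs_sym : forall m, (0 < m)%N ->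
    symbol_log ell (m%:R * (aP + 1) - 1) (zoneP ell T rho) (DPs m);
  DPs_diag : forall m t xi, (0 < m)%N -> zoneP ell T rho (t, xi) ->
    is_diag_mx (DPs m t xi);
  NPs_sym : forall m, (0 < m)%N ->
    symbol_log ell (m%:R * (aP + 1)) (zoneP ell T rho) (NPs m);
  RPs_sym : forall m, (0 < m)%N ->
    symbol_log ell (m%:R * (aP + 1) + aP) (zoneP ell T rho) (RPs m);
  RPs_eq : forall m, (0 < m)%N ->
    renorm_eq (zoneP ell T rho) NPs RPs
      (fun t xi => ((zeta ell t xi)^-1)%:C *: BP xi + RP t xi)
      (fun m t xi => ((zeta ell t xi)^-1)%:C *: BP xi
                     + \sum_(1 <= k < m.+1) DPs k t xi)
      m
}.

Record renorm_H (rho : R) (lam : R -> 'M[R]_d) (DH BH RH : fld)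
    (DHs NHs RHs : nat -> fld) : Prop := RenormH {
  DHs_sym : forall m, (0 < m)%N ->
    symbol ell (- (m%:R - 1) * (ell_min ell + 1) - 1) (zoneH ell T rho) (DHs m);
  DHs_diag : forall m t xi, (0 < m)%N -> zoneH ell T rho (t, xi) ->
    is_diag_mx (DHs m t xi);
  DHs_1 : forall t xi, zoneH ell T rho (t, xi) ->
    DHs 1%N t xi =
      diag_mx (\row_i (((zeta ell t xi)^-1)%:C * BH t xi i i + RH t xi i i));
  NHs_sym : forall m, (0 < m)%N ->
    symbol ell (- m%:R * (ell_min ell + 1)) (zoneH ell T rho) (NHs m);
  RHs_sym : forall m, (0 < m)%N ->
    symbol ell (- m%:R * (ell_min ell + 1) - 1) (zoneH ell T rho) (RHs m);
  RHs_eq : forall m, (0 < m)%N ->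
    renorm_eq (zoneH ell T rho) NHs RHs
      (fun t xi => (0 +i* frakZ ell lam t xi) *: DH t xi
                   + ((zeta ell t xi)^-1)%:C *: BH t xi + RH t xi)
      (fun m t xi => (0 +i* frakZ ell lam t xi) *: DH t xi
                     + \sum_(1 <= k < m.+1) DHs k t xi)
      m
}.

Definition EP (BP : 'rV[R]_d -> mat) : fld :=
  fun t xi => mexp (- (ln (zeta ell t xi))%:C *: BP xi).

Definition bH (rho : R) (BH : fld) (i : 'I_n) (t : R) (xi : 'rV[R]_d) : R[i] :=
  let I := `[(jbr ell xi)^-1 * rho^-1, t]%classic in
  Rintegral lebesgue_measure I (fun s => s^-1 * complex.Re (BH s xi i i))
  +i* Rintegral lebesgue_measure I (fun s => s^-1 * complex.Im (BH s xi i i)).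

Definition EH (rho : R) (BH : fld) : fld :=
  fun t xi => diag_mx (\row_i cexp (- bH rho BH i t xi)).

(* The matrix taking U to U_A and F to F_A: the three branches are
   Z_P \ Z_I, Z_I and Z_H \ Z_I. *)
Definition gaugeA (rho : R) (MP : fld) (BP : 'rV[R]_d -> mat)
    (NPs : nat -> fld) (mP : nat) (MH BH : fld) (NHs : nat -> fld) (mH : nat)
    : fld :=
  fun t xi =>
    if zeta ell t xi < rho then EP BP t xi *m renQ NPs mP t xi *m MP t xi
    else if zeta ell t xi <= rho^-1 then 1%:M
    else EH rho BH t xi *m renQ NHs mH t xi *m MH t xi.

Implicit Types (U F : R -> 'rV[R]_d -> 'cV[R[i]]_n).

(* C^1 solutions of d_t U = A U + F, for each fixed xi; no regularity in xi *)
Definition is_solution (A : fld) F U : Prop :=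
  exists dU : R -> 'rV[R]_d -> 'cV[R[i]]_n, forall xi,
    {within `]0, T], continuous (fun t => dU t xi)} /\
    forall t, 0 < t <= T ->
      is_dt (strip T) U t xi (dU t xi) /\
      dU t xi = A t xi *m U t xi + F t xi.

(* functions on (0, T] x R^d are represented by total ones *)
Definition eq_on_strip U1 U2 : Prop :=
  forall t xi, 0 < t <= T -> U1 t xi = U2 t xi.

Definition unique_solution (A : fld) F
    (P : (R -> 'rV[R]_d -> 'cV[R[i]]_n) -> Prop) : Prop :=
  exists U, [/\ is_solution A F U, P U &
    forall U', is_solution A F U' -> P U' -> eq_on_strip U' U].

Definition applyA (G : fld) U : R -> 'rV[R]_d -> 'cV[R[i]]_n :=
  fun t xi => G t xi *m U t xi.

Definition intnorm F (t0 : R) (xi : 'rV[R]_d) : \bar R :=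
  (\int[lebesgue_measure]_(s in `]0%R, t0]) (mxnorm (F s xi))%:E)%E.

Definition limit0 U (v : 'rV[R]_d -> 'cV[R[i]]_n) (xi : 'rV[R]_d) : Prop :=
  U t xi @[t --> 0^'+] --> v xi.

(* G is the matrix with U_A = G U and F_A = G F *)
Definition asymptotics_holds (A G : fld) : Prop :=
  exists C : R, forall (u : 'rV[R]_d -> 'cV[R[i]]_n) F,
    continuous_on (strip T) F ->
    unique_solution A F (fun U => forall xi, U T xi = u xi) /\
    forall U, is_solution A F U -> (forall xi, U T xi = u xi) ->
      (forall xi, (intnorm (applyA G F) T xi < +oo)%E) ->
      exists uA : 'rV[R]_d -> 'cV[R[i]]_n,
        (forall xi, limit0 (applyA G U) uA xi) /\
        forall xi t0, 0 < t0 <= T ->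
          ((mxnorm (uA xi))%:E <= C%:E * ((mxnorm (applyA G U t0 xi))%:E
                                   + intnorm (applyA G F) t0 xi))%E.

Definition scattering_holds (A G : fld) : Prop :=
  exists C : R, forall (uA : 'rV[R]_d -> 'cV[R[i]]_n) F,
    continuous_on (strip T) F ->
    (forall xi, (intnorm (applyA G F) T xi < +oo)%E) ->
    unique_solution A F (fun U => forall xi, limit0 (applyA G U) uA xi) /\
    forall U, is_solution A F U -> (forall xi, limit0 (applyA G U) uA xi) ->
      forall xi t0, 0 < t0 <= T ->
        ((mxnorm (applyA G U t0 xi))%:E
           <= C%:E * ((mxnorm (uA xi))%:E + intnorm (applyA G F) t0 xi))%E.

End System.

(* Main.v *)
Require Import Defs.
From mathcomp Require Import all_boot all_order all_algebra.
From mathcomp Require Import complex.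
From mathcomp Require Import all_classical all_reals all_analysis.
From mathcomp Require Import measurable_realfun ring lra.

Set Implicit Arguments.
Unset Strict Implicit.
Unset Printing Implicit Defensive.

Import Order.TTheory GRing.Theory Num.Theory.
Import numFieldNormedType.Exports.

Local Open Scope classical_set_scope.
Local Open Scope ring_scope.

(** Fix [xi], and let [W = G *m U] where [G] is the gauge with [U_A = G *m U].
    Inside each zone [W] solves a system with right-hand side [G *m F] and
    coefficient [S + K], where [S] is skew-adjoint and [K] has an integral over
    the zone which is bounded independently of [xi].  As [S] does not change
    lengths, Gronwall's inequality, forwards and backwards in time, bounds
    [|W t|] and [|W s|] by each other up to a constant and the integral of
    [|G *m F|] (lemmas [gronwall], [zone_estimate]).

    In [Z_P], where [S = 0], the factor [Q_P M_P] reduces the coefficient to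
    [t^-1 B_P + <<xi>> (D + R Q_P^-1)] with [D] diagonal, and [E_P = z^(- B_P)]
    removes [t^-1 B_P].  Conjugation by [E_P] multiplies [D] by powers of
    [log z] only: [B_P] is in Jordan form, so that its diagonal part cancels and
    its nilpotent part contributes polynomials in [log z].  The remainder [R]
    may lose a factor [z ^ (- 2 beta)], with [beta] a bound of [|B_P|], which a
    large [m_P] compensates.  So [|K| <= C <<xi>> z ^ (b - 1)] with [b > 0]
    (lemma [coefP_bound]).

    In [Z_H], [S = i H D_H], and [E_H] removes the diagonal of [t^-1 B_H].
    Being diagonal it commutes with all other diagonal terms, and what it does
    to the remainder is again compensated by a large [m_H].  So
    [|K| <= C <<xi>> z ^ (- b - 1)] with [b > 0] (lemma [restH_bound]).  In [Z_I]
    the coefficient is at most [C <<xi>>] on a time interval of length at most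
    [C / <<xi>>].  Where two zones meet, [z] is fixed and the two values of the
    gauge are comparable; chaining the zones gives a two-sided estimate on
    [(0, T]], uniform in [xi] (lemma [two_sided_of_intervals]).

    In [Z_P] the derivative of [W] is now dominated by an integrable function,
    hence [W] has a limit at [0] (lemma [zone_limit]), and the estimates extend
    to the limit.  They give the uniqueness of the scattering solution.  They
    also show that the linear map from the data at [T] of homogeneous solutions
    to their limits at [0] is injective; on the finite-dimensional space [C^n]
    it is then onto, which gives the existence
    (lemma [scattering_solution_exists]). *)

Local Notation Re := complex.Re.
Local Notation Im := complex.Im.

(** * Norm and inner product of complex matrices *)

Section Norms.
Context {R : realType}.

Lemma ReD (x y : R[i]) : Re (x + y) = Re x + Re y. Proof. by case: x y => [a b] []. Qed.
Lemma ImD (x y : R[i]) : Im (x + y) = Im x + Im y. Proof. by case: x y => [a b] []. Qed.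
Lemma ReN (x : R[i]) : Re (- x) = - Re x. Proof. by case: x. Qed.
Lemma ImN (x : R[i]) : Im (- x) = - Im x. Proof. by case: x. Qed.
Lemma ReM (x y : R[i]) : Re (x * y) = Re x * Re y - Im x * Im y.
Proof. by case: x y => [a b] []. Qed.
Lemma ImM (x y : R[i]) : Im (x * y) = Re x * Im y + Im x * Re y.
Proof. by case: x y => [a b] []. Qed.

Lemma sum_sqr_ge0 (I : finType) (a : I -> R) : 0 <= \sum_i a i ^+ 2.
Proof. by apply: sumr_ge0 => i _; exact: sqr_ge0. Qed.

(** The Cauchy-Schwarz inequality, by expanding the sum of the squares of
    [B * a i - A * b i] with [A], [B] the two lengths. *)
Lemma sum_mul_le_sqrt (I : finType) (a b : I -> R) :
  \sum_i a i * b i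
    <= Num.sqrt (\sum_i a i ^+ 2) * Num.sqrt (\sum_i b i ^+ 2).
Proof.
set A := Num.sqrt _; set B := Num.sqrt _.
have A2 : \sum_i a i ^+ 2 = A ^+ 2 by rewrite sqr_sqrtr// sum_sqr_ge0.
have B2 : \sum_i b i ^+ 2 = B ^+ 2 by rewrite sqr_sqrtr// sum_sqr_ge0.
have A0 : 0 <= A by rewrite sqrtr_ge0.
have B0 : 0 <= B by rewrite sqrtr_ge0.
set s := \sum_i _.
have H : 0 <= (A * B) * (A * B - s) *+ 2.
  suff -> : (A * B) * (A * B - s) *+ 2 = \sum_i (B * a i - A * b i) ^+ 2.
    exact: sum_sqr_ge0.
  transitivity (\sum_i (B ^+ 2 * a i ^+ 2 + A ^+ 2 * b i ^+ 2
     - (A * B) *+ 2 * (a i * b i))); last by apply: eq_bigr => i _; ring.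
  rewrite sumrB big_split/= -!mulr_sumr A2 B2 -/s; ring.
have [AB|AB] := ltP 0 (A * B).
  by move: H; rewrite pmulrn_lge0// pmulr_rge0// subr_ge0.
have {}AB : A * B = 0 by apply/eqP; rewrite eq_le AB mulr_ge0.
suff : s = 0 by move=> ->; rewrite AB.
apply: big1 => i _; move/eqP: AB; rewrite mulf_eq0.
have z c X : \sum_i c i ^+ 2 = X ^+ 2 -> X = 0 -> c i = 0 :> R.
  move=> + X0; rewrite X0 expr0n/= => /eqP; rewrite psumr_eq0; last first.
    by move=> *; exact: sqr_ge0.
  by move=> /allP/(_ i); rewrite mem_index_enum sqrf_eq0 => /(_ isT)/eqP.
by case/orP => /eqP; [move/(z _ _ A2)->; rewrite mul0r|
  move/(z _ _ B2)->; rewrite mulr0].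
Qed.

Definition mxnorm2 {p q} (A : 'M[R[i]]_(p, q)) : R :=
  \sum_i \sum_j (Re (A i j) ^+ 2 + Im (A i j) ^+ 2).

(** The real part of the Hermitian inner product. *)
Definition mxip {p q} (A B : 'M[R[i]]_(p, q)) : R :=
  \sum_i \sum_j (Re (A i j) * Re (B i j) + Im (A i j) * Im (B i j)).

Lemma mxnorm2_ge0 {p q} (A : 'M[R[i]]_(p, q)) : 0 <= mxnorm2 A.
Proof. by do 2 (apply: sumr_ge0 => ? _); rewrite addr_ge0// sqr_ge0. Qed.

Lemma mxnorm_ge0 {p q} (A : 'M[R[i]]_(p, q)) : 0 <= mxnorm A.
Proof. exact: sqrtr_ge0. Qed.

Lemma mxnorm_sqr {p q} (A : 'M[R[i]]_(p, q)) : mxnorm A ^+ 2 = mxnorm2 A.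
Proof. by rewrite sqr_sqrtr// mxnorm2_ge0. Qed.

Lemma mxip_le {p q} (A B : 'M[R[i]]_(p, q)) : mxip A B <= mxnorm A * mxnorm B.
Proof.
pose f (A : 'M[R[i]]_(p, q)) (x : 'I_p * 'I_q * bool) :=
  if x.2 then Re (A x.1.1 x.1.2) else Im (A x.1.1 x.1.2).
have E (X Y : 'M[R[i]]_(p, q)) : \sum_x f X x * f Y x =
    \sum_i \sum_j (Re (X i j) * Re (Y i j) + Im (X i j) * Im (Y i j)).
  rewrite pair_big/=.
  rewrite -(pair_big xpredT xpredT (fun u b => f X (u, b) * f Y (u, b)))/=.
  by apply: eq_bigr => u _; rewrite big_bool.
have E2 (X : 'M[R[i]]_(p, q)) : \sum_x f X x ^+ 2 = mxnorm2 X.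
  under eq_bigr do rewrite expr2.
  by rewrite E; apply: eq_bigr => i _; apply: eq_bigr => j _; rewrite !expr2.
by rewrite /mxip -E; apply: le_trans (sum_mul_le_sqrt _ _) _; rewrite !E2.
Qed.

Lemma mxnormN {p q} (A : 'M[R[i]]_(p, q)) : mxnorm (- A) = mxnorm A.
Proof.
rewrite /mxnorm; congr Num.sqrt; apply: eq_bigr => i _; apply: eq_bigr => j _.
by rewrite mxE ReN ImN !sqrrN.
Qed.

Lemma normr_mxip_le {p q} (A B : 'M[R[i]]_(p, q)) :
  `|mxip A B| <= mxnorm A * mxnorm B.
Proof.
have ipN : mxip (- A) B = - mxip A B.
  rewrite /mxip -sumrN; apply: eq_bigr => i _; rewrite -sumrN.
  by apply: eq_bigr => j _; rewrite mxE ReN ImN; ring.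
by rewrite ler_norml mxip_le andbT lerNl -ipN -(mxnormN A) mxip_le.
Qed.

Lemma mxnorm2D {p q} (A B : 'M[R[i]]_(p, q)) :
  mxnorm2 (A + B) = mxnorm2 A + mxip A B *+ 2 + mxnorm2 B.
Proof.
rewrite /mxnorm2 /mxip -sumrMnl -!big_split/=; apply: eq_bigr => i _.
rewrite -sumrMnl -!big_split/=; apply: eq_bigr => j _.
by rewrite mxE ReD ImD; ring.
Qed.

Lemma mxnormD {p q} (A B : 'M[R[i]]_(p, q)) :
  mxnorm (A + B) <= mxnorm A + mxnorm B.
Proof.
rewrite -(@ler_pXn2r _ 2)// ?nnegrE ?addr_ge0 ?mxnorm_ge0//.
rewrite sqrrD !mxnorm_sqr mxnorm2D lerD2r lerD2l.
by rewrite lerMn2r/= mxip_le.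
Qed.

Lemma mxnorm0 {p q} : mxnorm (0 : 'M[R[i]]_(p, q)) = 0.
Proof.
rewrite /mxnorm big1 ?sqrtr0// => i _; rewrite big1// => j _.
by rewrite mxE/= expr0n/= addr0.
Qed.

Lemma mxnormZ {p q} (c : R[i]) (A : 'M[R[i]]_(p, q)) :
  mxnorm (c *: A) = ComplexField.Normc.normc c * mxnorm A.
Proof.
rewrite /mxnorm; case: c => [a b]/=; rewrite -sqrtrM ?addr_ge0 ?sqr_ge0//.
congr Num.sqrt; rewrite mulr_sumr; apply: eq_bigr => i _.
rewrite mulr_sumr; apply: eq_bigr => j _.
by rewrite mxE ReM ImM/=; ring.
Qed.

Lemma normc_real (c : R) : ComplexField.Normc.normc (c%:C)%C = `|c|.
Proof. by rewrite /= expr0n/= addr0 sqrtr_sqr. Qed.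

Lemma mxnormZr {p q} (c : R) (A : 'M[R[i]]_(p, q)) :
  mxnorm ((c%:C)%C *: A) = `|c| * mxnorm A.
Proof. by rewrite mxnormZ normc_real. Qed.

Lemma mxnormB {p q} (A B : 'M[R[i]]_(p, q)) :
  mxnorm (A - B) <= mxnorm A + mxnorm B.
Proof. by rewrite -(mxnormN B) mxnormD. Qed.

Lemma mxnorm_sum {p q} (I : Type) (r : seq I) (P : pred I)
    (f : I -> 'M[R[i]]_(p, q)) :
  mxnorm (\sum_(i <- r | P i) f i) <= \sum_(i <- r | P i) mxnorm (f i).
Proof.
elim/big_ind2 : _ => [|x y u v xu yv|//]; first by rewrite mxnorm0.
by apply: le_trans (mxnormD _ _) _; rewrite lerD.
Qed.

Lemma sqr_entry_le {p q} (A : 'M[R[i]]_(p, q)) i j :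
  Re (A i j) ^+ 2 + Im (A i j) ^+ 2 <= mxnorm2 A.
Proof.
rewrite /mxnorm2 (bigD1 i)//= (bigD1 j)//= -addrA lerDl addr_ge0//.
  by apply: sumr_ge0 => *; rewrite addr_ge0 ?sqr_ge0.
by do 2 (apply: sumr_ge0 => ? _); rewrite addr_ge0 ?sqr_ge0.
Qed.

Lemma Re_le_mxnorm {p q} (A : 'M[R[i]]_(p, q)) i j : `|Re (A i j)| <= mxnorm A.
Proof.
rewrite -sqrtr_sqr ler_sqrt ?mxnorm2_ge0//.
by apply: le_trans (sqr_entry_le A i j); rewrite lerDl sqr_ge0.
Qed.

Lemma Im_le_mxnorm {p q} (A : 'M[R[i]]_(p, q)) i j : `|Im (A i j)| <= mxnorm A.
Proof.
rewrite -sqrtr_sqr ler_sqrt ?mxnorm2_ge0//.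
by apply: le_trans (sqr_entry_le A i j); rewrite lerDr sqr_ge0.
Qed.

Lemma mxnorm_eq0 {p q} (A : 'M[R[i]]_(p, q)) : mxnorm A = 0 -> A = 0.
Proof.
move=> A0; apply/matrixP => i j; rewrite mxE.
have := Re_le_mxnorm A i j; have := Im_le_mxnorm A i j.
by rewrite A0 !normr_le0; case: (A i j) => a b/= /eqP -> /eqP ->.
Qed.

Lemma mxnorm_le_sum {p q} (A : 'M[R[i]]_(p, q)) :
  mxnorm A <= \sum_i \sum_j (`|Re (A i j)| + `|Im (A i j)|).
Proof.
have S0 : 0 <= \sum_i \sum_j (`|Re (A i j)| + `|Im (A i j)|).
  by do 2 (apply: sumr_ge0 => ? _); rewrite addr_ge0.
rewrite -(@ler_pXn2r _ 2)// ?nnegrE ?mxnorm_ge0// mxnorm_sqr.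
have sq (I : finType) (a b : I -> R) : (forall i, 0 <= b i) ->
    (forall i, a i <= b i ^+ 2) -> \sum_i a i <= (\sum_i b i) ^+ 2.
  move=> b0 ab; rewrite expr2 mulr_suml; apply: ler_sum => i _.
  apply: le_trans (ab i) _; rewrite expr2 ler_wpM2l//.
  by rewrite (bigD1 i)//= lerDl sumr_ge0.
apply: (sq 'I_p) => i; first by apply: sumr_ge0 => *; rewrite addr_ge0.
apply: (sq 'I_q) => j; first by rewrite addr_ge0.
by rewrite sqrrD !real_normK ?num_real// lerD2r lerDl mulrn_wge0 ?mulr_ge0.
Qed.

Lemma normc_sum (I : finType) (f : I -> R[i]) :
  ComplexField.Normc.normc (\sum_i f i)
    <= \sum_i ComplexField.Normc.normc (f i).
Proof.
elim/big_ind2 : _ => [|x y u v xu yv|//]; first by rewrite /= expr0n/= addr0 sqrtr0.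
by apply: le_trans (le_normcD _ _) _; rewrite lerD.
Qed.

Lemma normcE2 (z : R[i]) :
  ComplexField.Normc.normc z ^+ 2 = Re z ^+ 2 + Im z ^+ 2.
Proof. by case: z => a b/=; rewrite sqr_sqrtr// addr_ge0 ?sqr_ge0. Qed.

Lemma normc_ge0 (z : R[i]) : 0 <= ComplexField.Normc.normc z.
Proof. by case: z => a b/=; rewrite sqrtr_ge0. Qed.

Lemma mxnormM {p q r} (A : 'M[R[i]]_(p, q)) (B : 'M[R[i]]_(q, r)) :
  mxnorm (A *m B) <= mxnorm A * mxnorm B.
Proof.
rewrite -(@ler_pXn2r _ 2)// ?nnegrE ?mulr_ge0 ?mxnorm_ge0// exprMn !mxnorm_sqr.
rewrite /mxnorm2 mulr_suml; apply: ler_sum => i _.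
rewrite [X in _ * X]exchange_big/= mulr_sumr; apply: ler_sum => k _.
rewrite -normcE2 mxE.
under [X in _ <= X * _]eq_bigr do rewrite -normcE2.
under [X in _ <= _ * X]eq_bigr do rewrite -normcE2.
rewrite -(@sqr_sqrtr _ (\sum_j _)) ?sum_sqr_ge0//.
rewrite -[X in _ <= _ * X](@sqr_sqrtr _ _) ?sum_sqr_ge0// -exprMn.
rewrite ler_pXn2r ?nnegrE ?normc_ge0 ?mulr_ge0 ?sqrtr_ge0//.
apply: le_trans (normc_sum _) _.
under [X in X <= _]eq_bigr do rewrite ComplexField.Normc.normcM.
exact: sum_mul_le_sqrt.
Qed.

End Norms.

(** * Convergence of complex matrices *)

Section Topology.
Context {R : realType}.

Lemma cvg_complexP (T : Type) (F : set_system T) {FF : Filter F}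
    (f : T -> R[i]) (l : R[i]) :
  f x @[x --> F] --> l <->
  (Re (f x) @[x --> F] --> Re l) /\ (Im (f x) @[x --> F] --> Im l).
Proof.
have realE (e : R[i]) : 0 < e -> e = ((Re e)%:C)%C /\ 0 < Re e.
  by case: e => a b; rewrite ltcE/= => /andP[/eqP->].
split.
  move=> /cvgrPdist_lt fl; split; apply/cvgrPdist_lt => e e0.
    have e0' : 0 < ((e%:C)%C : R[i]) by rewrite ltcR.
    near=> x; have : `|l - f x| < (e%:C)%C by near: x; exact: fl.
    rewrite normc_def ltcR; apply: le_lt_trans.
    rewrite -ReN -ReD -sqrtr_sqr ler_sqrt ?addr_ge0 ?sqr_ge0//.
    by rewrite lerDl sqr_ge0.
  have e0' : 0 < ((e%:C)%C : R[i]) by rewrite ltcR.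
  near=> x; have : `|l - f x| < (e%:C)%C by near: x; exact: fl.
  rewrite normc_def ltcR; apply: le_lt_trans.
  rewrite -ImN -ImD -sqrtr_sqr ler_sqrt ?addr_ge0 ?sqr_ge0//.
  by rewrite lerDr sqr_ge0.
move=> [/cvgrPdist_lt rl /cvgrPdist_lt il]; apply/cvgrPdist_lt => e.
move=> /realE[-> e0].
have e2 : 0 < Re e / 2 by rewrite divr_gt0.
near=> x.
have rx : `|Re l - Re (f x)| < Re e / 2 by near: x; exact: rl.
have ix : `|Im l - Im (f x)| < Re e / 2 by near: x; exact: il.
rewrite normc_def ltcR -[ltRHS]gtr0_norm// -sqrtr_sqr ltr_sqrt ?exprn_gt0//.
rewrite ReD ReN ImD ImN -real_normK ?num_real//.
rewrite -[X in _ + X]real_normK ?num_real//.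
have := normr_ge0 (Re l - Re (f x)); have := normr_ge0 (Im l - Im (f x)).
move: rx ix; set a := `|_|; set b := `|_|; move=> *; nra.
Unshelve. all: by end_near. Qed.

Lemma cvg_mx_coordP (T : Type) (F : set_system T) {FF : Filter F} {p q}
    (X : T -> 'M[R[i]]_(p, q)) (L : 'M[R[i]]_(p, q)) :
  X x @[x --> F] --> L <-> forall i j, X x i j @[x --> F] --> L i j.
Proof.
split=> [XL i j|XL].
  exact: (cvg_comp _ _ XL (@coord_continuous _ _ _ i j L)).
apply/cvg_ballP => e e0; rewrite near_simpl.
suff : \forall x \near F, forall ij : 'I_p * 'I_q,
    ball (L ij.1 ij.2) e (X x ij.1 ij.2).
  by apply: filterS => x H; split => // i j; exact: (H (i, j)).
by apply: filter_forall => -[i j]; move/cvg_ballP: (XL i j); apply.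
Qed.

Lemma cvg_mxP (T : Type) (F : set_system T) {FF : Filter F} {p q}
    (X : T -> 'M[R[i]]_(p, q)) (L : 'M[R[i]]_(p, q)) :
  X x @[x --> F] --> L <->
  forall i j, (Re (X x i j) @[x --> F] --> Re (L i j)) /\
              (Im (X x i j) @[x --> F] --> Im (L i j)).
Proof.
rewrite cvg_mx_coordP; split=> XL i j; first by have /cvg_complexP := XL i j.
by apply/cvg_complexP; exact: XL.
Qed.

Lemma cvg_mxnorm (T : Type) (F : set_system T) {FF : ProperFilter F} {p q}
    (X : T -> 'M[R[i]]_(p, q)) (L : 'M[R[i]]_(p, q)) :
  X x @[x --> F] --> L -> mxnorm (X x) @[x --> F] --> mxnorm L.
Proof.
move=> /cvg_mxP XL; apply: (@cvg_comp _ _ _ _ (@Num.sqrt R)); last first.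
  exact: sqrt_continuous.
apply: cvg_big => [|i _]; first by apply: add_continuous.
apply: cvg_big => [|j _]; first by apply: add_continuous.
have [cr ci] := XL i j.
rewrite !expr2; apply: cvgD.
  by under eq_fun do rewrite expr2; exact: cvgM.
by under eq_fun do rewrite expr2; exact: cvgM.
Qed.

End Topology.

(** * Entrywise calculus of matrix functions *)

Section Calculus.
Context {R : realType}.

(** Derivatives and continuity are taken separately for the real and imaginary
    parts of each entry, so that the calculus of real functions applies. *)
Definition cder (f : R -> R[i]) (t : R) (l : R[i]) : Prop :=
  is_derive t 1 (fun s => Re (f s)) (Re l) /\
  is_derive t 1 (fun s => Im (f s)) (Im l).

Definition mder {p q} (X : R -> 'M[R[i]]_(p, q)) t (L : 'M[R[i]]_(p, q)) : Prop :=
  forall i j, cder (fun s => X s i j) t (L i j).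

Lemma cderD f g t k l : cder f t k -> cder g t l ->
  cder (fun s => f s + g s) t (k + l).
Proof.
move=> [fr fi] [gr gi]; split; under eq_fun do rewrite ?ReD ?ImD.
  by rewrite ReD; exact: is_deriveD.
by rewrite ImD; exact: is_deriveD.
Qed.

Lemma cder_cst c t : cder (fun=> c) t 0.
Proof. by split; exact: is_derive_cst. Qed.

Lemma cderM f g t k l : cder f t k -> cder g t l ->
  cder (fun s => f s * g s) t (k * g t + f t * l).
Proof.
move=> [fr fi] [gr gi]; split; under eq_fun do rewrite ?ReM ?ImM.
  rewrite ReD !ReM; apply: is_derive_eq.
  by rewrite /GRing.scale/=; ring.
rewrite ImD !ImM; apply: is_derive_eq.
by rewrite /GRing.scale/=; ring.
Qed.

Lemma cder_sum (I : Type) (r : seq I) (P : pred I) (f : I -> R -> R[i]) t l :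
  (forall i, P i -> cder (f i) t (l i)) ->
  cder (fun s => \sum_(i <- r | P i) f i s) t (\sum_(i <- r | P i) l i).
Proof.
move=> fl; elim: r => [|a r IH].
  by under eq_fun do rewrite big_nil; rewrite big_nil; exact: cder_cst.
under eq_fun do rewrite big_cons; rewrite big_cons.
by case: ifPn => // Pa; apply: cderD => //; exact: fl.
Qed.

Lemma mderM {p q r} (X : R -> 'M[R[i]]_(p, q)) (Y : R -> 'M[R[i]]_(q, r)) t K L :
  mder X t K -> mder Y t L ->
  mder (fun s => X s *m Y s) t (K *m Y t + X t *m L).
Proof.
move=> XK YL i j; under eq_fun do rewrite mxE; rewrite !mxE -big_split/=.
by apply: cder_sum => k _; exact: cderM.
Qed.

Lemma mderD {p q} (X Y : R -> 'M[R[i]]_(p, q)) t K L :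
  mder X t K -> mder Y t L -> mder (fun s => X s + Y s) t (K + L).
Proof.
by move=> XK YL i j; under eq_fun do rewrite mxE; rewrite mxE; exact: cderD.
Qed.

Lemma mder_cst {p q} (A : 'M[R[i]]_(p, q)) t : mder (fun=> A) t 0.
Proof. by move=> i j; rewrite mxE; exact: cder_cst. Qed.

Lemma mder_sum {p q} (I : Type) (r : seq I) (P : pred I)
    (X : I -> R -> 'M[R[i]]_(p, q)) t L :
  (forall i, P i -> mder (X i) t (L i)) ->
  mder (fun s => \sum_(i <- r | P i) X i s) t (\sum_(i <- r | P i) L i).
Proof.
move=> XL; elim: r => [|a r IH].
  by under eq_fun do rewrite big_nil; rewrite big_nil; exact: mder_cst.
under eq_fun do rewrite big_cons; rewrite big_cons.
by case: ifPn => // Pa; apply: mderD => //; exact: XL.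
Qed.

Lemma mderZ {p q} (c : R -> R[i]) (X : R -> 'M[R[i]]_(p, q)) t k L :
  cder c t k -> mder X t L ->
  mder (fun s => c s *: X s) t (k *: X t + c t *: L).
Proof.
move=> ck XL i j; under eq_fun do rewrite mxE; rewrite !mxE; exact: cderM.
Qed.

Definition ccont (A : set R) (f : R -> R[i]) : Prop :=
  {within A, continuous (fun s => Re (f s))} /\
  {within A, continuous (fun s => Im (f s))}.

Definition mcont {p q} (A : set R) (X : R -> 'M[R[i]]_(p, q)) : Prop :=
  forall i j, ccont A (fun s => X s i j).

Lemma ccont_ext A f g : f =1 g -> ccont A f -> ccont A g.
Proof. by move=> /funext ->. Qed.

Lemma ccontD A f g : ccont A f -> ccont A g -> ccont A (fun s => f s + g s).
Proof.
move=> [fr fi] [gr gi]; split; under eq_fun do rewrite ?ReD ?ImD; move=> x.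
  by apply: cvgD; [exact: fr|exact: gr].
by apply: cvgD; [exact: fi|exact: gi].
Qed.

Lemma ccontM A f g : ccont A f -> ccont A g -> ccont A (fun s => f s * g s).
Proof.
move=> [fr fi] [gr gi]; split; under eq_fun do rewrite ?ReM ?ImM; move=> x.
  by apply: cvgB; apply: cvgM; [exact: fr|exact: gr|exact: fi|exact: gi].
by apply: cvgD; apply: cvgM; [exact: fr|exact: gi|exact: fi|exact: gr].
Qed.

Lemma ccont_cst A c : ccont A (fun=> c).
Proof. by split=> x; exact: cvg_cst. Qed.

Lemma mcontD {p q} A (X Y : R -> 'M[R[i]]_(p, q)) :
  mcont A X -> mcont A Y -> mcont A (fun s => X s + Y s).
Proof.
move=> cX cY i j; apply: (ccont_ext (f := fun s => X s i j + Y s i j)).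
  by move=> s; rewrite mxE.
exact: ccontD.
Qed.

Lemma mcont_cst {p q} A (B : 'M[R[i]]_(p, q)) : mcont A (fun=> B).
Proof. by move=> i j; exact: ccont_cst. Qed.

Lemma ccont_sum A (I : Type) (r : seq I) (P : pred I) (f : I -> R -> R[i]) :
  (forall i, P i -> ccont A (f i)) ->
  ccont A (fun s => \sum_(i <- r | P i) f i s).
Proof.
move=> fA; elim: r => [|a r IH].
  apply: (ccont_ext (f := fun=> 0)); last exact: ccont_cst.
  by move=> s; rewrite big_nil.
apply: (ccont_ext (f := fun s => (if P a then f a s else 0)
    + \sum_(i <- r | P i) f i s)).
  by move=> s; rewrite big_cons; case: ifP; rewrite ?add0r.
by apply: ccontD => //; case Pa: (P a); [exact: fA|exact: ccont_cst].
Qed.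

Lemma mcont_sum {p q} A (I : Type) (r : seq I) (P : pred I)
    (X : I -> R -> 'M[R[i]]_(p, q)) :
  (forall i, P i -> mcont A (X i)) ->
  mcont A (fun s => \sum_(i <- r | P i) X i s).
Proof.
move=> XA i j; apply: (ccont_ext (f := fun s => \sum_(k <- r | P k) X k s i j)).
  by move=> s; rewrite summxE.
by apply: ccont_sum => k Pk; exact: XA.
Qed.

Lemma mcontM {p q r} A (X : R -> 'M[R[i]]_(p, q)) (Y : R -> 'M[R[i]]_(q, r)) :
  mcont A X -> mcont A Y -> mcont A (fun s => X s *m Y s).
Proof.
move=> cX cY i j; apply: (ccont_ext (f := fun s => \sum_k X s i k * Y s k j)).
  by move=> s; rewrite mxE.
by apply: ccont_sum => k _; exact: ccontM.
Qed.

Lemma mcontZ {p q} A c (Y : R -> 'M[R[i]]_(p, q)) :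
  ccont A c -> mcont A Y -> mcont A (fun s => c s *: Y s).
Proof.
move=> cX cY i j; apply: (ccont_ext (f := fun s => c s * Y s i j)).
  by move=> s; rewrite mxE.
exact: ccontM.
Qed.

Lemma mcontW {p q} (A B : set R) (X : R -> 'M[R[i]]_(p, q)) :
  B `<=` A -> mcont A X -> mcont B X.
Proof.
by move=> BA cX i j; have [? ?] := cX i j; split; exact: continuous_subspaceW BA _.
Qed.

Lemma mcont_mxnorm {p q} A (X : R -> 'M[R[i]]_(p, q)) :
  mcont A X -> {within A, continuous (fun s => mxnorm (X s))}.
Proof.
move=> cX x; apply: cvg_mxnorm; apply/cvg_mxP => i j.
by have [/(_ x) ? /(_ x) ?] := cX i j.
Qed.

Lemma is_derive_continuous (f : R -> R) (t l : R) : is_derive t 1 f l -> {for t, continuous f}.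
Proof. by move=> [fd _]; apply/differentiable_continuous/derivable1_diffP. Qed.

Lemma mder_mcont {p q} (A : set R) (X : R -> 'M[R[i]]_(p, q)) L :
  (forall t, A t -> mder X t (L t)) -> mcont A X.
Proof.
move=> XL i j; split; apply: continuous_in_subspaceT => t /set_mem At;
  have [? ?] := XL t At i j; exact: is_derive_continuous.
Qed.

Lemma mcont_withinP {p q} (A : set R) (X : R -> 'M[R[i]]_(p, q)) :
  mcont A X <-> {within A, continuous X}.
Proof.
split=> [cX x|cX i j].
  by apply/cvg_mxP => i j; have [/(_ x) ? /(_ x) ?] := cX i j.
by split=> x; have /cvg_mxP/(_ i j)[] := cX x.
Qed.

Lemma mcont_ext {p q} (A : set R) (X Y : R -> 'M[R[i]]_(p, q)) :
  {in A, X =1 Y} -> mcont A X -> mcont A Y.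
Proof.
move=> XY /mcont_withinP cX; apply/mcont_withinP.
by apply: subspace_eq_continuous cX.
Qed.

Lemma is_derive_cvgP (f : R -> R) (t l : R) :
  is_derive t 1 f l <-> h^-1 * (f (t + h) - f t) @[h --> 0^'] --> l.
Proof.
have E : (fun h => h^-1 * (f (t + h) - f t)) =
         (fun h => h^-1 *: ((f \o shift t) (h *: 1) - f t)).
  apply/funext => h /=; rewrite /GRing.scale/= mulr1 [t + h]addrC//.
rewrite E; split.
  by move=> [/cvg_ex[m fm] <-]; rewrite /derive; apply/cvgP: fm.
move=> fl; split; first exact: (cvgP l).
by rewrite /derive; apply: cvg_lim fl.
Qed.

Lemma mder_cvgP {p q} (X : R -> 'M[R[i]]_(p, q)) t L :
  mder X t L <->
  ((h^-1)%:C)%C *: (X (t + h) - X t) @[h --> 0^'] --> L.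
Proof.
have E i j h : Re ((((h^-1)%:C)%C *: (X (t + h) - X t)) i j) =
    h^-1 * (Re (X (t + h) i j) - Re (X t i j)).
  by rewrite !mxE ReM/= mul0r subr0 ReD ReN.
have E' i j h : Im ((((h^-1)%:C)%C *: (X (t + h) - X t)) i j) =
    h^-1 * (Im (X (t + h) i j) - Im (X t i j)).
  by rewrite !mxE ImM/= mul0r addr0 ImD ImN.
rewrite cvg_mxP; split=> H i j.
  have [/is_derive_cvgP r /is_derive_cvgP m] := H i j.
  by split; [under eq_fun do rewrite E|under eq_fun do rewrite E'].
have [r m] := H i j; split; apply/is_derive_cvgP.
  by under eq_fun do rewrite -E.
by under eq_fun do rewrite -E'.
Qed.

End Calculus.

(** * Primitives of real functions *)

Section RealCalculus.
Context {R : realType}.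
Notation mu := (@lebesgue_measure R).

Lemma derive_ge0_le (f f' : R -> R) (a b : R) : a <= b ->
  {within `[a, b], continuous f} ->
  (forall x, a < x < b -> is_derive x 1 f (f' x)) ->
  (forall x, a < x < b -> 0 <= f' x) -> f a <= f b.
Proof.
move=> ab cf df f'0.
apply: (@ger0_derive1_le_cc _ f a b) => //; rewrite ?in_itv/= ?lexx ?ab//.
- by move=> x; rewrite in_itv/= => /df[].
- move=> x; rewrite in_itv/= => axb; have [? E] := df x axb.
  by rewrite derive1E E f'0.
Qed.

Lemma derive_eq_diff (f g d : R -> R) (a b : R) : a <= b ->
  {within `[a, b], continuous f} -> {within `[a, b], continuous g} ->
  (forall x, a < x < b -> is_derive x 1 f (d x)) ->
  (forall x, a < x < b -> is_derive x 1 g (d x)) -> f b - f a = g b - g a.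
Proof.
move=> ab cf cg df dg.
have H (u v : R -> R) : {within `[a, b], continuous u} ->
    {within `[a, b], continuous v} ->
    (forall x, a < x < b -> is_derive x 1 u (d x)) ->
    (forall x, a < x < b -> is_derive x 1 v (d x)) -> u b - u a <= v b - v a.
  move=> cu cv du dv.
  have : (v - u) a <= (v - u) b.
    apply: (@derive_ge0_le _ (fun x => d x - d x)) => // [x|x xab|x _].
    - by apply: cvgB; [exact: cv|exact: cu].
    - by apply: is_deriveB; [exact: dv|exact: du].
    - by rewrite subrr.
  by rewrite /= !fctE; lra.
by apply/eqP; rewrite eq_le !H.
Qed.

Definition clamp (a b x : R) : R := Num.max a (Num.min b x).

Lemma clamp_id a b x : a <= x <= b -> clamp a b x = x.
Proof. by move=> /andP[ax xb]; rewrite /clamp (min_idPr xb) (max_idPr ax). Qed.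

Lemma clamp_itv a b x : a <= b -> a <= clamp a b x <= b.
Proof. by move=> ab; rewrite /clamp le_max lexx ge_max ab ge_min lexx. Qed.

Lemma continuous_clamp_id a b : continuous (clamp a b).
Proof.
move=> x; apply: (@continuous_max R R (cst a) (fun y => Num.min b y)).
  exact: cst_continuous.
by apply: (@continuous_min R R (cst b) id); [exact: cst_continuous|].
Qed.

Lemma continuous_comp_within (T : topologicalType) (A : set R) (f : R -> T)
    (g : R -> R) : {within A, continuous f} -> continuous g ->
  (forall x, A (g x)) -> continuous (f \o g).
Proof.
move=> /subspace_continuousP cf cg gA x B /(cf _ (gA x)) H.
have := cg x _ H; apply: (@filterS _ (nbhs x)) => y /=.
by apply; exact: gA.
Qed.

Lemma continuous_clamp (T : topologicalType) a b (f : R -> T) : a <= b ->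
  {within `[a, b], continuous f} -> continuous (f \o clamp a b).
Proof.
move=> ab cf; apply: continuous_comp_within cf _ _ => [|x /=].
  exact: continuous_clamp_id.
by rewrite in_itv/= clamp_itv.
Qed.

Lemma continuous_itv_integrable (g : R -> R) a b : continuous g ->
  mu.-integrable `[a, b] (EFin \o g).
Proof.
move=> cg; apply: continuous_compact_integrable; first exact: segment_compact.
exact: continuous_subspaceT.
Qed.

Lemma antiderivative_gt (g : R -> R) (a : R) : continuous g ->
  exists G, forall x, a < x -> is_derive x 1 G (g x).
Proof.
move=> cg; exists (fun x => \int[mu]_(t in `[a, x]) g t)%R => x ax.
have x1 : x < x + 1 by rewrite ltrDl.
have [dG Gx] := continuous_FTC1_closed x1 (continuous_itv_integrable a (x + 1) cg)
   ax (cg x).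
by split; [exact: dG|rewrite -derive1E; exact: Gx].
Qed.

(** An integral from a base point gives a primitive to the right of it only;
    reflecting gives one to the left, and the two agree where both exist. *)
Lemma antiderivative (g : R -> R) : continuous g ->
  exists G, forall x : R, is_derive x (1 : R) G (g x).
Proof.
move=> cg.
have [G1 dG1] := antiderivative_gt (-1) cg.
have cg' : continuous (fun x => - g (- x)).
  by move=> x; apply: cvgN; apply: continuous_comp; [exact: opp_continuous|exact: cg].
have [G2 dG2] := antiderivative_gt (-1) cg'.
pose H x := G2 (- x).
have dH (x : R) : x < 1 -> is_derive x (1 : R) H (g x).
  move=> x1; have x1' : -1 < - x by rewrite ltrN2.
  have D := dG2 _ x1'; rewrite opprK in D.
  have := @is_derive1_comp _ G2 -%R x _ _ D (is_deriveNid x 1).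
  by rewrite mulrNN mulr1.
have E (x : R) : -1 < x < 1 -> H x = G1 x - G1 0 + H 0.
  move=> /andP[x1 x2].
  have cG1 a b : -1 < a -> {within `[a, b], continuous G1}.
    move=> a1; apply: continuous_in_subspaceT => y /set_mem/=.
    rewrite in_itv/= => /andP[ay _]; apply: (is_derive_continuous (l := g y)).
    by apply: dG1; exact: lt_le_trans ay.
  have cH a b : b < 1 -> {within `[a, b], continuous H}.
    move=> b1; apply: continuous_in_subspaceT => y /set_mem/=.
    rewrite in_itv/= => /andP[_ yb]; apply: (is_derive_continuous (l := g y)).
    by apply: dH; exact: le_lt_trans b1.
  have [x0|/ltW x0] := leP 0 x.
    suff : H x - H 0 = G1 x - G1 0 by move=> <-; rewrite subrK.
    apply: (@derive_eq_diff _ _ g) => //; [exact: cH|apply: cG1|..].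
    - by rewrite oppr_lt0.
    - by move=> y /andP[_ yx]; apply: dH; exact: lt_trans x2.
    - move=> y /andP[y0 _]; apply: dG1; apply: lt_trans y0.
      by rewrite oppr_lt0.
  suff : H 0 - H x = G1 0 - G1 x by lra.
  apply: (@derive_eq_diff _ _ g) => //; [apply: cH => //|exact: cG1|..].
  - by move=> y /andP[_ yx]; apply: dH; exact: lt_trans ltr01.
  - by move=> y /andP[y0 _]; apply: dG1; exact: lt_trans y0.
exists (fun x => if -1 < x then G1 x - G1 0 + H 0 else H x) => x.
have [x1|x1] := ltP (-1) x.
  apply: (@near_eq_is_derive _ _ _ (fun x => G1 x - G1 0 + H 0)).
    by near=> y; rewrite ifT//; near: y; exact: lt_nbhsr.
  have := is_deriveD (is_deriveB (dG1 x x1) (is_derive_cst (G1 0) x 1))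
     (is_derive_cst (H 0) x 1).
  by rewrite subr0 addr0.
have x1' : x < 1 by apply: le_lt_trans x1 _; rewrite ltrN10 || lra.
apply: (near_eq_is_derive _ (dH x x1')).
near=> y; case: ifPn => // y1; apply: E; rewrite y1/=.
by near: y; exact: lt_nbhsl.
Unshelve. all: by end_near. Qed.

Lemma antiderivative_cc (f : R -> R) (a b : R) : a <= b ->
  {within `[a, b], continuous f} ->
  exists2 P : R -> R, continuous P & forall x, a < x < b -> is_derive x 1 P (f x).
Proof.
move=> ab cf; have [P dP] := antiderivative (continuous_clamp ab cf).
exists P => x; first exact: is_derive_continuous.
move=> /andP[ax xb]; have := dP x.
by rewrite /= clamp_id// !ltW.
Qed.

(** For arbitrary nonnegative functions, since their integral is a supremum over
    the simple functions below them; the gauge will be known only piecewise. *)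
Lemma ge0_integral_mono (D E : set R) (f g : R -> \bar R) :
  (forall x, D x -> (0 <= f x)%E) -> (forall x, E x -> (0 <= g x)%E) ->
  D `<=` E -> (forall x, D x -> (f x <= g x)%E) ->
  (\int[mu]_(x in D) f x <= \int[mu]_(x in E) g x)%E.
Proof.
move=> f0 g0 DE fg; rewrite !ge0_integralE//.
apply: le_ereal_sup => _ [h hf <-]; exists h => // x.
apply: le_trans (hf x) _; rewrite /patch; case: ifPn => [/set_mem Dx|_].
  by rewrite mem_set; [exact: fg|exact: DE].
by case: ifPn => [/set_mem/g0|].
Qed.

(** Only the values of [h] in the open interval enter: the gauge jumps at the
    ends of the zones. *)
Lemma le_integral_of_primitive (f P : R -> R) (a b : R) (D : set R)
    (h : R -> \bar R) : a <= b ->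
  {within `[a, b], continuous f} -> (forall x, a <= x <= b -> 0 <= f x) ->
  {within `[a, b], continuous P} ->
  (forall x, a < x < b -> is_derive x 1 P (f x)) ->
  `]a, b[ `<=` D -> (forall x, D x -> (0 <= h x)%E) ->
  (forall x, a < x < b -> h x = (f x)%:E) ->
  ((P b - P a)%:E <= \int[mu]_(x in D) h x)%E.
Proof.
rewrite le_eqVlt => /predU1P[<- *|ab cf f0 cP dP abD h0 hf].
  by rewrite subrr integral_ge0.
have [_ Pa Pb] := (continuous_within_itvP P ab).1 cP.
rewrite EFinB -(@continuous_FTC2 _ f)//.
- rewrite (@integral_itv_bndoo _ a b _ true false); last first.
    apply/measurable_EFinP; apply: subspace_continuous_measurable_fun => //.
    by apply: continuous_subspaceW cf; exact: subset_itv_oo_cc.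
  apply: ge0_integral_mono => //.
  + by move=> x /=; rewrite in_itv/= => /andP[? ?]; rewrite lee_fin f0// !ltW.
  + by move=> x /=; rewrite in_itv/= => /hf ->.
- by split => // x; rewrite in_itv/= => /dP[].
- move=> x; rewrite in_itv/= => /dP[? E].
  by rewrite derive1E E.
Qed.

End RealCalculus.

(** * Gronwall's inequality *)

Section Gronwall.
Context {R : realType}.

Lemma is_derive_bigsum n (h : 'I_n -> R -> R) (t : R) (dh : 'I_n -> R) :
  (forall i, is_derive t 1 (h i) (dh i)) ->
  is_derive t (1 : R) (fun s => \sum_i h i s) (\sum_i dh i).
Proof.
move=> H; rewrite (_ : (fun s => _) = \sum_i h i); first exact: is_derive_sum.
by apply/funext => s; rewrite fct_sumE.
Qed.

Lemma is_derive_mxnorm2 {p q} (V : R -> 'M[R[i]]_(p, q)) (t : R) dV :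
  mder V t dV -> is_derive t (1 : R) (fun s => mxnorm2 (V s)) (2 * mxip (V t) dV).
Proof.
move=> VdV; rewrite /mxnorm2 /mxip mulr_sumr; apply: is_derive_bigsum => i.
rewrite mulr_sumr; apply: is_derive_bigsum => j.
have [r m] := VdV i j; apply: is_derive_eq.
by rewrite /GRing.scale/=; ring.
Qed.

(** The length of [V] is regularized to [w = sqrt (|V| ^+ 2 + e ^+ 2)], which
    is differentiable also where [V] vanishes.  The hypothesis bounds [|w'|] by
    [kap * w + f], so that [exp (- k) * w - P] decreases and [exp k * w + P]
    increases; these two facts are the two estimates. *)
Lemma gronwall {p q} (V dV : R -> 'M[R[i]]_(p, q)) (k kap P f : R -> R) (a b : R) :
  a <= b -> mcont `[a, b] V -> {within `[a, b], continuous k} ->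
  {within `[a, b], continuous P} ->
  (forall t, a < t < b -> [/\ mder V t (dV t), is_derive t 1 k (kap t),
    is_derive t 1 P (f t), 0 <= kap t & 0 <= f t]) ->
  (forall t, a < t < b -> `|mxip (V t) (dV t)|
     <= kap t * mxnorm2 (V t) + f t * mxnorm (V t)) ->
  mxnorm (V b) <= expR (k b - k a) * (mxnorm (V a) + (P b - P a)) /\
  mxnorm (V a) <= expR (k b - k a) * (mxnorm (V b) + (P b - P a)).
Proof.
move=> ab cV ck cP H ip.
pose w e t := Num.sqrt (mxnorm2 (V t) + e ^+ 2).
have Vw e t : mxnorm (V t) <= w e t.
  by rewrite ler_sqrt ?addr_ge0 ?mxnorm2_ge0 ?sqr_ge0// lerDl sqr_ge0.
have wV e t : 0 <= e -> w e t <= mxnorm (V t) + e.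
  move=> e0; rewrite -(@ler_pXn2r _ 2)// ?nnegrE ?addr_ge0 ?mxnorm_ge0 ?sqrtr_ge0//.
  rewrite sqr_sqrtr ?addr_ge0 ?mxnorm2_ge0 ?sqr_ge0// sqrrD mxnorm_sqr lerD2r.
  by rewrite lerDl mulrn_wge0// mulr_ge0 ?mxnorm_ge0.
have w0 e t : 0 < e -> 0 < w e t.
  by move=> e0; rewrite sqrtr_gt0 ltr_wpDl ?mxnorm2_ge0// exprn_gt0.
have cV2 : {within `[a, b], continuous (fun t => mxnorm2 (V t))}.
  rewrite (_ : (fun t => _) = (fun t => mxnorm (V t) * mxnorm (V t))).
    by move=> x; apply: cvgM; exact: (mcont_mxnorm cV).
  by apply/funext => t; rewrite -mxnorm_sqr expr2.
have cw e : {within `[a, b], continuous (w e)}.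
  move=> x; apply: (@cvg_comp _ _ _ _ (@Num.sqrt R)); last exact: sqrt_continuous.
  apply: cvgD; last exact: cvg_cst.
  exact: cV2.
have dw e t : 0 < e -> a < t < b ->
    is_derive t (1 : R) (w e) (mxip (V t) (dV t) / w e t).
  move=> e0 /H[VdV _ _ _ _].
  have pos : 0 < mxnorm2 (V t) + e ^+ 2.
    by rewrite ltr_wpDl ?mxnorm2_ge0// exprn_gt0.
  have D1 : is_derive t (1 : R) (fun s => mxnorm2 (V s) + e ^+ 2)
      (2 * mxip (V t) (dV t)).
    have := is_deriveD (is_derive_mxnorm2 VdV) (is_derive_cst (e ^+ 2) t 1).
    by rewrite addr0.
  have D2 := @is_derive1_comp _ Num.sqrt (fun s => mxnorm2 (V s) + e ^+ 2) t _ _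
     (is_derive1_sqrt pos) D1.
  apply: (is_derive_eq D2).
  rewrite -/(w e t); have := lt0r_neq0 (w0 e t e0) => w1.
  by field.
have bw e t : 0 < e -> a < t < b ->
    `|mxip (V t) (dV t) / w e t| <= kap t * w e t + f t.
  move=> e0 tab; rewrite normrM normfV (gtr0_norm (w0 e t e0)) ler_pdivrMr ?w0//.
  apply: le_trans (ip t tab) _; have [_ _ _ k0 f0] := H t tab.
  rewrite mulrDl lerD//; last by rewrite ler_wpM2l.
  rewrite -mulrA ler_wpM2l// -expr2 sqr_sqrtr ?lerDl ?sqr_ge0//.
  by rewrite addr_ge0 ?mxnorm2_ge0 ?sqr_ge0.
have kmono s t : a <= s -> s <= t -> t <= b -> k s <= k t.
  move=> sa st tb; apply: (@derive_ge0_le _ k kap) => //.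
  - apply: continuous_subspaceW ck => x/=; rewrite !in_itv/= => /andP[sx xt].
    by rewrite (le_trans sa sx) (le_trans xt tb).
  - move=> x /andP[sx xt]; have [] := H x; last by [].
    by rewrite (le_lt_trans sa sx) (lt_le_trans xt tb).
  - move=> x /andP[sx xt]; have [] := H x; last by [].
    by rewrite (le_lt_trans sa sx) (lt_le_trans xt tb).
have ck' (g : R -> R) : continuous g ->
    {within `[a, b], continuous (fun t => expR (g (k t)))}.
  move=> cg x; apply: (@cvg_comp _ _ _ (fun t => g (k t)) expR).
    by apply: (@cvg_comp _ _ _ k g); [exact: ck|exact: cg].
  exact: continuous_expR.
split.
  suff S e : 0 < e -> mxnorm (V b)
      <= expR (k b - k a) * (mxnorm (V a) + (P b - P a)) + e.
    by apply/ler_addgt0Pr => e e0; exact: S.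
  move=> e0; pose e' := e / expR (k b - k a).
  have e'0 : 0 < e' by rewrite divr_gt0 ?expR_gt0.
  pose phi t := - (expR (k a - k t) * w e' t - P t).
  have : phi a <= phi b.
    pose dphi t := - (expR (k a - k t) * (mxip (V t) (dV t) / w e' t - kap t * w e' t)
                       - f t).
    apply: (@derive_ge0_le _ phi dphi a b ab).
    - move=> x; apply: cvgN; apply: cvgB; last exact: cP.
      apply: cvgM; last exact: cw.
      by apply: (ck' (fun y => k a - y)) => y; apply: cvgB; [exact: cvg_cst|exact: cvg_id].
    - move=> t tab; have [VdV kt Pt _ _] := H t tab.
      have D1 : is_derive t (1 : R) (fun s => k a - k s) (0 - kap t).
        exact: is_deriveB (is_derive_cst (k a) t 1) kt.
      have D2 := @is_derive1_comp _ expR (fun s => k a - k s) t _ _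
        (is_derive_expR _) D1.
      have D3 := is_deriveN (is_deriveB (is_deriveM D2 (dw e' t e'0 tab)) Pt).
      by apply: (is_derive_eq D3); rewrite /dphi /GRing.scale/=; ring.
    - move=> t tab; have [_ _ _ k0 f0] := H t tab.
      have := bw e' t e'0 tab; move=> /ler_normlP[_ ub].
      have E1 : expR (k a - k t) <= 1.
        by rewrite expR_le1 subr_le0; apply: kmono; lra.
      have := expR_gt0 (k a - k t) => E0; rewrite /dphi.
      set E := expR _ in E0 E1 *; set m := _ / _ in ub *; nra.
  rewrite /phi subrr expR0 mul1r lerN2 => le1.
  have {le1} le2 : expR (k a - k b) * mxnorm (V b) <= mxnorm (V a) + e' + (P b - P a).
    apply: le_trans (_ : expR (k a - k b) * w e' b <= _).
      by rewrite ler_wpM2l ?expR_ge0.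
    have := wV e' a (ltW e'0); lra.
  rewrite -(@ler_pM2l _ (expR (k a - k b))) ?expR_gt0// mulrDr mulrA -expRD.
  rewrite addrA subrK subrr expR0 mul1r; apply: le_trans le2 _.
  have -> : expR (k a - k b) * e = e'.
    by rewrite /e' mulrC -expRN opprB.
  lra.
suff S e : 0 < e -> mxnorm (V a)
    <= expR (k b - k a) * (mxnorm (V b) + (P b - P a)) + e.
  by apply/ler_addgt0Pr => e e0; exact: S.
move=> e0; pose e' := e / expR (k b - k a).
have e'0 : 0 < e' by rewrite divr_gt0 ?expR_gt0.
pose phi t := expR (k t - k b) * w e' t + P t.
have : phi a <= phi b.
  pose dphi t := expR (k t - k b) * (mxip (V t) (dV t) / w e' t + kap t * w e' t)
                     + f t.
  apply: (@derive_ge0_le _ phi dphi a b ab).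
  - move=> x; apply: cvgD; last exact: cP.
    apply: cvgM; last exact: cw.
    by apply: (ck' (fun y => y - k b)) => y; apply: cvgB; [exact: cvg_id|exact: cvg_cst].
  - move=> t tab; have [VdV kt Pt _ _] := H t tab.
    have D1 : is_derive t (1 : R) (fun s => k s - k b) (kap t - 0).
      exact: is_deriveB kt (is_derive_cst (k b) t 1).
    have D2 := @is_derive1_comp _ expR (fun s => k s - k b) t _ _
        (is_derive_expR _) D1.
    have D3 := is_deriveD (is_deriveM D2 (dw e' t e'0 tab)) Pt.
    by apply: (is_derive_eq D3); rewrite /dphi /GRing.scale/=; ring.
  - move=> t tab; have [_ _ _ k0 f0] := H t tab.
    have := bw e' t e'0 tab; move=> /ler_normlP[lb _].
    have E1 : expR (k t - k b) <= 1.
      by rewrite expR_le1 subr_le0; apply: kmono; lra.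
    have := expR_gt0 (k t - k b) => E0; rewrite /dphi.
    set E := expR _ in E0 E1 *; set m := _ / _ in lb *; nra.
rewrite /phi subrr expR0 mul1r => le1.
have {le1} le2 : expR (k a - k b) * mxnorm (V a) <= mxnorm (V b) + e' + (P b - P a).
  apply: le_trans (_ : expR (k a - k b) * w e' a <= _).
    by rewrite ler_wpM2l ?expR_ge0.
  have := wV e' b (ltW e'0); lra.
rewrite -(@ler_pM2l _ (expR (k a - k b))) ?expR_gt0// mulrDr mulrA -expRD.
rewrite addrA subrK subrr expR0 mul1r; apply: le_trans le2 _.
have -> : expR (k a - k b) * e = e'.
  by rewrite /e' mulrC -expRN opprB.
lra.
Qed.

(** [gronwall] for [V - V a] with [kap = 0]. *)
Lemma mxnorm_increment {p q} (V dV : R -> 'M[R[i]]_(p, q)) (P f : R -> R) (a b : R) :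
  a <= b -> (forall t, a <= t <= b -> mder V t (dV t)) ->
  (forall t, a <= t <= b -> is_derive t (1 : R) P (f t)) ->
  (forall t, a <= t <= b -> mxnorm (dV t) <= f t) ->
  mxnorm (V b - V a) <= P b - P a.
Proof.
move=> ab dVd dP le.
have dW t : a <= t <= b -> mder (fun s => V s + - V a) t (dV t).
  move=> tab; have := mderD (dVd t tab) (mder_cst (- V a) t); rewrite addr0.
  exact.
have itvE t : `[a, b]%classic t -> a <= t <= b by rewrite /= in_itv.
have cst0 (A : set R) : {within A, continuous (fun=> 0 : R)}.
  by move=> x; exact: cvg_cst.
have cP : {within `[a, b], continuous P}.
  apply: continuous_in_subspaceT => t /set_mem/itvE/dP; exact: is_derive_continuous.
have := @gronwall _ _ (fun s => V s + - V a) dV (fun=> 0) (fun=> 0) P f a b ab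
  (mder_mcont (fun t tab => dW t (itvE t tab))) (cst0 _) cP.
case.
- move=> t /andP[/ltW ta /ltW tb]; split.
  + by apply: dW; rewrite ta.
  + exact: is_derive_cst.
  + by apply: dP; rewrite ta.
  + exact: lexx.
  + by apply: le_trans (mxnorm_ge0 _) (le t _); rewrite ta.
- move=> t /andP[/ltW ta /ltW tb]; rewrite mul0r add0r mulrC.
  apply: le_trans (normr_mxip_le _ _) _; rewrite ler_wpM2l ?mxnorm_ge0//.
  by apply: le; rewrite ta.
by rewrite !subrr mxnorm0 expR0 mul1r add0r.
Qed.

End Gronwall.

(** * Linear differential equations *)

Section LinearODE.
Context {R : realType}.

Lemma mder_comp {p q} (V : R -> 'M[R[i]]_(p, q)) (g : R -> R) (t c : R) L :
  mder V (g t) L -> is_derive t (1 : R) g c ->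
  mder (fun s => V (g s)) t ((c%:C)%C *: L).
Proof.
move=> VL gc i j; have [r m] := VL i j; rewrite mxE; split.
  have := @is_derive1_comp _ (fun s => Re (V s i j)) g t _ _ r gc.
  by rewrite ReM/= mul0r subr0 mulrC.
have := @is_derive1_comp _ (fun s => Im (V s i j)) g t _ _ m gc.
by rewrite ImM/= mul0r addr0 mulrC.
Qed.

Lemma mcont_comp {p q} (A : set R) (X : R -> 'M[R[i]]_(p, q)) (g : R -> R) :
  mcont A X -> continuous g -> (forall x, A (g x)) -> mcont setT (X \o g).
Proof.
move=> /mcont_withinP cX cg gA; apply/mcont_withinP.
apply: continuous_subspaceT.
exact: (@continuous_comp_within _ _ A X g cX cg gA).
Qed.

Lemma mcont_real {p q} (A : set R) (c : R -> R) (X : R -> 'M[R[i]]_(p, q)) :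
  {within A, continuous c} -> mcont A X -> mcont A (fun t => ((c t)%:C)%C *: X t).
Proof. by move=> cc; apply: mcontZ; split => // x; exact: cvg_cst. Qed.

Lemma matrix_primitive {p q} (X : R -> 'M[R[i]]_(p, q)) : mcont setT X ->
  exists Y : R -> 'M[R[i]]_(p, q), Y 0 = 0 /\ forall t, mder Y t (X t).
Proof.
move=> cX.
have prim (f : R -> R) : {within setT, continuous f} ->
    {G : R -> R | G 0 = 0 /\ forall x : R, is_derive x (1 : R) G (f x)}.
  move=> /(@continuous_subspace_setT R R f).2 cf; apply: cid.
  have [G dG] := antiderivative cf; exists (fun x => G x - G 0).
  split=> [|x]; first by rewrite subrr.
  have := is_deriveB (dG x) (is_derive_cst (G 0) x 1).
  by rewrite subr0.
pose r i j := projT1 (prim _ (proj1 (cX i j))).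
pose m i j := projT1 (prim _ (proj2 (cX i j))).
exists (fun t => \matrix_(i, j) (r i j t +i* m i j t)%C); split.
  apply/matrixP => i j; rewrite !mxE /r /m.
  by case: (prim _ _) => ? [/= -> _]; case: (prim _ _) => ? [/= -> _].
move=> t i j; split; under eq_fun do rewrite mxE/=.
  by rewrite /r; case: (prim _ _) => ? [/= _].
by rewrite /m; case: (prim _ _) => ? [/= _].
Qed.

(** The weight [expR (2 * c * `|t|)] absorbs the factor [c] of each integration
    and leaves the ratio [1 / 2]. *)
Lemma picard_bound {p q} (A : R -> 'M[R[i]]_p) (D : nat -> R -> 'M[R[i]]_(p, q))
    (S c M : R) : 0 < c -> 0 <= M ->
  (forall t, `|t| <= S -> mxnorm (A t) <= c) ->
  (forall t, `|t| <= S -> mxnorm (D 0%N t) <= M) ->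
  (forall k, D k.+1 0 = 0) ->
  (forall k t, `|t| <= S -> mder (D k.+1) t (A t *m D k t)) ->
  forall k t, `|t| <= S ->
    mxnorm (D k t) <= M * 2^-1 ^+ k * expR (2 * c * `|t|).
Proof.
move=> c0 M0 Ac D0 Dz dD; elim=> [|k IH] t tS.
  rewrite expr0 mulr1; apply: le_trans (D0 t tS) _; rewrite ler_peMr//.
  by rewrite -expR0 ler_expR mulr_ge0// mulr_ge0// ltW.
have step s : `|s| <= S -> mxnorm (A s *m D k s) <=
    M * 2^-1 ^+ k * expR (2 * c * `|s|) * c.
  move=> sS; apply: le_trans (mxnormM _ _) _; rewrite mulrC.
  by apply: ler_pM; rewrite ?mxnorm_ge0 ?IH ?Ac.
have scal (x : R) : is_derive x (1 : R) (fun s : R => 2 * c * s) (2 * c).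
  by apply: is_derive_eq; rewrite /GRing.scale/= mulr1.
have [t0|/ltW t0] := leP 0 t.
  pose P s := M * 2^-1 ^+ k.+1 * expR (2 * c * s).
  have dP (s : R) : is_derive s (1 : R) P (M * 2^-1 ^+ k * expR (2 * c * s) * c).
    have D1 := @is_derive1_comp _ expR (fun s => 2 * c * s) s _ _
       (is_derive_expR _) (scal s).
    have D2 := is_deriveM (is_derive_cst (M * 2^-1 ^+ k.+1) s 1) D1.
    apply: (is_derive_eq D2); rewrite /GRing.scale/= exprS.
    by field.
  have sS s : 0 <= s <= t -> `|s| <= S.
    by move=> /andP[s0 st]; rewrite ger0_norm//; apply: le_trans tS; rewrite ger0_norm.
  have := @mxnorm_increment _ _ _ (D k.+1) (fun s => A s *m D k s) P _ 0 t t0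
    (fun s st => dD k s (sS s st)) (fun s _ => dP s).
  rewrite Dz subr0 ger0_norm// => /(_ _)/le_trans; apply.
    move=> s st; apply: le_trans (step s (sS s st)) _.
    by case/andP: st => s0 _; rewrite ger0_norm.
  rewrite /P gerBl.
  by rewrite !mulr_ge0 ?expR_ge0 ?exprn_ge0 ?invr_ge0.
pose P s := - (M * 2^-1 ^+ k.+1 * expR (2 * c * - s)).
have dP (s : R) : is_derive s (1 : R) P (M * 2^-1 ^+ k * expR (2 * c * - s) * c).
  have D0' : is_derive s (1 : R) (fun s : R => 2 * c * - s) (- (2 * c)).
    by apply: is_derive_eq; rewrite /GRing.scale/= mulrN1.
  have D1 := @is_derive1_comp _ expR (fun s => 2 * c * - s) s _ _
     (is_derive_expR _) D0'.
  have D2 := is_deriveN (is_deriveM (is_derive_cst (M * 2^-1 ^+ k.+1) s 1) D1).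
  apply: (is_derive_eq D2); rewrite /GRing.scale/= exprS.
  by field.
have sS s : t <= s <= 0 -> `|s| <= S.
  by move=> /andP[s0 st]; rewrite ler0_norm//; apply: le_trans tS;
    rewrite ler0_norm// lerN2.
have := @mxnorm_increment _ _ _ (D k.+1) (fun s => A s *m D k s) P _ t 0 t0
  (fun s st => dD k s (sS s st)) (fun s _ => dP s).
rewrite Dz sub0r mxnormN ler0_norm// => /(_ _)/le_trans; apply.
  move=> s st; apply: le_trans (step s (sS s st)) _.
  by case/andP: st => _ s0; rewrite ler0_norm.
rewrite /P opprK addrC gerBl.
by rewrite !mulr_ge0 ?expR_ge0 ?exprn_ge0 ?invr_ge0.
Qed.

End LinearODE.

Section LinearODEExistence.
Context {R : realType}.

Lemma geometric_small (c e : R) : 0 < e -> exists K, c * 2^-1 ^+ K < e.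
Proof.
move=> e0; have : c * 2^-1 ^+ K @[K --> \oo] --> c * 0.
  apply: cvgM; first exact: cvg_cst.
  by apply: cvg_expr; rewrite ger0_norm ?invf_lt1 ?ltr1n.
rewrite mulr0 => /cvgrPdist_lt/(_ e e0)[K _ HK]; exists K.
have /= := HK K (leqnn K); rewrite sub0r normrN.
by apply: le_lt_trans; exact: ler_norm.
Qed.

Lemma uniform_limit_continuous_at (f : R -> R) (fK : nat -> R -> R) (c x : R) :
  (forall K, {for x, continuous (fK K)}) ->
  (\forall y \near x, forall K, `|f y - fK K y| <= c * 2^-1 ^+ K) ->
  {for x, continuous f}.
Proof.
move=> cfK near_f; apply/cvgrPdist_lt => e e0.
have e3 : 0 < e / 3 by rewrite divr_gt0.
have [K Ke] := geometric_small c e3.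
have fx : `|f x - fK K x| < e / 3.
  by apply: le_lt_trans Ke; exact: (nbhs_singleton near_f).
near=> y.
have fy : `|f y - fK K y| < e / 3.
  by apply: le_lt_trans Ke; near: y; apply: filterS near_f => y; exact.
have fxy : `|fK K x - fK K y| < e / 3.
  by near: y; move/cvgrPdist_lt : (cfK K); exact.
rewrite (_ : f x - f y = (f x - fK K x) + (fK K x - fK K y) - (f y - fK K y));
  last by ring.
apply: le_lt_trans (ler_normB _ _) _.
have := ler_normD (f x - fK K x) (fK K x - fK K y); lra.
Unshelve. all: by end_near. Qed.

Lemma continuous_bounded (f : R -> R) (S : R) : continuous f ->
  exists2 c : R, 0 < c & forall t, `|t| <= S -> f t <= c.
Proof.
move=> cf; have [S0|S0] := leP 0 S; last first.
  by exists 1 => // t tS; have := le_lt_trans tS S0; rewrite ltNge normr_ge0.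
have [x _ xmax] := @EVT_max _ f (- S) S (ge0_cp S0).2 (continuous_subspaceT cf).
exists (`|f x| + 1); first by rewrite ltr_wpDl.
move=> t; rewrite ler_norml => tS; apply: le_trans (xmax t _) _.
  by rewrite in_itv.
by rewrite (le_trans (ler_norm _))// lerDl.
Qed.

Lemma mcont_mxnorm_setT {p q} (X : R -> 'M[R[i]]_(p, q)) :
  mcont setT X -> continuous (fun t => mxnorm (X t)).
Proof. by move=> /mcont_mxnorm/(@continuous_subspace_setT R R _).2. Qed.

(** Picard iteration: the increments [D k] decay geometrically on each bounded
    interval, so that the partial sums converge there uniformly.  Instead of
    differentiating the limit [U], one compares it with a primitive [G] of
    [A *m U + F]: the partial sums minus [G] have small derivative. *)
Lemma linear_ode_exists {p q} (A : R -> 'M[R[i]]_p) (F : R -> 'M[R[i]]_(p, q))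
    (u0 : 'M[R[i]]_(p, q)) : mcont setT A -> mcont setT F ->
  exists U : R -> 'M[R[i]]_(p, q),
    U 0 = u0 /\ forall t, mder U t (A t *m U t + F t).
Proof.
move=> cA cF.
pose prim (X : R -> 'M[R[i]]_(p, q)) : R -> 'M[R[i]]_(p, q) :=
  xget (fun=> 0) [set Y | Y 0 = 0 /\ forall t, mder Y t (X t)].
have primP X : mcont setT X -> prim X 0 = 0 /\ forall t, mder (prim X) t (X t).
  by move=> /matrix_primitive H; rewrite /prim; exact: (xgetPex (fun=> 0) H).
pose D := fix D k := if k is k'.+1 then prim (fun t => A t *m D k' t)
                     else fun t => prim F t + u0.
have dD0 t : mder (D 0%N) t (F t).
  have := mderD ((primP F cF).2 t) (mder_cst u0 t); rewrite addr0; exact.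
have cD k : mcont setT (D k).
  elim: k => [|k IH]; first by apply: (mder_mcont (L := F)).
  have [_ dP] := primP _ (mcontM cA IH).
  by apply: (mder_mcont (L := fun t => A t *m D k t)) => t _; exact: dP.
have D_0 k : D k.+1 0 = 0 by exact: (primP _ (mcontM cA (cD k))).1.
have dD k t : mder (D k.+1) t (A t *m D k t).
  exact: (primP _ (mcontM cA (cD k))).2.
have bD S : exists2 C, 0 <= C & forall k t, `|t| <= S ->
    mxnorm (D k t) <= C * 2^-1 ^+ k.
  have [c c0 Ac] := continuous_bounded S (mcont_mxnorm_setT cA).
  have [M M0 DM] := continuous_bounded S (mcont_mxnorm_setT (cD 0%N)).
  exists (M * expR (2 * c * S)); first by rewrite mulr_ge0 ?expR_ge0// ltW.
  move=> k t tS; have := picard_bound c0 (ltW M0) Ac DM D_0 (fun k t _ => dD k t) k tS.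
  move=> /le_trans; apply; rewrite mulrAC ler_wpM2r ?exprn_ge0 ?invr_ge0//.
  by rewrite ler_pM2l// ler_expR ler_pM2l// mulr_gt0.
pose s K t := \sum_(0 <= k < K) D k t.
have sB S C : (forall k t, `|t| <= S -> mxnorm (D k t) <= C * 2^-1 ^+ k) ->
    forall K K' t, (K <= K')%N -> `|t| <= S ->
    mxnorm (s K' t - s K t) <= C * 2 * 2^-1 ^+ K.
  move=> DC K K' t KK' tS; rewrite /s -(subnKC KK').
  rewrite (@big_cat_nat _ _ _ K 0 (K + (K' - K)))//= ?leq_addr// addrAC subrr add0r.
  have C0 : 0 <= C.
    by have := DC 0%N t tS; rewrite expr0 mulr1; exact: le_trans (mxnorm_ge0 _).
  suff : mxnorm (\sum_(K <= k < K + (K' - K)) D k t)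
      <= C * 2 * (2^-1 ^+ K - 2^-1 ^+ (K + (K' - K))).
    move=> /le_trans; apply; rewrite ler_wpM2l ?mulr_ge0//.
    by rewrite gerBl exprn_ge0 ?invr_ge0.
  elim: (K' - K)%N => [|j IH].
    by rewrite addn0 big_geq// mxnorm0 subrr mulr0.
  rewrite addnS big_nat_recr ?leq_addr//=; apply: le_trans (mxnormD _ _) _.
  have := DC (K + j)%N t tS; rewrite exprS.
  have : 0 <= (2^-1 : R) ^+ (K + j) by rewrite exprn_ge0 ?invr_ge0.
  move: IH; set a := mxnorm _; set b := mxnorm _; set x := _ ^+ K; set y := _ ^+ _.
  by nra.
have cvg_s t : exists L : 'M[R[i]]_(p, q), s K t @[K --> \oo] --> L.
  have [C C0 DC] := bD `|t|.
  have cv (g : 'M[R[i]]_(p, q) -> R) : (forall X, `|g X| <= mxnorm X) ->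
      {morph g : x y / x + y} -> g 0 = 0 -> cvgn (fun K => g (s K t)).
    move=> gle gD g0; rewrite (_ : (fun K => _) = series (fun k => g (D k t))).
      apply: normed_cvg; apply: (@series_le_cvg _ _ (geometric C 2^-1)) => //.
      - by move=> k; exact: normr_ge0.
      - by move=> k; rewrite /geometric/= mulr_ge0 ?exprn_ge0 ?invr_ge0.
      - by move=> k; apply: le_trans (gle _) (DC _ _ _).
      - by apply: is_cvg_geometric_series; rewrite ger0_norm ?invf_lt1 ?ltr1n.
    by apply/funext => K; rewrite /s /series/= (big_morph g gD g0).
  exists (\matrix_(i, j) (limn (fun K => Re (s K t i j)) +i*
      limn (fun K => Im (s K t i j)))%C).
  apply/cvg_mxP => i j; rewrite mxE/=; split.
    apply: (cv (fun X => Re (X i j))) => [X|X Y|]; rewrite ?mxE ?ReD//.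
    exact: Re_le_mxnorm.
  apply: (cv (fun X => Im (X i j))) => [X|X Y|]; rewrite ?mxE ?ImD//.
  exact: Im_le_mxnorm.
have [U sU] := choice cvg_s.
have UB S C : (forall k t, `|t| <= S -> mxnorm (D k t) <= C * 2^-1 ^+ k) ->
    forall K t, `|t| <= S -> mxnorm (U t - s K t) <= C * 2 * 2^-1 ^+ K.
  move=> DC K t tS.
  have : mxnorm (s K' t - s K t) @[K' --> \oo] --> mxnorm (U t - s K t).
    apply: cvg_mxnorm; apply/cvg_mxP => i j.
    have /cvg_mxP/(_ i j)[cr ci] := sU t.
    split; under eq_fun do rewrite !mxE ?ReD ?ImD; rewrite !mxE ?ReD ?ImD.
      by apply: cvgD => //; exact: cvg_cst.
    by apply: cvgD => //; exact: cvg_cst.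
  move=> cv; apply: (cvgr_to_le cv).
  by exists K => // K' /= KK'; exact: (sB S C).
have ds K t : mder (s K.+1) t (A t *m s K t + F t).
  rewrite (_ : s K.+1 = fun t => D 0%N t + \sum_(0 <= k < K) D k.+1 t); last first.
    by apply/funext => t'; rewrite /s big_nat_recl.
  rewrite addrC mulmx_sumr; apply: mderD; first exact: dD0.
  by apply: mder_sum => k _; exact: dD.
have cs K : mcont setT (s K) by apply: mcont_sum => k _; exact: cD.
have cU : mcont setT U.
  have near_b : forall x : R, exists C, \forall y \near x,
      forall K, mxnorm (U y - s K y) <= C * 2^-1 ^+ K.
    move=> x; have [C C0 DC] := bD (`|x| + 1); exists (C * 2).
    near=> y => K; apply: (UB _ _ DC).
    have : `|x - y| < 1 by near: y; exact: cvgr_dist_lt.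
    have := ler_distD x 0 y; rewrite sub0r normrN sub0r normrN.
    by lra.
  have cR (f : R -> R) : {within setT, continuous f} -> continuous f.
    by move=> /(@continuous_subspace_setT R R _).2.
  move=> i j; split; apply: continuous_subspaceT => x; have [C near_x] := near_b x.
    apply: (@uniform_limit_continuous_at _ (fun K t => Re (s K t i j)) C).
      by move=> K; exact: (cR _ (cs K i j).1).
    apply: filterS near_x => y H K; apply: le_trans (H K).
    by have := Re_le_mxnorm (U y - s K y) i j; rewrite !mxE ReD ReN.
  apply: (@uniform_limit_continuous_at _ (fun K t => Im (s K t i j)) C).
    by move=> K; exact: (cR _ (cs K i j).2).
  apply: filterS near_x => y H K; apply: le_trans (H K).
  by have := Im_le_mxnorm (U y - s K y) i j; rewrite !mxE ImD ImN.
have [G [G0 dG]] := matrix_primitive (mcontD (mcontM cA cU) cF).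
have UE t : U t = G t + u0.
  have [C C0 DC] := bD `|t|.
  have [c c0 Ac] := continuous_bounded `|t| (mcont_mxnorm_setT cA).
  have e0 : mxnorm (U t - (G t + u0)) = 0.
    apply/eqP; rewrite eq_le mxnorm_ge0 andbT.
    apply/ler_addgt0Pr => e e0; rewrite add0r.
    have [K Ke] := geometric_small (C * 2 + c * (C * 2) * `|t|) e0.
    apply: ltW; apply: le_lt_trans Ke.
    pose W t := s K.+1 t + - 1%:C%C *: G t.
    have WD t' : mder W t' (A t' *m (s K t' - U t')).
      have := mderD (ds K t') (mderZ (cder_cst (- 1%:C%C) t') (dG t')).
      rewrite scale0r add0r mulmxBr.
      rewrite (_ : A t' *m s K t' + F t' + - 1%:C%C *: (A t' *m U t' + F t') =
        A t' *m s K t' - A t' *m U t') //.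
      by rewrite scaleNr scale1r opprD addrACA subrr addr0.
    have W0 : W 0 = u0.
      rewrite /W G0 scaler0 addr0 /s big_nat_recl// big1 ?addr0.
        by rewrite /D (primP F cF).1 add0r.
      by move=> k _; exact: D_0.
    have WB t' : `|t'| <= `|t| -> mxnorm (A t' *m (s K t' - U t'))
        <= c * (C * 2 * 2^-1 ^+ K).
      move=> tt; apply: le_trans (mxnormM _ _) _.
      apply: ler_pM; rewrite ?mxnorm_ge0 ?Ac//.
      by rewrite -mxnormN opprB; exact: (UB _ _ DC).
    have dlin (x : R) : is_derive x (1 : R)
        (fun y : R => c * (C * 2 * 2^-1 ^+ K) * y) (c * (C * 2 * 2^-1 ^+ K)).
      by apply: is_derive_eq; rewrite /GRing.scale/= mulr1.
    have Wt : mxnorm (W t - u0) <= c * (C * 2 * 2^-1 ^+ K) * `|t|.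
      have [t0|/ltW t0] := leP 0 t.
        have := @mxnorm_increment _ _ _ W _ _ _ 0 t t0
          (fun t' _ => WD t') (fun t' _ => dlin t').
        rewrite W0 mulr0 subr0; rewrite {1}(ger0_norm t0); apply => t' /andP[t'0 t't].
        by apply: WB; rewrite !ger0_norm.
      have := @mxnorm_increment _ _ _ W _ _ _ t 0 t0
        (fun t' _ => WD t') (fun t' _ => dlin t').
      rewrite W0 mulr0 sub0r -mxnormN opprB -mulrN (ler0_norm t0).
      apply => t' /andP[t't t'0].
      by apply: WB; rewrite !ler0_norm ?lerN2.
    rewrite (_ : U t - (G t + u0) = (U t - s K.+1 t) + (W t - u0)); last first.
      rewrite /W scaleNr scale1r opprD !addrA; congr (_ + _).
      by rewrite subrK.
    apply: le_trans (mxnormD _ _) _.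
    have := UB _ _ DC K.+1 t (lexx _); rewrite exprS.
    have : 0 <= (2^-1 : R) ^+ K by rewrite exprn_ge0 ?invr_ge0.
    move: Wt; set a := mxnorm _; set b := mxnorm _; set x := _ ^+ K; set y := `|t|.
    by nra.
  by apply/eqP; rewrite -subr_eq0; apply/eqP; exact: mxnorm_eq0 e0.
exists U; split=> [|t]; first by rewrite UE G0 add0r.
rewrite {1}(_ : U = fun t => G t + u0); last by apply/funext.
have := mderD (dG t) (mder_cst u0 t); rewrite addr0; exact.
Unshelve. all: by end_near. Qed.

End LinearODEExistence.

(** * Solutions on a half-open interval *)

Section OneSidedDerivative.
Context {R : realType}.

(** For fixed [xi], this is [is_dt (strip T)]. *)
Definition sder {p q} (T : R) (u : R -> 'M[R[i]]_(p, q)) (t : R)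
    (l : 'M[R[i]]_(p, q)) : Prop :=
  (fun h : R => (h^-1)%:C%C *: (u (t + h) - u t))
    @ within [set h | 0 < t + h <= T] 0^' --> l.

Lemma is_dt_mder {d p q} (V : set (R * 'rV[R]_d))
    (f : R -> 'rV[R]_d -> 'M[R[i]]_(p, q)) t xi l :
  (\forall h \near (0 : R), V (t + h, xi)) -> is_dt V f t xi l ->
  mder (f^~ xi) t l.
Proof.
move=> nV /= H; apply/mder_cvgP; apply: cvg_trans H.
apply: cvg_app => B /= H.
near=> h; have : V (t + h, xi) by near: h; exact: nbhs_dnbhs.
by near: h; exact: H.
Unshelve. all: by end_near.
Qed.

Lemma sder_mder {p q} (T : R) (u : R -> 'M[R[i]]_(p, q)) t l : 0 < t < T ->
  sder T u t l -> mder u t l.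
Proof.
move=> /andP[t0 tT].
apply: (@is_dt_mder 0 _ _ [set x | 0 < x.1 <= T] (fun t _ => u t) t 0).
have c : (fun h : R => t + h) @ (0 : R) --> t.
  rewrite -[X in _ --> X]addr0; apply: cvgD; [exact: cvg_cst|exact: cvg_id].
near=> h => /=; apply/andP; split.
  by near: h; exact: (cvgr_gt t).
by apply: ltW; near: h; exact: (cvgr_lt t).
Unshelve. all: by end_near. Qed.

Lemma mder_sder {p q} (T : R) (u v : R -> 'M[R[i]]_(p, q)) t l : 0 < t <= T ->
  (forall s, 0 < s <= T -> u s = v s) -> mder v t l -> sder T u t l.
Proof.
move=> tT uv /mder_cvgP H; rewrite /sder.
have {}H : (fun h : R => (h^-1)%:C%C *: (v (t + h) - v t))
    @ within [set h | 0 < t + h <= T] 0^' --> l.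
  by apply: cvg_trans H; apply: cvg_app; exact: cvg_within.
apply: cvg_trans H; apply: near_eq_cvg.
near=> h; have hT : 0 < t + h <= T by near: h; exact: withinT.
by rewrite /= !uv.
Unshelve. all: by end_near. Qed.

Lemma sderD {p q} (T : R) (u v : R -> 'M[R[i]]_(p, q)) t k l :
  sder T u t k -> sder T v t l -> sder T (fun s => u s + v s) t (k + l).
Proof.
rewrite /sder !cvg_mxP => uk vl i j.
have [ur um] := uk i j; have [vr vm] := vl i j; rewrite mxE ReD ImD.
pose dq (w : R -> 'M[R[i]]_(p, q)) h := (h^-1)%:C%C *: (w (t + h) - w t).
have E h : dq (fun s => u s + v s) h i j = dq u h i j + dq v h i j.
  by rewrite /dq !mxE -mulrDr opprD addrACA.
split.
  rewrite (_ : (fun h => _) = (fun h => Re (dq u h i j) + Re (dq v h i j))).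
    exact: cvgD ur vr.
  by apply/funext => h; rewrite -ReD -E.
rewrite (_ : (fun h => _) = (fun h => Im (dq u h i j) + Im (dq v h i j))).
  exact: cvgD um vm.
by apply/funext => h; rewrite -ImD -E.
Qed.

Lemma sderM {p q r} (T : R) (u : R -> 'M[R[i]]_(p, q)) (B : 'M[R[i]]_(q, r)) t k :
  sder T u t k -> sder T (fun s => u s *m B) t (k *m B).
Proof.
move=> uk; rewrite /sder.
have E : (fun h : R => (h^-1)%:C%C *: (u (t + h) *m B - u t *m B)) =
  (fun h : R => ((h^-1)%:C%C *: (u (t + h) - u t)) *m B).
  by apply/funext => h; rewrite -mulmxBl scalemxAl.
rewrite E; apply/cvg_mx_coordP => i j.
rewrite mxE; under eq_fun do rewrite mxE.
apply: cvg_big => [|s _]; first by apply: add_continuous.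
apply: cvgM; last exact: cvg_cst.
by have /cvg_mx_coordP := uk; apply.
Qed.

Lemma within_continuous_of_quotient (f : R -> R) (A : set R) (t l : R) :
  (fun h => h^-1 * (f (t + h) - f t)) @ within [set h | A (t + h)] 0^' --> l ->
  f x @[x --> within A (nbhs t)] --> f t.
Proof.
move=> H.
have {}H : (fun h => h * (h^-1 * (f (t + h) - f t)))
    @ within [set h | A (t + h)] 0^' --> 0 * l.
  by apply: cvgM H; apply: cvg_trans; [exact: cvg_within|exact: nbhs_dnbhs].
apply/cvgrPdist_lt => e e0; move: H; rewrite mul0r => /cvgrPdist_lt/(_ e e0) H.
rewrite /dnbhs /within/= in H.
have c : (fun x => x - t) @ t --> 0.
  by rewrite -(subrr t); apply: cvgB; [exact: cvg_id|exact: cvg_cst].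
have {}H : \forall x \near t, x - t != 0 -> A (t + (x - t)) ->
    `|0 - (x - t) * ((x - t)^-1 * (f (t + (x - t)) - f t))| < e.
  exact: (c _ H).
near=> x; have [->|xt] := eqVneq x t; first by rewrite subrr normr0.
have Ax : A x by near: x; exact: withinT.
have : x - t != 0 -> A (t + (x - t)) ->
    `|0 - (x - t) * ((x - t)^-1 * (f (t + (x - t)) - f t))| < e.
  by near: x; exact: cvg_within.
rewrite subr_eq0 => /(_ xt); rewrite addrC subrK => /(_ Ax).
by rewrite mulrA divff ?subr_eq0// mul1r sub0r opprB.
Unshelve. all: by end_near. Qed.

Lemma sder_mcont {p q} (T : R) (u l : R -> 'M[R[i]]_(p, q)) :
  (forall t, 0 < t <= T -> sder T u t (l t)) -> mcont `]0, T] u.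
Proof.
move=> H i j; split; apply/subspace_continuousP => t; rewrite /= in_itv/= => tT;
  have /cvg_mxP/(_ i j)[r m] := H t tT.
  have -> : `]0, T]%classic = [set x | 0 < x <= T].
    by apply/seteqP; split => x /=; rewrite in_itv.
  apply: (@within_continuous_of_quotient (fun x => Re (u x i j)) _ t (Re (l t i j))).
  move: r; under eq_fun do rewrite !mxE ReM/= mul0r subr0 ReD ReN; exact.
have -> : `]0, T]%classic = [set x | 0 < x <= T].
  by apply/seteqP; split => x /=; rewrite in_itv.
apply: (@within_continuous_of_quotient (fun x => Im (u x i j)) _ t (Im (l t i j))).
move: m; under eq_fun do rewrite !mxE ImM/= mul0r addr0 ImD ImN; exact.
Qed.

(** In the variable [s] with [t = T * expR s] the interval [`]0, T]] becomes a
    half-line, and the coefficients extend to all real [s] by freezing them at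
    [t = T]. *)
Lemma linear_ode_exists_oc {p q} (T : R) (a : R -> 'M[R[i]]_p)
    (f : R -> 'M[R[i]]_(p, q)) (u0 : 'M[R[i]]_(p, q)) : 0 < T ->
  mcont `]0, T] a -> mcont `]0, T] f ->
  exists u : R -> 'M[R[i]]_(p, q), u T = u0 /\
    forall t, 0 < t <= T -> sder T u t (a t *m u t + f t).
Proof.
move=> T0 ca cf.
pose tau s : R := Num.min T (T * expR s).
have ctau : continuous tau.
  move=> s; apply: (@continuous_min R R (cst T) (fun s => T * expR s)).
    exact: cst_continuous.
  by apply: cvgM; [exact: cvg_cst|exact: continuous_expR].
have tauT s : `]0, T]%classic (tau s).
  by rewrite /= in_itv/= lt_min T0 mulr_gt0 ?expR_gt0//= ge_min lexx.
have cr : {within setT, continuous (fun s : R => T * expR s)}.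
  apply: continuous_subspaceT => s.
  by apply: cvgM; [exact: cvg_cst|exact: continuous_expR].
have [V [V0 dV]] := @linear_ode_exists _ _ _ _ _ u0
  (mcont_real cr (mcont_comp ca ctau tauT)) (mcont_real cr (mcont_comp cf ctau tauT)).
exists (fun t => V (ln t - ln T)); split; first by rewrite subrr.
move=> t /andP[t0 tT].
apply: (@mder_sder _ _ T _ (fun t => V (ln t - ln T))) => //; first by rewrite t0.
have tE : T * expR (ln t - ln T) = t.
  by rewrite expRD expRN !lnK ?posrE// mulrCA divff ?mulr1// lt0r_neq0.
have tauE : tau (ln t - ln T) = t by rewrite /tau tE; exact/min_idPr.
have dln : is_derive t (1 : R) (fun x => ln x - ln T) t^-1.
  have := is_deriveB (is_derive1_ln t0) (is_derive_cst (ln T) t 1).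
  by rewrite subr0.
have := @mder_comp _ _ _ V (fun x => ln x - ln T) t _ _ (dV (ln t - ln T)) dln.
rewrite /= tauE tE -scalemxAl -scalerDr scalerA -rmorphM/= mulVf ?lt0r_neq0//.
by rewrite scale1r.
Qed.

End OneSidedDerivative.

(** * Scattering from two-sided estimates *)

Section AbstractScattering.
Context {R : realType} {n : nat}.
Notation mu := (@lebesgue_measure R).
Variables (T : R) (a G : R -> 'M[R[i]]_n).
Hypothesis T0 : 0 < T.
Hypothesis ca : mcont `]0, T] a.
Hypothesis Gunit : forall t, 0 < t <= T -> G t \in unitmx.

Definition sol {q} (f u : R -> 'M[R[i]]_(n, q)) : Prop :=
  forall t, 0 < t <= T -> sder T u t (a t *m u t + f t).

(** [intnorm (applyA G F)] at a single [xi]. *)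
Definition gint (f : R -> 'cV[R[i]]_n) (t : R) : \bar R :=
  (\int[mu]_(s in `]0%R, t]) (mxnorm (G s *m f s))%:E)%E.

(** [J] stands for a finite bound of the integral, which itself may be infinite. *)
Definition two_sided_estimate (C : R) : Prop :=
  forall f u : R -> 'cV[R[i]]_n, mcont `]0, T] f -> sol f u ->
  forall s t J, 0 < s -> s <= t -> t <= T -> (gint f t <= J%:E)%E ->
    mxnorm (G t *m u t) <= C * (mxnorm (G s *m u s) + J) /\
    mxnorm (G s *m u s) <= C * (mxnorm (G t *m u t) + J).

Definition has_limits : Prop :=
  forall f u : R -> 'cV[R[i]]_n, mcont `]0, T] f -> sol f u ->
  (gint f T < +oo)%E ->
  exists v : 'cV[R[i]]_n, G t *m u t @[t --> 0^'+] --> v.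

Variable C : R.
Hypothesis est : two_sided_estimate C.
Hypothesis lims : has_limits.

Lemma gint0 t : gint (fun=> 0%R) t = 0%E.
Proof.
rewrite /gint; under eq_integral do rewrite mulmx0 mxnorm0.
by rewrite integral0.
Qed.

Lemma gint_le f s t : s <= t -> (gint f s <= gint f t)%E.
Proof.
move=> st; apply: ge0_integral_mono => // [x _|x _|]; rewrite ?lee_fin ?mxnorm_ge0//.
by move=> x /=; rewrite !in_itv/= => /andP[-> xs]; exact: le_trans st.
Qed.

Lemma gint_ge0 f t : (0 <= gint f t)%E.
Proof. by apply: integral_ge0 => x _; rewrite lee_fin mxnorm_ge0. Qed.

Lemma sol_exists q (f : R -> 'M[R[i]]_(n, q)) (u0 : 'M[R[i]]_(n, q)) :
  mcont `]0, T] f -> exists u, u T = u0 /\ sol f u.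
Proof. by move=> cf; exact: linear_ode_exists_oc. Qed.

Lemma solM q r (u : R -> 'M[R[i]]_(n, q)) (B : 'M[R[i]]_(q, r)) :
  sol (fun=> 0) u -> sol (fun=> 0) (fun t => u t *m B).
Proof.
move=> su t tT; have := sderM (B := B) (su t tT).
by rewrite !addr0 mulmxA.
Qed.

Lemma solD q (f g u v : R -> 'M[R[i]]_(n, q)) :
  sol f u -> sol g v -> sol (fun t => f t + g t) (fun t => u t + v t).
Proof.
move=> su sv t tT; have := sderD (su t tT) (sv t tT).
by rewrite mulmxDr addrACA.
Qed.

Lemma solB (f u v : R -> 'cV[R[i]]_n) :
  sol f u -> sol f v -> sol (fun=> 0) (fun t => u t - v t).
Proof.
move=> su sv t tT; have := sderD (su t tT) (sderM (B := - 1%:M) (sv t tT)).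
have -> : (fun s => u s + v s *m - 1%:M) = (fun s => u s - v s).
  by apply/funext => s; rewrite mulmxN mulmx1.
by rewrite mulmxN mulmx1 addr0 mulmxBr opprD addrACA subrr addr0.
Qed.

Lemma gauge_norm_eq0 (t : R) (v : 'cV[R[i]]_n) :
  0 < t <= T -> mxnorm (G t *m v) <= 0 -> v = 0.
Proof.
move=> tT v0; apply: (can_inj (mulKmx (Gunit tT))); rewrite mulmx0.
by apply: mxnorm_eq0; apply/eqP; rewrite eq_le v0 mxnorm_ge0.
Qed.

(** The difference solves the homogeneous equation, and the backward estimate
    from [T] makes it vanish. *)
Lemma sol_unique (f u v : R -> 'cV[R[i]]_n) :
  sol f u -> sol f v -> u T = v T -> forall t, 0 < t <= T -> u t = v t.
Proof.
move=> su sv uvT t /[dup] tT' /andP[t0 tT]; apply/eqP; rewrite -subr_eq0; apply/eqP.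
have g0 : (gint (fun=> 0%R) T <= 0%:E)%E by rewrite gint0.
have [_] := est (mcont_cst _ _) (solB su sv) t0 tT (lexx T) g0.
by rewrite uvT subrr mulmx0 mxnorm0 addr0 mulr0; exact: gauge_norm_eq0.
Qed.

Lemma limit_le (f u : R -> 'cV[R[i]]_n) v t J : mcont `]0, T] f -> sol f u ->
  G t *m u t @[t --> 0^'+] --> v -> 0 < t <= T -> (gint f t <= J%:E)%E ->
  mxnorm v <= C * (mxnorm (G t *m u t) + J).
Proof.
move=> cf su uv /andP[t0 tT] fJ.
apply: (cvgr_to_le (cvg_mxnorm uv)); near=> s.
have s0 : 0 < s by near: s; exact: nbhs_right_gt.
have st : s <= t by near: s; exact: nbhs_right_le.
exact: (est cf su s0 st tT fJ).2.
Unshelve. all: by end_near. Qed.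

Lemma le_limit (f u : R -> 'cV[R[i]]_n) v t J : mcont `]0, T] f -> sol f u ->
  G t *m u t @[t --> 0^'+] --> v -> 0 < t <= T -> (gint f t <= J%:E)%E ->
  mxnorm (G t *m u t) <= C * (mxnorm v + J).
Proof.
move=> cf su uv /andP[t0 tT] fJ.
have cv : C * (mxnorm (G s *m u s) + J) @[s --> 0^'+] --> C * (mxnorm v + J).
  apply: cvgM; first exact: cvg_cst.
  by apply: cvgD; [exact: cvg_mxnorm uv|exact: cvg_cst].
apply: (cvgr_to_ge cv); near=> s.
have s0 : 0 < s by near: s; exact: nbhs_right_gt.
have st : s <= t by near: s; exact: nbhs_right_le.
exact: (est cf su s0 st tT fJ).1.
Unshelve. all: by end_near. Qed.

Lemma injective_unitmx (W : 'M[R[i]]_n) :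
  (forall c : 'cV[R[i]]_n, W *m c = 0 -> c = 0) -> W \in unitmx.
Proof.
move=> W0; rewrite -unitmx_tr -row_free_unit; apply: inj_row_free => v /(congr1 trmx).
by rewrite trmx_mul trmxK trmx0 => /W0/(congr1 trmx); rewrite trmxK trmx0.
Qed.

Lemma cvg_matrixD p q (F : set_system R) {FF : Filter F}
    (X Y : R -> 'M[R[i]]_(p, q)) (K L : 'M[R[i]]_(p, q)) :
  X x @[x --> F] --> K -> Y x @[x --> F] --> L -> X x + Y x @[x --> F] --> K + L.
Proof.
rewrite !cvg_mx_coordP => XK YL i j; rewrite mxE; under eq_fun do rewrite mxE.
by apply: cvgD; [exact: XK|exact: YL].
Qed.

Lemma cvg_matrixMr p q r (F : set_system R) {FF : Filter F}
    (X : R -> 'M[R[i]]_(p, q)) (K : 'M[R[i]]_(p, q)) (B : 'M[R[i]]_(q, r)) :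
  X x @[x --> F] --> K -> X x *m B @[x --> F] --> K *m B.
Proof.
rewrite !cvg_mx_coordP => XK i j; rewrite mxE; under eq_fun do rewrite mxE.
apply: cvg_big => [|k _]; first by apply: add_continuous.
by apply: cvgM; [exact: XK|exact: cvg_cst].
Qed.

(** The limits of the homogeneous solutions depend linearly on their values at
    [T], through a matrix [W] which is injective by [le_limit], hence onto. *)
Lemma scattering_solution_exists (f : R -> 'cV[R[i]]_n) (v : 'cV[R[i]]_n) :
  mcont `]0, T] f -> (gint f T < +oo)%E ->
  exists u, sol f u /\ (G t *m u t @[t --> 0^'+] --> v).
Proof.
move=> cf fT.
have TT : 0 < T <= T by rewrite T0 lexx.
have [U [UT sU]] := sol_exists 1%:M (mcont_cst `]0, T] (0 : 'M[R[i]]_n)).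
have /choice[w Uw] : forall j : 'I_n, exists w : 'cV[R[i]]_n,
    G t *m (U t *m delta_mx j 0) @[t --> 0^'+] --> w.
  move=> j; apply: lims (mcont_cst _ _) (solM (B := _) sU) _.
  by rewrite gint0 ltry.
pose W := \matrix_(i, j) w j i 0.
have GUW : G t *m U t @[t --> 0^'+] --> W.
  apply/cvg_mx_coordP => i j; rewrite mxE.
  have /cvg_mx_coordP/(_ i 0) := Uw j.
  by under eq_fun do rewrite mulmxA -colE mxE.
have GUc (c : 'cV[R[i]]_n) : G t *m (U t *m c) @[t --> 0^'+] --> W *m c.
  by under eq_fun do rewrite mulmxA; exact: cvg_matrixMr.
have Wunit : W \in unitmx.
  apply: injective_unitmx => c Wc0.
  have g0 : (gint (fun=> 0%R) T <= 0%:E)%E by rewrite gint0.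
  have := le_limit (mcont_cst _ _) (solM (B := c) sU) (GUc c) TT g0.
  by rewrite Wc0 mxnorm0 addr0 mulr0 UT mul1mx => /(gauge_norm_eq0 TT).
have [u0 [_ su0]] := sol_exists 0 cf.
have [v0 u0v0] := lims cf su0 fT.
pose c := invmx W *m (v - v0).
exists (fun t => u0 t + U t *m c); split.
  have := solD su0 (solM (B := c) sU); rewrite (_ : (fun t => f t + 0) = f)//.
  by apply/funext => t; rewrite addr0.
have <- : v0 + W *m c = v by rewrite /c mulKVmx// subrKC.
under eq_fun do rewrite mulmxDr.
exact: (cvg_matrixD u0v0 (GUc c)).
Qed.

Lemma scattering_solution_unique (f u u' : R -> 'cV[R[i]]_n) (v : 'cV[R[i]]_n) :
  sol f u -> sol f u' -> G t *m u t @[t --> 0^'+] --> v ->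
  G t *m u' t @[t --> 0^'+] --> v -> forall t, 0 < t <= T -> u t = u' t.
Proof.
move=> su su' uv u'v t tT; apply/eqP; rewrite -subr_eq0; apply/eqP.
have g0 : (gint (fun=> 0%R) t <= 0%:E)%E by rewrite gint0.
have lim0 : G t *m (u t - u' t) @[t --> 0^'+] --> (0 : 'cV[R[i]]_n).
  under eq_fun do rewrite mulmxBr -(mulmx1 (G _ *m u' _)) -mulmxN.
  have <- : v + v *m - 1%:M = 0 by rewrite mulmxN mulmx1 subrr.
  exact: (cvg_matrixD uv (cvg_matrixMr (B := - 1%:M) u'v)).
have := le_limit (mcont_cst _ _) (solB su su') lim0 tT g0.
by rewrite mxnorm0 addr0 mulr0; exact: gauge_norm_eq0.
Qed.

End AbstractScattering.

(** * Gauged systems with integrable coefficients *)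

Section ZoneEstimates.
Context {R : realType}.
Notation mu := (@lebesgue_measure R).

Lemma mxipDr {p q} (A B D : 'M[R[i]]_(p, q)) : mxip A (B + D) = mxip A B + mxip A D.
Proof.
rewrite /mxip -big_split/=; apply: eq_bigr => i _; rewrite -big_split/=.
by apply: eq_bigr => j _; rewrite mxE ReD ImD; ring.
Qed.

(** [Gam] conjugates the system into one with coefficient [K]. *)
Definition gauge_eq {n} (a Gam K : R -> 'M[R[i]]_n) (t : R) : Prop :=
  exists2 dGam, mder Gam t dGam & dGam + Gam t *m a t = K t *m Gam t.

Lemma gauged_mder {n} (a Gam K : R -> 'M[R[i]]_n) (f u : R -> 'cV[R[i]]_n) t :
  gauge_eq a Gam K t -> mder u t (a t *m u t + f t) ->
  mder (fun s => Gam s *m u s) t (K t *m (Gam t *m u t) + Gam t *m f t).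
Proof.
move=> [dGam dG E] du; have := mderM dG du.
by rewrite mulmxDr addrA !mulmxA -mulmxDl E.
Qed.

(** [h] and [D] stand for the integrand and domain of an integral of the whole
    source term, which agrees with that of [Gam] only inside the zone. *)
Lemma zone_estimate {n} (a Gam K : R -> 'M[R[i]]_n) (f u : R -> 'cV[R[i]]_n)
    (k kap : R -> R) (s t J : R) (D : set R) (h : R -> \bar R) :
  s <= t -> mcont `[s, t] Gam -> mcont `[s, t] u -> mcont `[s, t] f ->
  {within `[s, t], continuous k} ->
  (forall x, s < x < t -> mder u x (a x *m u x + f x)) ->
  (forall x, s < x < t -> gauge_eq a Gam K x) ->
  (forall x, s < x < t -> [/\ is_derive x (1 : R) k (kap x), 0 <= kap x &
     forall v : 'cV[R[i]]_n, `|mxip v (K x *m v)| <= kap x * mxnorm2 v]) ->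
  `]s, t[ `<=` D -> (forall x, D x -> (0 <= h x)%E) ->
  (forall x, s < x < t -> h x = (mxnorm (Gam x *m f x))%:E) ->
  (\int[mu]_(x in D) h x <= J%:E)%E ->
  mxnorm (Gam t *m u t) <= expR (k t - k s) * (mxnorm (Gam s *m u s) + J) /\
  mxnorm (Gam s *m u s) <= expR (k t - k s) * (mxnorm (Gam t *m u t) + J).
Proof.
move=> st cG cu cf ck du dG H stD h0 hE hJ.
have cGf := mcont_mxnorm (mcontM cG cf).
have [P cP dP] := antiderivative_cc st cGf.
have cP' : {within `[s, t], continuous P} by exact: continuous_subspaceT.
have PJ : P t - P s <= J.
  rewrite -lee_fin; apply: le_trans hJ.
  by apply: (le_integral_of_primitive st cGf _ cP') => // x _; exact: mxnorm_ge0.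
pose dV x := K x *m (Gam x *m u x) + Gam x *m f x.
have := @gronwall _ _ _ (fun x => Gam x *m u x) dV k kap P
  (fun x => mxnorm (Gam x *m f x)) s t st (mcontM cG cu) ck cP'.
case.
- move=> x xst; have [? ? _] := H x xst; split=> //.
  + exact: gauged_mder (dG x xst) (du x xst).
  + exact: dP.
  + exact: mxnorm_ge0.
- move=> x xst; have [_ _ Kx] := H x xst.
  rewrite mxipDr; apply: le_trans (ler_normD _ _) _; rewrite lerD//.
  by rewrite mulrC; exact: normr_mxip_le.
move=> H1 H2; split.
  by apply: le_trans H1 _; rewrite ler_wpM2l ?expR_ge0// lerD2l.
by apply: le_trans H2 _; rewrite ler_wpM2l ?expR_ge0// lerD2l.
Qed.

Lemma monotone_cvg_at_right0 (c dc : R -> R) (b m : R) : 0 < b ->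
  (forall t, 0 < t < b -> is_derive t (1 : R) c (dc t)) ->
  (forall t, 0 < t < b -> 0 <= dc t) -> (forall t, 0 < t < b -> m <= c t) ->
  exists l : R, c t @[t --> 0^'+] --> l.
Proof.
move=> b0 dc' dc0 mc; exists (inf (c @` [set` Interval (BRight 0) (BLeft b)])).
apply: nondecreasing_at_right_cvgr.
- by rewrite bnd_simp.
- move=> x y; rewrite !in_itv/= => /andP[x0 xb] /andP[y0 yb] xy.
  have I z : x <= z <= y -> 0 < z < b.
    by move=> /andP[? ?]; rewrite (lt_le_trans x0)//= (le_lt_trans _ yb).
  apply: (@derive_ge0_le _ c dc) => //.
  + apply: continuous_in_subspaceT => z /set_mem; rewrite /= in_itv/= => /I/dc'.
    exact: is_derive_continuous.
  + by move=> z /andP[/ltW xz /ltW zy]; apply/dc'/I; rewrite xz.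
  + by move=> z /andP[/ltW xz /ltW zy]; apply/dc0/I; rewrite xz.
- by exists m => _ [t /= + <-]; rewrite in_itv/=; exact: mc.
Qed.

(** [c + g] and [g] are both monotone and bounded below. *)
Lemma dominated_cvg_at_right0 (c dc g dg : R -> R) (b m M : R) : 0 < b ->
  (forall t, 0 < t < b -> is_derive t (1 : R) c (dc t)) ->
  (forall t, 0 < t < b -> is_derive t (1 : R) g (dg t)) ->
  (forall t, 0 < t < b -> `|dc t| <= dg t) ->
  (forall t, 0 < t < b -> `|c t| <= M) -> (forall t, 0 < t < b -> m <= g t) ->
  exists l : R, c t @[t --> 0^'+] --> l.
Proof.
move=> b0 Dc Dg le cM gm.
have [l1 g1] : exists l : R, g t @[t --> 0^'+] --> l.
  apply: (@monotone_cvg_at_right0 g dg b m) => // t tb.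
  exact: le_trans (normr_ge0 _) (le t tb).
have [l2 g2] : exists l : R, c t + g t @[t --> 0^'+] --> l.
  apply: (@monotone_cvg_at_right0 _ (fun t => dc t + dg t) b (m - M)) => // t tb.
  - by apply: is_deriveD; [exact: Dc|exact: Dg].
  - by have := le t tb; rewrite ler_norml => /andP[+ _]; lra.
  - by have := cM t tb; have := gm t tb; rewrite ler_norml => + /andP[+ _]; lra.
exists (l2 - l1).
rewrite (_ : c = fun t => (c t + g t) - g t); last by apply/funext => t; rewrite addrK.
exact: cvgB.
Qed.

(** A primitive in the variable [ln t], where the interval is a half-line. *)
Lemma antiderivative_oc (f : R -> R) (b : R) : 0 < b ->
  {within `]0, b], continuous f} ->
  exists P : R -> R, forall t : R, 0 < t <= b -> is_derive t (1 : R) P (f t).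
Proof.
move=> b0 cf; pose tau s : R := Num.min b (expR s).
have ctau : continuous tau.
  move=> s; apply: (@continuous_min R R (cst b) expR).
    exact: cst_continuous.
  exact: continuous_expR.
have taub s : `]0, b]%classic (tau s).
  by rewrite /= in_itv/= lt_min b0 expR_gt0/= ge_min lexx.
have cg : continuous (fun s => f (tau s) * expR s).
  move=> s; apply: cvgM; last exact: continuous_expR.
  exact: (continuous_comp_within cf ctau taub).
have [Q dQ] := antiderivative cg.
exists (Q \o @ln R) => t /andP[t0 tb].
have D := is_derive1_comp (dQ (ln t)) (is_derive1_ln t0).
apply: (is_derive_eq D); rewrite lnK ?posrE// mulfK ?lt0r_neq0//.
by congr f; rewrite /tau lnK ?posrE//; exact/min_idPr.
Qed.

(** Each coordinate of [Gam *m u] has a derivative dominated by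
    [M * kap + |Gam *m f|], a function with a primitive bounded below. *)
Lemma zone_limit {n} (a Gam K : R -> 'M[R[i]]_n) (f u : R -> 'cV[R[i]]_n)
    (k kap : R -> R) (b m M : R) (D : set R) (h : R -> \bar R) :
  0 < b -> mcont `]0, b] Gam -> mcont `]0, b] f ->
  (forall x, 0 < x < b -> mder u x (a x *m u x + f x)) ->
  (forall x, 0 < x < b -> gauge_eq a Gam K x) ->
  (forall x, 0 < x < b -> [/\ is_derive x (1 : R) k (kap x), m <= k x &
     forall v : 'cV[R[i]]_n, mxnorm (K x *m v) <= kap x * mxnorm v]) ->
  (forall x, 0 < x < b -> mxnorm (Gam x *m u x) <= M) ->
  (forall x, 0 < x < b -> 0 <= kap x) ->
  `]0, b[ `<=` D -> (forall x, D x -> (0 <= h x)%E) ->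
  (forall x, 0 < x < b -> h x = (mxnorm (Gam x *m f x))%:E) ->
  (\int[mu]_(x in D) h x < +oo)%E ->
  exists v : 'cV[R[i]]_n, Gam t *m u t @[t --> 0^'+] --> v.
Proof.
move=> b0 cG cf du dG H VM kap0 bD h0 hE hfin.
have cGf := mcont_mxnorm (mcontM cG cf).
have [P dP] := antiderivative_oc b0 cGf.
pose J := fine (\int[mu]_(x in D) h x)%E.
have JE : (\int[mu]_(x in D) h x)%E = J%:E.
  by rewrite fineK// ge0_fin_numE ?integral_ge0.
have M0 : 0 <= M.
  apply: le_trans (mxnorm_ge0 (Gam (b / 2) *m u (b / 2))) (VM _ _).
  by rewrite divr_gt0//= ltr_pdivrMr// ltr_pMr// ltr1n.
have Pm x : 0 < x < b -> P b - J <= P x.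
  move=> /andP[x0 xb]; suff : P b - P x <= J by lra.
  rewrite -lee_fin -JE.
  have sub z : x <= z <= b -> 0 < z <= b.
    by move=> /andP[xz ->]; rewrite (lt_le_trans x0).
  apply: (@le_integral_of_primitive _ (fun x => mxnorm (Gam x *m f x))) => //.
  - exact: ltW.
  - apply: continuous_subspaceW cGf => z; rewrite /= !in_itv/=; exact: sub.
  - by move=> z _; exact: mxnorm_ge0.
  - apply: continuous_in_subspaceT => z /set_mem; rewrite /= in_itv/= => /sub/dP.
    exact: is_derive_continuous.
  - by move=> z /andP[/ltW xz /ltW zb]; apply/dP/sub; rewrite xz.
  - move=> z /=; rewrite in_itv/= => /andP[xz zb]; apply: bD.
    by rewrite /= in_itv/= zb (lt_trans x0).
  - by move=> z /andP[xz zb]; apply: hE; rewrite zb (lt_trans x0).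
pose g t := M * k t + P t.
pose dg t := M * kap t + mxnorm (Gam t *m f t).
have lt_le t : 0 < t < b -> 0 < t <= b by move=> /andP[-> /ltW].
have Dg t : 0 < t < b -> is_derive t (1 : R) g (dg t).
  move=> tb; have [kt _ _] := H t tb.
  have D1 := is_deriveD (is_deriveM (is_derive_cst M t 1) kt) (dP t (lt_le t tb)).
  by apply: (is_derive_eq D1); rewrite /dg /GRing.scale/= mulr0 addr0.
have gm t : 0 < t < b -> M * m + (P b - J) <= g t.
  by move=> tb; rewrite /g lerD ?Pm// ler_wpM2l//; have [] := H t tb.
pose dV x := K x *m (Gam x *m u x) + Gam x *m f x.
have DV t : 0 < t < b -> mder (fun s => Gam s *m u s) t (dV t).
  by move=> tb; exact: gauged_mder (dG t tb) (du t tb).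
have dVle t : 0 < t < b -> mxnorm (dV t) <= dg t.
  move=> tb; apply: le_trans (mxnormD _ _) _; rewrite lerD2r.
  have [_ _ Kt] := H t tb; apply: le_trans (Kt _) _.
  by rewrite mulrC ler_wpM2r ?kap0 ?VM.
have /choice[vr Hr] : forall i : 'I_n, exists l : R,
    Re ((Gam t *m u t) i 0) @[t --> 0^'+] --> l.
  move=> i; apply: (@dominated_cvg_at_right0 _ (fun t => Re (dV t i 0)) g dg b
      (M * m + (P b - J)) M) => // t tb.
  - exact: (DV t tb i 0).1.
  - exact: le_trans (Re_le_mxnorm _ _ _) (dVle t tb).
  - exact: le_trans (Re_le_mxnorm _ _ _) (VM t tb).
have /choice[vi Hi] : forall i : 'I_n, exists l : R,
    Im ((Gam t *m u t) i 0) @[t --> 0^'+] --> l.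
  move=> i; apply: (@dominated_cvg_at_right0 _ (fun t => Im (dV t i 0)) g dg b
      (M * m + (P b - J)) M) => // t tb.
  - exact: (DV t tb i 0).2.
  - exact: le_trans (Im_le_mxnorm _ _ _) (dVle t tb).
  - exact: le_trans (Im_le_mxnorm _ _ _) (VM t tb).
exists (\col_i (vr i +i* vi i)%C); apply/cvg_mxP => i j.
by rewrite ord1 mxE/=; split; [exact: Hr|exact: Hi].
Qed.

End ZoneEstimates.

(** * The matrix exponential *)

Section MatrixExponential.
Context {R : realType}.

Lemma cvg_of_mxnorm (T : Type) (F : set_system T) {FF : Filter F} {p q}
    (X : T -> 'M[R[i]]_(p, q)) (L : 'M[R[i]]_(p, q)) :
  (forall e, 0 < e -> \forall x \near F, mxnorm (X x - L) < e) ->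
  X x @[x --> F] --> L.
Proof.
move=> H; apply/cvg_mxP => i j; split; apply/cvgrPdist_lt => e e0;
  apply: filterS (H e e0) => x; apply: le_lt_trans; rewrite distrC.
  by have := Re_le_mxnorm (X x - L) i j; rewrite !mxE ReD ReN.
by have := Im_le_mxnorm (X x - L) i j; rewrite !mxE ImD ImN.
Qed.

Definition exp_coef (k : nat) (s : R) : R := s ^+ k / k`!%:R.

Lemma is_derive_exp_coef k (s : R) :
  is_derive s (1 : R) (exp_coef k.+1) (exp_coef k s).
Proof.
have D : is_derive s (1 : R) (fun s : R => s ^+ k.+1) (k.+1%:R * s ^+ k).
  rewrite (_ : (fun s => _) = id ^+ k.+1); last first.
    by apply/funext => y; rewrite exprfctE.
  have H := is_deriveX k.+1 (is_derive_id s (1 : R)).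
  by apply: (is_derive_eq H); rewrite /GRing.scale/= mulr1.
have := is_deriveM D (is_derive_cst (k.+1`!%:R^-1 : R) s 1).
move=> H; apply: (is_derive_eq H).
rewrite /exp_coef /GRing.scale/= mulr0 add0r factS natrM.
have k0 : k.+1%:R != 0 :> R by rewrite pnatr_eq0.
have f0 : k`!%:R != 0 :> R by rewrite pnatr_eq0 -lt0n fact_gt0.
by field; rewrite f0 nat1r k0.
Qed.

Lemma exp_coef0 k : exp_coef k.+1 0 = 0.
Proof. by rewrite /exp_coef expr0n mul0r. Qed.

Lemma exp_coef00 s : exp_coef 0 s = 1.
Proof. by rewrite /exp_coef expr0 divr1. Qed.

Lemma cder_real (f : R -> R) (t l : R) : is_derive t (1 : R) f l ->
  cder (fun s => (f s)%:C%C) t l%:C%C.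
Proof. by move=> fl; split => //=; exact: is_derive_cst. Qed.

Definition exp_sum {n} (B : 'M[R[i]]_n) (K : nat) (s : R) : 'M[R[i]]_n :=
  \sum_(0 <= k < K) (exp_coef k s)%:C%C *: B ^+ k.

Lemma mder_exp_sum {n} (B : 'M[R[i]]_n) K s :
  mder (exp_sum B K.+1) s (B *m exp_sum B K s).
Proof.
have E : exp_sum B K.+1 =
    fun t => 1%:M + \sum_(0 <= k < K) (exp_coef k.+1 t)%:C%C *: B ^+ k.+1.
  by apply/funext => t; rewrite /exp_sum big_nat_recl// exp_coef00 expr0 scale1r.
rewrite E -[X in mder _ _ X]add0r mulmx_sumr; apply: mderD; first exact: mder_cst.
apply: mder_sum => k _.
have := mderZ (cder_real (is_derive_exp_coef k s)) (mder_cst (B ^+ k.+1) s).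
by rewrite scaler0 addr0 exprS -scalemxAr.
Qed.

Lemma matrix_exprZ {n} (c : R[i]) (B : 'M[R[i]]_n) k :
  (c *: B) ^+ k = c ^+ k *: B ^+ k.
Proof.
elim: k => [|k IH]; first by rewrite !expr0 scale1r.
by rewrite !exprS IH -mulmxE -scalemxAl -scalemxAr scalerA.
Qed.

(** The remainders [E - exp_sum B k] are Picard increments for the constant
    coefficient [B], hence tend to zero. *)
Lemma mexp_ode {n} (B : 'M[R[i]]_n) (E : R -> 'M[R[i]]_n) :
  E 0 = 1%:M -> (forall s, mder E s (B *m E s)) ->
  forall s, mexp (s%:C%C *: B) = E s.
Proof.
move=> E0 dE s.
pose D k t := E t + - 1%:C%C *: exp_sum B k t.
have dD k t : mder (D k.+1) t (B *m D k t).
  have := mderD (dE t) (mderZ (cder_cst (- 1%:C%C) t) (mder_exp_sum B k t)).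
  by rewrite scale0r add0r scalemxAr -mulmxDr.
have D0 k : D k.+1 0 = 0.
  rewrite /D E0 /exp_sum big_nat_recl// exp_coef00 expr0 scale1r big1 ?addr0.
    by rewrite scaleNr scale1r subrr.
  by move=> i _; rewrite exp_coef0 scale0r.
have DE : D 0%N = E.
  by apply/funext => t; rewrite /D /exp_sum big_geq// scaler0 addr0.
have cE : mcont setT E by exact: (mder_mcont (fun t _ => dE t)).
have [M M0 EM] := continuous_bounded `|s| (mcont_mxnorm_setT cE).
have c0 : 0 < mxnorm B + 1 by rewrite ltr_wpDl ?mxnorm_ge0.
have Bc (t : R) : `|t| <= `|s| -> mxnorm B <= mxnorm B + 1 by rewrite lerDl.
have := @picard_bound _ _ _ (fun=> B) D `|s| _ M c0 (ltW M0) Bc _ D0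
  (fun k t _ => dD k t).
rewrite DE => /(_ EM)/(_ _ s (lexx _)) bnd.
rewrite /mexp; apply: cvg_lim; first exact: norm_hausdorff.
apply: cvg_of_mxnorm => e e0.
have [K0 K0e] := geometric_small (M * expR (2 * (mxnorm B + 1) * `|s|)) e0.
exists K0 => // K /= K0K.
have -> : \sum_(0 <= k < K) (k`!%:R^-1 : R[i]) *: (s%:C%C *: B) ^+ k = exp_sum B K s.
  apply: eq_bigr => k _; rewrite matrix_exprZ scalerA; congr (_ *: _).
  by rewrite /exp_coef mulrC rmorphM/= rmorphXn fmorphV/= rmorph_nat.
apply: le_lt_trans K0e.
have -> : exp_sum B K s - E s = - D K s.
  by rewrite /D scaleNr scale1r opprB.
rewrite mxnormN; apply: le_trans (bnd K) _; rewrite mulrAC.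
rewrite ler_wpM2l ?mulr_ge0 ?expR_ge0 ?(ltW M0)//.
by rewrite ler_wiXn2l ?invr_ge0// invf_le1 ?ler1n.
Qed.

Lemma mder_eq0_const {p q} (V : R -> 'M[R[i]]_(p, q)) (s : R) :
  (forall t, mder V t 0) -> V s = V 0.
Proof.
move=> dV; apply/eqP; rewrite -subr_eq0; apply/eqP; apply: mxnorm_eq0.
apply/eqP; rewrite eq_le mxnorm_ge0 andbT.
have z t : is_derive t (1 : R) (fun=> 0 : R) 0 by exact: is_derive_cst.
have le (t : R) : mxnorm (0 : 'M[R[i]]_(p, q)) <= 0 by rewrite mxnorm0.
have [s0|/ltW s0] := leP 0 s.
  have := @mxnorm_increment _ _ _ V _ (fun=> 0) (fun=> 0) 0 s s0
    (fun t _ => dV t) (fun t _ => z t) (fun t _ => le t).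
  by rewrite subrr.
have := @mxnorm_increment _ _ _ V _ (fun=> 0) (fun=> 0) s 0 s0
    (fun t _ => dV t) (fun t _ => z t) (fun t _ => le t).
by rewrite subrr -mxnormN opprB.
Qed.

Lemma cder_cexp (c : R -> R[i]) (t : R) (l : R[i]) : cder c t l ->
  cder (fun s => cexp (c s)) t (l * cexp (c t)).
Proof.
move=> [cr ci].
have De := @is_derive1_comp _ expR (fun s => Re (c s)) t _ _ (is_derive_expR _) cr.
have Dc := @is_derive1_comp _ (@cos R) (fun s => Im (c s)) t _ _ (is_derive_cos _) ci.
have Ds := @is_derive1_comp _ (@sin R) (fun s => Im (c s)) t _ _ (is_derive_sin _) ci.
split.
  apply: (is_derive_eq (is_deriveM De Dc)); rewrite ReM /GRing.scale/=; ring.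
apply: (is_derive_eq (is_deriveM De Ds)); rewrite ImM /GRing.scale/=; ring.
Qed.

Lemma cexp0 : cexp (0 : R[i]) = 1.
Proof. by rewrite /cexp/= expR0 cos0 sin0 mulr1 mulr0. Qed.

Lemma ccont_cexp (A : set R) (c : R -> R[i]) :
  ccont A c -> ccont A (fun s => cexp (c s)).
Proof.
move=> [cr ci].
have ce : {within A, continuous (fun s => expR (Re (c s)))}.
  move=> x; apply: (@cvg_comp _ _ _ (fun s => Re (c s)) expR); first exact: cr.
  exact: continuous_expR.
by split=> x; apply: cvgM; first [exact: ce|
  apply: (@cvg_comp _ _ _ (fun s => Im (c s)) (@cos R)); [exact: ci|exact: continuous_cos]|
  apply: (@cvg_comp _ _ _ (fun s => Im (c s)) (@sin R)); [exact: ci|exact: continuous_sin]].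
Qed.

Lemma cexpNK (z : R[i]) : cexp z * cexp (- z) = 1.
Proof.
case: z => a b; rewrite /cexp/= expRN cosN sinN.
apply/eqP; rewrite eq_complex/=; have e0 := lt0r_neq0 (expR_gt0 a).
apply/andP; split; apply/eqP.
  transitivity (cos b ^+ 2 + sin b ^+ 2); first by field.
  exact: cos2Dsin2.
by field.
Qed.

Lemma cexp_le (z : R[i]) : `|Re (cexp z)| <= expR (Re z) /\ `|Im (cexp z)| <= expR (Re z).
Proof.
have h x : `|x| <= 1 -> `|expR (Re z) * x| <= expR (Re z).
  by move=> x1; rewrite normrM ger0_norm ?expR_ge0// ler_piMr ?expR_ge0.
by split; rewrite /cexp/= h// ler_norml ?cos_geN1 ?cos_le1 ?sin_geN1 ?sin_le1.
Qed.

End MatrixExponential.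

(** * Exponentials of Jordan matrices *)

Section Jordan.
Context {R : realType} {n : nat}.
Variable B : 'M[R[i]]_n.
Hypothesis jB : is_jordan B.

Definition jordan_nil : 'M[R[i]]_n := \matrix_(i, j) (if i == j then 0 else B i j).

Definition diag_exp (s : R) : 'M[R[i]]_n :=
  diag_mx (\row_i cexp (s%:C%C * B i i)).

(** The exponential of [s *: jordan_nil]: the series stops at order [n]. *)
Definition unip (s : R) : 'M[R[i]]_n := exp_sum jordan_nil n s.

Definition jordan_exp (s : R) : 'M[R[i]]_n := diag_exp s *m unip s.

Lemma jordan_nil_pow k (i j : 'I_n) :
  nat_of_ord j != (i + k)%N -> (jordan_nil ^+ k) i j = 0.
Proof.
elim: k i j => [|k IH] i j.
  by rewrite addn0 expr0 mxE eq_sym => /negbTE; rewrite -val_eqE/= => ->.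
move=> jik; rewrite exprS mxE big1// => l _.
have [li|li] := eqVneq (nat_of_ord l) i.+1.
  by rewrite [X in _ * X]IH ?mulr0// li addSnnS.
rewrite mxE; case: eqVneq => [_|il]; first by rewrite mul0r.
by have [H _] := jB i l; rewrite H ?mul0r// eq_sym.
Qed.

Lemma jordan_nil_n : jordan_nil ^+ n = 0.
Proof.
apply/matrixP => i j; rewrite jordan_nil_pow ?mxE//.
by rewrite neq_ltn (leq_trans (ltn_ord j)) ?leq_addl.
Qed.

Lemma mder_unip s : mder unip s (jordan_nil *m unip s).
Proof.
rewrite /unip; case: n jordan_nil jordan_nil_n => [N _|m N Nm].
  by move=> [].
have -> : N *m exp_sum N m.+1 s = N *m exp_sum N m s.
  rewrite /exp_sum big_nat_recr//= mulmxDr -scalemxAr.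
  by rewrite (_ : N *m N ^+ m = 0) ?scaler0 ?addr0// -Nm exprS.
exact: mder_exp_sum.
Qed.

Lemma cder_scale (z : R[i]) (s : R) : cder (fun s => s%:C%C * z) s z.
Proof.
case: z => a b; split.
  by apply: is_derive_eq; rewrite /GRing.scale/=; ring.
by apply: is_derive_eq; rewrite /GRing.scale/=; ring.
Qed.

Lemma mder_diag_exp s :
  mder diag_exp s (diag_mx (\row_i B i i) *m diag_exp s).
Proof.
move=> i j; rewrite /diag_exp mul_diag_mx !mxE.
have [->|ij] := eqVneq i j.
  rewrite mulr1n (_ : (fun s => _) = fun s => cexp (s%:C%C * B j j)).
    exact: cder_cexp (cder_scale _ _).
  by apply/funext => t; rewrite !mxE eqxx mulr1n.
rewrite mulr0n mulr0 (_ : (fun s => _) = fun=> 0); first exact: cder_cst.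
by apply/funext => t; rewrite !mxE (negbTE ij) mulr0n.
Qed.

(** Entries of [jordan_nil] link only equal eigenvalues. *)
Lemma diag_comm_nil (g : R[i] -> R[i]) :
  diag_mx (\row_i g (B i i)) *m jordan_nil = jordan_nil *m diag_mx (\row_i g (B i i)).
Proof.
apply/matrixP => i j; rewrite mul_diag_mx mul_mx_diag !mxE.
have [_|ij] := eqVneq i j; first by rewrite mulr0 mul0r.
have [ji|ji] := eqVneq (nat_of_ord j) i.+1.
  have [_ /(_ ji)[->|[_ ->]]] := jB i j; first by rewrite mulr0 mul0r.
  by rewrite mulrC.
by have [H _] := jB i j; rewrite H ?mulr0 ?mul0r// eq_sym.
Qed.

Lemma diag_comm_unip (g : R[i] -> R[i]) t :
  diag_mx (\row_i g (B i i)) *m unip t = unip t *m diag_mx (\row_i g (B i i)).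
Proof.
rewrite /unip /exp_sum mulmx_sumr mulmx_suml; apply: eq_bigr => k _.
rewrite -scalemxAr -scalemxAl; congr (_ *: _).
elim: k => [|k IH]; first by rewrite expr0 mulmx1 mul1mx.
by rewrite exprS -mulmxE mulmxA diag_comm_nil -!mulmxA IH.
Qed.

Lemma diag_exp_comm_nil s : diag_exp s *m jordan_nil = jordan_nil *m diag_exp s.
Proof. exact: (diag_comm_nil (fun l => cexp (s%:C%C * l))). Qed.

Lemma diag_exp_comm_unip s t : diag_exp s *m unip t = unip t *m diag_exp s.
Proof. exact: (diag_comm_unip (fun l => cexp (s%:C%C * l))). Qed.

Lemma unip_comm_nil s : unip s *m jordan_nil = jordan_nil *m unip s.
Proof.
rewrite /unip /exp_sum mulmx_sumr mulmx_suml; apply: eq_bigr => k _.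
by rewrite -scalemxAr -scalemxAl mulmxE -exprSr -exprS.
Qed.

Lemma jordan_decomp : B = diag_mx (\row_i B i i) + jordan_nil.
Proof.
apply/matrixP => i j; rewrite !mxE.
by have [->|] := eqVneq i j; rewrite ?mulr1n ?mulr0n ?addr0 ?add0r.
Qed.

Lemma jordan_exp_comm s : B *m jordan_exp s = jordan_exp s *m B.
Proof.
rewrite [X in X *m _]jordan_decomp [X in _ = _ *m X]jordan_decomp.
rewrite /jordan_exp mulmxDl mulmxDr; congr (_ + _).
  have /= C := diag_comm_unip id s; rewrite -[RHS]mulmxA -C !mulmxA.
  by congr (_ *m _); rewrite /diag_exp diag_mxC.
by rewrite mulmxA -diag_exp_comm_nil -!mulmxA unip_comm_nil.
Qed.

Lemma mder_jordan_exp s : mder jordan_exp s (B *m jordan_exp s).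
Proof.
have <- : diag_mx (\row_i B i i) *m diag_exp s *m unip s
    + diag_exp s *m (jordan_nil *m unip s) = B *m jordan_exp s.
  by rewrite [in RHS]jordan_decomp /jordan_exp mulmxDl !mulmxA diag_exp_comm_nil.
exact: mderM (mder_diag_exp s) (mder_unip s).
Qed.

Lemma unip0 : unip 0 = 1%:M.
Proof.
rewrite /unip; case: n jordan_nil => [N|m N].
  by apply/matrixP => -[].
rewrite /exp_sum big_nat_recl// exp_coef00 expr0 scale1r big1 ?addr0// => k _.
by rewrite exp_coef0 scale0r.
Qed.

Lemma diag_exp0 : diag_exp 0 = 1%:M.
Proof.
rewrite /diag_exp -(@diag_const_mx _ n 1); congr diag_mx; apply/rowP => i.
by rewrite !mxE mul0r cexp0.
Qed.

(** [jordan_exp] solves the equation that characterizes the exponential. *)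
Lemma mexp_jordan s : mexp (s%:C%C *: B) = jordan_exp s.
Proof.
apply: mexp_ode; last exact: mder_jordan_exp.
by rewrite /jordan_exp unip0 diag_exp0 mulmx1.
Qed.

Lemma diag_expK s : diag_exp s *m diag_exp (- s) = 1%:M.
Proof.
rewrite /diag_exp mulmx_diag -(@diag_const_mx _ n 1); congr diag_mx.
by apply/rowP => i; rewrite !mxE rmorphN mulNr cexpNK.
Qed.

(** The product is constant in [s], by the commutation of [unip] and [jordan_nil]. *)
Lemma unipK s : unip s *m unip (- s) = 1%:M.
Proof.
have dN (t : R) : is_derive t (1 : R) (fun t => - t) (- 1).
  exact: is_deriveNid.
have := @mder_eq0_const _ _ _ (fun t => unip t *m unip (- t)) s.
rewrite oppr0 unip0 mulmx1; apply => t.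
have := mderM (mder_unip t) (@mder_comp _ _ _ unip -%R t _ _ (mder_unip (- t)) (dN t)).
rewrite rmorphN1 scaleN1r mulmxN !mulmxA unip_comm_nil subrr.
exact.
Qed.

Lemma jordan_expK s : jordan_exp s *m jordan_exp (- s) = 1%:M.
Proof.
rewrite /jordan_exp mulmxA -(mulmxA (diag_exp s)) -(diag_exp_comm_unip (- s) s).
by rewrite mulmxA diag_expK mul1mx unipK.
Qed.

(** For diagonal [D] the factors [diag_exp] cancel, so that only the
    polynomially growing [unip] remains. *)
Lemma jordan_exp_conj (D : 'M[R[i]]_n) s : is_diag_mx D ->
  jordan_exp s *m D *m jordan_exp (- s) = unip s *m D *m unip (- s).
Proof.
move=> /diag_mxP[d ->]; rewrite /jordan_exp diag_exp_comm_unip.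
rewrite -(mulmxA (unip s)) (_ : diag_exp s *m diag_mx d = diag_mx d *m diag_exp s).
  by rewrite !mulmxA -(mulmxA _ (diag_exp s)) diag_expK mulmx1.
by rewrite /diag_exp diag_mxC.
Qed.

End Jordan.

Section JordanGrowth.
Context {R : realType} {n : nat}.

Lemma mxnorm_exp (N : 'M[R[i]]_n) k (b : R) : mxnorm N <= b ->
  mxnorm (N ^+ k) <= mxnorm (1%:M : 'M[R[i]]_n) * b ^+ k.
Proof.
move=> Nb; elim: k => [|k IH]; first by rewrite !expr0 mulr1.
rewrite !exprS mulrCA; apply: le_trans (mxnormM _ _) _.
by apply: ler_pM; rewrite ?mxnorm_ge0.
Qed.

Lemma mxnorm_jordan_nil (B : 'M[R[i]]_n) : mxnorm (jordan_nil B) <= mxnorm B.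
Proof.
rewrite ler_sqrt ?mxnorm2_ge0//.
apply: ler_sum => i _; apply: ler_sum => j _; rewrite mxE.
by case: ifP => // _; rewrite /= expr0n/= addr0 addr_ge0 ?sqr_ge0.
Qed.

Lemma exp_coef_le k (s : R) : (k <= n)%N -> `|exp_coef k s| <= (1 + `|s|) ^+ n.
Proof.
move=> kn; rewrite /exp_coef normrM normrX normfV normr_nat.
apply: le_trans (_ : `|s| ^+ k * 1 <= _).
  by rewrite ler_wpM2l ?exprn_ge0// invf_le1 ?ltr0n ?fact_gt0// ler1n fact_gt0.
rewrite mulr1; apply: le_trans (_ : (1 + `|s|) ^+ k <= _).
  by rewrite lerXn2r ?nnegrE ?addr_ge0// lerDr.
by apply: ler_weXn2l => //; rewrite lerDl.
Qed.

Definition unip_const (b : R) : R :=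
  n%:R * (mxnorm (1%:M : 'M[R[i]]_n) * (1 + b) ^+ n).

Lemma unip_const_ge0 b : 0 <= b -> 0 <= unip_const b.
Proof. by move=> b0; rewrite !mulr_ge0 ?mxnorm_ge0 ?exprn_ge0 ?addr_ge0. Qed.

Lemma unip_growth (B : 'M[R[i]]_n) (b s : R) : mxnorm B <= b ->
  mxnorm (unip B s) <= unip_const b * (1 + `|s|) ^+ n.
Proof.
move=> Bb; have b0 : 0 <= b := le_trans (mxnorm_ge0 B) Bb.
apply: le_trans (mxnorm_sum _ _ _) _.
apply: le_trans (_ : \sum_(0 <= k < n)
    (1 + `|s|) ^+ n * (mxnorm (1%:M : 'M[R[i]]_n) * (1 + b) ^+ n) <= _).
  rewrite big_nat_cond [leRHS]big_nat_cond.
  apply: ler_sum => k; rewrite andbT => /andP[_ kn]; rewrite mxnormZr.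
  apply: ler_pM; rewrite ?mxnorm_ge0//; first exact: exp_coef_le (ltnW kn).
  apply: le_trans (mxnorm_exp _ (le_trans (mxnorm_jordan_nil B) Bb)) _.
  rewrite ler_wpM2l ?mxnorm_ge0//; apply: le_trans (_ : (1 + b) ^+ k <= _).
    by rewrite lerXn2r ?nnegrE ?addr_ge0// lerDr.
  by apply: ler_weXn2l; rewrite ?lerDl// ltnW.
rewrite sumr_const_nat subn0 /unip_const -[leLHS]mulr_natl -[in leRHS]mulrA.
by rewrite [X in _ <= _ * X]mulrC.
Qed.

Lemma diag_exp_growth (B : 'M[R[i]]_n) (b s : R) : mxnorm B <= b ->
  mxnorm (diag_exp B s) <= (2 * n%:R ^+ 2) * expR (b * `|s|).
Proof.
move=> Bb; apply: le_trans (mxnorm_le_sum _) _.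
have ent (i j : 'I_n) : `|Re (diag_exp B s i j)| + `|Im (diag_exp B s i j)|
    <= 2 * expR (b * `|s|).
  rewrite !mxE; case: eqVneq => [_|_]; last first.
    by rewrite mulr0n/= normr0 addr0 mulr_ge0 ?expR_ge0.
  rewrite mulr1n; have [cr ci] := cexp_le (s%:C%C * B i i).
  have le : expR (Re (s%:C%C * B i i)) <= expR (b * `|s|).
    rewrite ler_expR ReM/= mul0r subr0.
    apply: le_trans (ler_norm _) _; rewrite normrM mulrC.
    by rewrite ler_wpM2r// (le_trans (Re_le_mxnorm B i i)).
  rewrite mulr_natl mulr2n lerD//.
    exact: le_trans cr le.
  exact: le_trans ci le.
apply: le_trans (_ : \sum_(i < n) \sum_(j < n) 2 * expR (b * `|s|) <= _).
  by apply: ler_sum => i _; apply: ler_sum => j _; exact: ent.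
rewrite !sumr_const card_ord -[leLHS]mulr_natl -[X in _ * X <= _]mulr_natl.
by rewrite le_eqVlt; apply/orP; left; apply/eqP; ring.
Qed.

Lemma jordan_exp_growth (B : 'M[R[i]]_n) (b s : R) : mxnorm B <= b ->
  mxnorm (jordan_exp B s) <=
    (2 * n%:R ^+ 2) * unip_const b * expR (b * `|s|) * (1 + `|s|) ^+ n.
Proof.
move=> Bb; have b0 : 0 <= b := le_trans (mxnorm_ge0 B) Bb.
apply: le_trans (mxnormM _ _) _.
rewrite (_ : _ * _ * _ * _ =
    (2 * n%:R ^+ 2 * expR (b * `|s|)) * (unip_const b * (1 + `|s|) ^+ n)).
  apply: ler_pM; rewrite ?mxnorm_ge0 ?unip_growth//.
  exact: diag_exp_growth.
by move: (unip_const b) (expR _) (_ ^+ n) => x y z; ring.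
Qed.

End JordanGrowth.

(** * Powers and logarithms *)

Section Powers.
Context {R : realType}.

(** With [w = - ln z], this is [1 + w <= (1 + d^-1) * expR (d * w)] raised to
    the power [r]. *)
Lemma log_absorb (e : R) (r : nat) : 0 < e ->
  exists2 C : R, 0 <= C &
    forall z, 0 < z <= 1 -> (1 + `|ln z|) ^+ r <= C * z `^ (- e).
Proof.
move=> e0; pose d := e / r.+1%:R.
have d0 : 0 < d by rewrite divr_gt0.
have c0 : 0 <= 1 + d^-1 by rewrite addr_ge0// invr_ge0 ltW.
exists ((1 + d^-1) ^+ r); first by rewrite exprn_ge0.
move=> z /andP[z0 z1].
have w0 : ln z <= 0 by rewrite ln_le0.
rewrite ler0_norm// /powR (gt_eqF z0) mulNr; set w := - ln z.
rewrite -mulrN -/w.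
have wp : 0 <= w by rewrite oppr_ge0.
apply: le_trans (_ : ((1 + d^-1) * expR (d * w)) ^+ r <= _).
  rewrite lerXn2r ?nnegrE ?addr_ge0 ?mulr_ge0 ?expR_ge0//.
  apply: le_trans (_ : (1 + d^-1) * (1 + d * w) <= _).
    have := mulVf (lt0r_neq0 d0); have : 0 <= d^-1 by rewrite invr_ge0 ltW.
    have : 0 <= d * w by rewrite mulr_ge0// ltW.
    set i := d^-1 => ? ? di; rewrite mulrDl mul1r mulrDr mulr1 mulrA di mul1r; lra.
  by rewrite ler_wpM2l// expR_ge1Dx.
rewrite exprMn ler_wpM2l ?exprn_ge0// -expRM_natl ler_expR mulrA ler_wpM2r//.
by rewrite /d mulrCA ger_pMr// ler_pdivrMr// mul1r ler_nat.
Qed.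

Lemma powR_log_le (a b : R) (r : nat) : b < a ->
  exists2 C : R, 0 <= C & forall z, 0 < z <= 1 ->
    z `^ a * (1 + `|ln z|) ^+ r <= C * z `^ b.
Proof.
move=> ba; have ab0 : 0 < a - b by rewrite subr_gt0.
have [C C0 HC] := log_absorb r ab0; exists C => // z z01.
have z0 : 0 < z by case/andP: z01.
apply: le_trans (_ : z `^ a * (C * z `^ (- (a - b))) <= _).
  by rewrite ler_wpM2l ?powR_ge0// HC.
by rewrite mulrCA -powRD ?(gt_eqF z0) ?implybT// opprB addrC subrK.
Qed.

Lemma powR_le1 (a z : R) : 0 <= a -> 0 < z <= 1 -> z `^ a <= 1.
Proof.
move=> a0 /andP[z0 z1]; rewrite /powR (gt_eqF z0) expR_le1.
by rewrite mulr_ge0_le0// ln_le0.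
Qed.

Lemma powR_anti (a b z : R) : b <= a -> 0 < z <= 1 -> z `^ a <= z `^ b.
Proof.
move=> ba /andP[z0 z1]; rewrite /powR (gt_eqF z0) ler_expR ler_wnM2r// ln_le0//.
Qed.

End Powers.

(** * Chaining estimates over intervals *)

Section ZoneChaining.
Context {R : realType} {n : nat}.
Variables (T : R) (a G : R -> 'M[R[i]]_n).

Definition interval_estimate (lo hi C : R) : Prop :=
  forall f u : R -> 'cV[R[i]]_n, mcont `]0, T] f -> sol T a f u ->
  forall s t J, 0 < s -> lo <= s -> s <= t -> t <= hi -> t <= T ->
    (gint G f t <= J%:E)%E ->
    mxnorm (G t *m u t) <= C * (mxnorm (G s *m u s) + J) /\
    mxnorm (G s *m u s) <= C * (mxnorm (G t *m u t) + J).

(** [Gam] may differ from [G] at the endpoints [lo] and [hi]; there the two only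
    need to be comparable. *)
Lemma interval_estimate_of_gauge (Gam K : R -> 'M[R[i]]_n) (k kap : R -> R)
    (lo hi c kt : R) : 1 <= c ->
  let Z := [set x | [/\ 0 < x, lo <= x, x <= hi & x <= T]] in
  mcont Z Gam -> {within Z, continuous k} ->
  (forall x, 0 < x -> lo < x -> x < hi -> x < T -> [/\ gauge_eq a Gam K x,
     is_derive x (1 : R) k (kap x), 0 <= kap x, G x = Gam x &
     forall v : 'cV[R[i]]_n, `|mxip v (K x *m v)| <= kap x * mxnorm2 v]) ->
  (forall x, Z x -> forall v : 'cV[R[i]]_n, mxnorm (Gam x *m v) <= c * mxnorm (G x *m v)
     /\ mxnorm (G x *m v) <= c * mxnorm (Gam x *m v)) ->
  (forall s t, Z s -> Z t -> k t - k s <= kt) ->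
  interval_estimate lo hi (c ^+ 2 * expR kt).
Proof.
move=> c1 Z cG ck H cmp kkt f u cf su s t J s0 los st thi tT fJ.
have c0 : 0 <= c by apply: le_trans c1.
have sub x : s <= x <= t -> Z x.
  move=> /andP[sx xt]; split.
  - exact: lt_le_trans sx.
  - exact: le_trans sx.
  - exact: le_trans thi.
  - exact: le_trans tT.
have subZ : `[s, t] `<=` Z by move=> x; rewrite /= in_itv/=; exact: sub.
have subT : `[s, t] `<=` `]0, T].
  by move=> x /subZ[x0 _ _ xT]; rewrite /= in_itv/= x0.
have strict x : s < x < t -> [/\ 0 < x, lo < x, x < hi & x < T].
  move=> /andP[sx xt]; split.
  - exact: lt_trans sx.
  - exact: le_lt_trans sx.
  - exact: lt_le_trans thi.
  - exact: lt_le_trans tT.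
have Zs : Z s by apply: sub; rewrite lexx.
have Zt : Z t by apply: sub; rewrite lexx st.
have J0 : 0 <= J by rewrite -lee_fin; apply: le_trans fJ; exact: gint_ge0.
have [E1 E2] : mxnorm (Gam t *m u t) <= expR (k t - k s) * (mxnorm (Gam s *m u s) + J) /\
  mxnorm (Gam s *m u s) <= expR (k t - k s) * (mxnorm (Gam t *m u t) + J).
  apply: (@zone_estimate _ _ a Gam K f u k kap s t J `]0, t]%classic
    (fun x => (mxnorm (G x *m f x))%:E) st).
  - exact: mcontW cG.
  - exact: mcontW subT (sder_mcont su).
  - exact: mcontW subT cf.
  - exact: continuous_subspaceW ck.
  - move=> x /strict[x0 _ _ xT]; apply: (@sder_mder _ _ _ T); first by rewrite x0.
    by apply: su; rewrite x0 ltW.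
  - by move=> x /strict[x0 xlo xhi xT]; have [] := H x x0 xlo xhi xT.
  - by move=> x /strict[x0 xlo xhi xT]; have [] := H x x0 xlo xhi xT.
  - move=> x; rewrite /= !in_itv/= => /andP[sx /ltW ->].
    by rewrite (lt_trans s0).
  - by move=> x _; rewrite lee_fin mxnorm_ge0.
  - by move=> x /strict[x0 xlo xhi xT]; have [_ _ _ ->] := H x x0 xlo xhi xT.
  - exact: fJ.
have ek : expR (k t - k s) <= expR kt by rewrite ler_expR kkt.
have comb x y : mxnorm (Gam x *m u x) <= expR (k t - k s) * (mxnorm (Gam y *m u y) + J) ->
    Z x -> Z y ->
    mxnorm (G x *m u x) <= c ^+ 2 * expR kt * (mxnorm (G y *m u y) + J).
  move=> E Zx Zy; apply: le_trans (cmp x Zx (u x)).2 _.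
  rewrite expr2 -!mulrA ler_wpM2l//; apply: le_trans E _.
  rewrite mulrCA; apply: ler_pM.
  - exact: expR_ge0.
  - exact: addr_ge0 (mxnorm_ge0 _) J0.
  - exact: ek.
  rewrite mulrDr lerD//; first exact: (cmp y Zy (u y)).1.
  by rewrite ler_peMl.
by split; apply: comb.
Qed.

(** The times [s] and [t] are joined through [m1] and [m2], the points between
    them closest to [t1] and [t2]; a step may be trivial. *)
Lemma two_sided_of_intervals (t1 t2 C : R) : t1 <= t2 -> 1 <= C ->
  interval_estimate 0 t1 C -> interval_estimate t1 t2 C -> interval_estimate t2 T C ->
  two_sided_estimate T a G (3 * C ^+ 3).
Proof.
move=> t12 C1 E1 E2 E3 f u cf su s t J s0 st tT fJ.
have J0 : 0 <= J by rewrite -lee_fin; apply: le_trans fJ; exact: gint_ge0.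
pose N x := mxnorm (G x *m u x).
have N0 x : 0 <= N x by exact: mxnorm_ge0.
pose E x y := N y <= C * (N x + J) /\ N x <= C * (N y + J).
have Erefl x : E x x.
  by split; have := N0 x; nra.
pose m1 := Num.max s (Num.min t t1); pose m2 := Num.max s (Num.min t t2).
have m1t : m1 <= t by rewrite /m1 ge_max st ge_min lexx.
have m2t : m2 <= t by rewrite /m2 ge_max st ge_min lexx.
have sm1 : s <= m1 by rewrite /m1 le_max lexx.
have m12 : m1 <= m2.
  by rewrite /m1 /m2 ge_max !le_max lexx/= le_min !ge_min lexx t12 !orbT.
have gJ x : x <= t -> (gint G f x <= J%:E)%E.
  by move=> xt; apply: le_trans fJ; exact: gint_le.
have F1 : E s m1.
  rewrite /E /m1; have [ts|ts] := leP (Num.min t t1) s; first exact: Erefl.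
  apply: (E1 f u cf su) => //; rewrite ?(ltW s0) ?(ltW ts) ?ge_min ?lexx ?orbT//.
  - by rewrite tT.
  - by apply: gJ; rewrite ge_min lexx.
have F2 : E m1 m2.
  have [m21|m12'] := leP m2 m1.
    by rewrite (_ : m2 = m1); [exact: Erefl|apply/eqP; rewrite eq_le m21 m12].
  apply: (E2 f u cf su) => //.
  - exact: lt_le_trans sm1.
  - move: m12'; rewrite /m1 /m2; case: (leP t t1) => tt1; last by rewrite le_max lexx orbT.
    by rewrite (max_idPr st) => /lt_le_trans/(_ m2t); rewrite ltxx.
  - move: m12'; rewrite /m2; case: (leP t t2) => tt2; first by rewrite (max_idPr st).
    by case: (leP t2 s) => // t2s /(le_lt_trans sm1); rewrite ltxx.
  - exact: le_trans tT.
  - exact: gJ.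
have F3 : E m2 t.
  have [tm2|m2t'] := leP t m2.
    by rewrite (_ : m2 = t); [exact: Erefl|apply/eqP; rewrite eq_le tm2 m2t].
  apply: (E3 f u cf su) => //.
  - by apply: lt_le_trans s0 _; exact: le_trans m12.
  - move: m2t'; rewrite /m2; case: (leP t t2) => tt2; last by rewrite le_max lexx orbT.
    by rewrite (max_idPr st) ltxx.
have C0 : 0 <= C by apply: le_trans C1.
have comb (w x y z : R) : 0 <= w -> x <= C * (w + J) -> y <= C * (x + J) ->
    z <= C * (y + J) -> z <= 3 * C ^+ 3 * (w + J).
  move=> w0 xw yx zy; set W := w + J in xw *.
  have JW : J <= W by rewrite lerDr.
  have W0 : 0 <= W by apply: le_trans JW.
  have C2 : C <= C ^+ 2 by rewrite expr2 ler_peMl.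
  have C3 : C ^+ 2 <= C ^+ 3 by rewrite (exprS _ 2) ler_peMl// exprn_ge0.
  have y1 : y <= 2 * C ^+ 2 * W.
    apply: le_trans yx _; apply: le_trans (_ : C * (C * W + W) <= _).
      by rewrite ler_wpM2l// lerD.
    have : C * W <= C ^+ 2 * W by rewrite ler_wpM2r.
    have -> : C * (C * W + W) = C ^+ 2 * W + C * W by ring.
    by lra.
  apply: le_trans zy _; apply: le_trans (_ : C * (2 * C ^+ 2 * W + W) <= _).
    by rewrite ler_wpM2l// lerD.
  have : C * W <= C ^+ 3 * W by rewrite ler_wpM2r// (le_trans C2).
  have -> : C * (2 * C ^+ 2 * W + W) = 2 * (C ^+ 3 * W) + C * W by ring.
  by lra.
split.
  exact: (comb _ _ _ _ (N0 s) F1.1 F2.1 F3.1).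
exact: (comb _ _ _ _ (N0 t) F3.2 F2.2 F1.2).
Qed.

End ZoneChaining.

(** * Perturbations of the identity and the gauge identity *)

Section Helpers.
Context {R : realType}.

Definition near_identity {n} (Q : 'M[R[i]]_n) : Prop :=
  [/\ Q \in unitmx, mxnorm (invmx Q) <= 2 * mxnorm (1%:M : 'M[R[i]]_n) &
     mxnorm Q <= mxnorm (1%:M : 'M[R[i]]_n) + 1].

(** [invmx (1 + X) = 1 - X *m invmx (1 + X)], and the last term is absorbed. *)
Lemma neumann {n} (X : 'M[R[i]]_n) : mxnorm X <= 2^-1 ->
  1%:M + X \in unitmx /\
  mxnorm (invmx (1%:M + X)) <= 2 * mxnorm (1%:M : 'M[R[i]]_n).
Proof.
move=> X2.
have u : 1%:M + X \in unitmx.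
  apply: injective_unitmx => c; rewrite mulmxDl mul1mx => /eqP.
  rewrite addr_eq0 => /eqP cE; apply: mxnorm_eq0; apply/eqP.
  rewrite eq_le mxnorm_ge0 andbT.
  have : mxnorm c <= 2^-1 * mxnorm c.
    rewrite {1}cE mxnormN; apply: le_trans (mxnormM _ _) _.
    by rewrite ler_wpM2r ?mxnorm_ge0.
  by lra.
split=> //; set Q := 1%:M + X in u *.
have QE : invmx Q = 1%:M - X *m invmx Q.
  by apply/eqP; rewrite eq_sym subr_eq -[X in X + _](mul1mx (invmx Q)) -mulmxDl mulmxV.
have : mxnorm (invmx Q) <= mxnorm (1%:M : 'M[R[i]]_n) + 2^-1 * mxnorm (invmx Q).
  rewrite {1}QE; apply: le_trans (mxnormB _ _) _; rewrite lerD2l.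
  by apply: le_trans (mxnormM _ _) _; rewrite ler_wpM2r ?mxnorm_ge0.
by lra.
Qed.

(** [M] transforms the coefficient [A] into [X], then [Q] transforms [X] into [Y]
    up to the error [Rm], and [E] removes the part [W] of [Y]. *)
Lemma gauge_algebra {n} (E E' Q M A X Y W Rm dE dQ dM : 'M[R[i]]_n) :
  E' *m E = 1%:M -> Q \in unitmx ->
  M *m A + dM = X *m M -> dQ = Rm - Q *m X + Y *m Q -> dE = - (E *m W) ->
  (dE *m Q + E *m dQ) *m M + (E *m Q) *m dM + (E *m Q *m M) *m A =
  (E *m (Y - W) *m E' + E *m (Rm *m invmx Q) *m E') *m (E *m Q *m M).
Proof.
move=> EE Qu MA -> ->.
rewrite -addrA -[E *m Q *m M *m A]mulmxA -mulmxDr [dM + _]addrC MA.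
have -> : (E *m (Y - W) *m E' + E *m (Rm *m invmx Q) *m E') *m (E *m Q *m M)
    = E *m ((Y - W) *m Q + Rm) *m M.
  rewrite -mulmxDl -mulmxDr -!mulmxA (mulmxA E' E) EE mul1mx; congr (E *m _).
  by rewrite mulmxA; congr (_ *m M); rewrite mulmxDl -(mulmxA Rm) mulVmx// mulmx1.
rewrite mulmxA -mulmxDl; congr (_ *m M).
rewrite mulNmx -!mulmxA -mulmxN -!mulmxDr; congr (E *m _).
rewrite mulmxBl -addrA (_ : Rm - Q *m X + Y *m Q + Q *m X = Rm + Y *m Q).
  by rewrite [Rm + _]addrC addrA [- _ + _]addrC.
by rewrite addrAC subrK.
Qed.

Lemma small_power (C b : R) : 0 <= C -> 0 < b ->
  exists2 rho : R, 0 < rho & forall z, 0 <= z <= rho -> C * z `^ b <= 2^-1.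
Proof.
move=> C0 b0; pose q := (2 * (C + 1))^-1.
have q0 : 0 < q by rewrite invr_gt0 mulr_gt0// ltr_wpDl.
exists (q `^ b^-1); first exact: powR_gt0.
move=> z /andP[z0 zq]; have : z `^ b <= q.
  apply: le_trans (_ : (q `^ b^-1) `^ b <= _).
    by apply: ge0_ler_powR; rewrite ?nnegrE ?powR_ge0// ltW.
  by rewrite -powRrM mulVf ?lt0r_neq0// powRr1// ltW.
move=> zb; apply: le_trans (_ : C * q <= _); first by rewrite ler_wpM2l.
by rewrite /q invfM mulrCA ger_pMr ?invr_gt0// ler_pdivrMr ?ltr_wpDl// mul1r lerDl.
Qed.

End Helpers.

(** * Bounds of symbols *)

Section Symbols.
Context {R : realType} {d p q : nat}.
Implicit Types (V : set (R * 'rV[R]_d)) (f : R -> 'rV[R]_d -> 'M[R[i]]_(p, q)).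

Lemma jbr_ge1 (ell : 'I_d -> R) xi : 1 <= jbr ell xi.
Proof. exact: bigmax_ge_id. Qed.

Lemma jbr_gt0 (ell : 'I_d -> R) xi : 0 < jbr ell xi.
Proof. exact: lt_le_trans (jbr_ge1 ell xi). Qed.

Lemma continuous_on_slice V f xi (D : set R) : continuous_on V f ->
  (forall t, D t -> V (t, xi)) -> mcont D (f^~ xi).
Proof.
move=> /subspace_continuousP cf DV; apply/mcont_withinP/subspace_continuousP.
move=> t Dt; have := cf (t, xi) (DV t Dt).
have c : (fun s : R => (s, xi)) @ within D (nbhs t) --> within V (nbhs (t, xi)).
  have c0 : (fun s : R => (s, xi)) @ nbhs t --> nbhs (t, xi).
    move=> B [[P Q] /= [Pt Qxi] PQB]; apply: filterS Pt => s Ps.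
    by apply: (PQB (s, xi)); split => //; exact: nbhs_singleton.
  move=> B /= HB; have {}HB := c0 _ HB.
  change (nbhs t (fun s => V (s, xi) -> B (s, xi))) in HB.
  change (\forall s \near within D (nbhs t), B (s, xi)).
  near=> s; have Ds : D s by near: s; exact: withinT.
  have : V (s, xi) -> B (s, xi) by near: s; apply: cvg_within.
  by apply; exact: DV.
move=> H; exact: (cvg_comp _ _ c H).
Unshelve. all: by end_near. Qed.

Lemma symbol_bound ell a V f : symbol ell a V f ->
  exists2 C : R, 0 <= C & forall t xi, V (t, xi) ->
    mxnorm (f t xi) <= C * zeta ell t xi `^ a.
Proof.
move=> [_ [g [[g0 _] /(_ 0%N)[C HC]]]]; exists `|C| => // t xi Vt.
rewrite -g0//; apply: le_trans (HC t xi Vt) _.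
by rewrite ler_wpM2r ?powR_ge0 ?ler_norm.
Qed.

Lemma symbol_log_bound ell a V f : symbol_log ell a V f ->
  exists r : nat, exists2 C : R, 0 <= C & forall t xi, V (t, xi) ->
    mxnorm (f t xi) <= C * (zeta ell t xi `^ a * (1 + `|ln (zeta ell t xi)|) ^+ r).
Proof.
move=> [_ [g [[g0 _] [r /(_ 0%N)[C HC]]]]]; exists r, `|C| => // t xi Vt.
rewrite -g0//; apply: le_trans (HC t xi Vt) _; rewrite -mulrA.
by rewrite ler_wpM2r ?mulr_ge0 ?powR_ge0 ?exprn_ge0 ?addr_ge0 ?ler_norm.
Qed.

Lemma sum_bound V (f : nat -> R -> 'rV[R]_d -> 'M[R[i]]_(p, q))
    (g : R -> 'rV[R]_d -> R) (j m : nat) :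
  (forall k, (j <= k)%N -> exists2 C : R, 0 <= C & forall t xi, V (t, xi) ->
     mxnorm (f k t xi) <= C * g t xi) ->
  exists2 C : R, 0 <= C & forall t xi, V (t, xi) ->
    mxnorm (\sum_(j <= k < m) f k t xi) <= C * g t xi.
Proof.
move=> H; elim: m => [|m [C C0 IH]].
  by exists 0 => // t xi _; rewrite big_geq// mxnorm0 mul0r.
have [mj|jm] := ltnP m j.
  by exists 0 => // t xi _; rewrite big_geq// mxnorm0 mul0r.
have [C' C'0 HC'] := H m jm; exists (C + C'); first exact: addr_ge0.
move=> t xi Vt; rewrite big_nat_recr//= mulrDl.
by apply: le_trans (mxnormD _ _) _; rewrite lerD ?IH ?HC'.
Qed.

End Symbols.

Section PowerPrimitive.
Context {R : realType}.

(** The bounds of the coefficients are [C * (L * z `^ (b - 1))] with [z = L * t]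
    and [L] the size of [xi]; their primitive depends on [z] only, which makes
    the estimates uniform in [xi]. *)
Definition power_primitive (L C b t : R) : R := C / b * (L * t) `^ b.

Lemma is_derive_power_primitive (L C b t : R) : 0 < L -> 0 < t -> b != 0 ->
  is_derive t (1 : R) (power_primitive L C b) (C * (L * (L * t) `^ (b - 1))).
Proof.
move=> L0 t0 b0; have Lt0 : 0 < L * t by rewrite mulr_gt0.
have D1 : is_derive t (1 : R) (fun t : R => L * t) L.
  by apply: is_derive_eq; rewrite /GRing.scale/= mulr1.
have D2 := @is_derive1_comp _ (fun x => x `^ b) (fun t : R => L * t) t _ _
  (is_derive1_powR b Lt0) D1.
have D3 := is_deriveM (is_derive_cst (C / b) t 1) D2.
apply: (is_derive_eq D3); rewrite /GRing.scale/= mulr0 addr0.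
by field.
Qed.

End PowerPrimitive.

(** * The zone near the initial time *)

Section ZoneP.
Context {R : realType} {d n : nat}.
Local Notation fld := (R -> 'rV[R]_d -> 'M[R[i]]_n).
Variables (ell : 'I_d -> R) (T rhobar : R) (A MP : fld) (BP : 'rV[R]_d -> 'M[R[i]]_n).
Variables (RP : fld) (aP : R) (DPs NPs RPs : nat -> fld) (m : nat) (beta : R).
Hypothesis T0 : 0 < T.
Hypothesis rb : 0 < rhobar < 1.
Hypothesis HP : hyp_P ell T rhobar A MP BP RP aP.
Hypothesis HR : renorm_P ell T rhobar BP RP aP DPs NPs RPs.
Hypothesis m0 : (0 < m)%N.
Hypothesis BPle : forall xi, mxnorm (BP xi) <= beta.
Hypothesis m_large : 2 * beta <= m%:R * (aP + 1).

Local Notation L := (jbr ell).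
Local Notation z := (zeta ell).
Local Notation V := (zoneP ell T rhobar).

Let a1 : 0 < aP + 1.
Proof. by have := aP_gt HP; lra. Qed.

Lemma zeta_gt0 (t : R) (xi : 'rV[R]_d) : 0 < t -> 0 < z t xi.
Proof. by move=> t0; rewrite mulr_gt0// jbr_gt0. Qed.

Lemma zoneP_zeta t xi : V (t, xi) -> 0 < z t xi <= 1.
Proof.
case=> /andP[t0 tT] /= zr; rewrite zeta_gt0//=.
by case/andP: rb => _ /ltW; exact: le_trans.
Qed.

Lemma BP_is_jordan xi : is_jordan (BP xi).
Proof.
have rb0 : 0 < rhobar by case/andP: rb.
pose t := Num.min T (rhobar / L xi).
have tT : 0 < t <= T.
  by rewrite /t lt_min T0 divr_gt0 ?jbr_gt0//= ge_min lexx.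
apply: (BP_jordan HP (t := t)); split => //=.
rewrite /zeta mulrC -ler_pdivlMr ?jbr_gt0//.
by rewrite /t ge_min lexx orbT.
Qed.

Lemma EPE t xi : EP ell BP t xi = jordan_exp (BP xi) (- ln (z t xi)).
Proof.
rewrite /EP -mexp_jordan; last exact: BP_is_jordan.
by rewrite rmorphN.
Qed.

Definition gaugeP : fld :=
  fun t xi => EP ell BP t xi *m renQ NPs m t xi *m MP t xi.

(** The coefficient of the system for [gaugeP *m U]; [jordan_exp (BP xi) s] is
    [EP ell BP t xi]. *)
Definition coefP : fld := fun t xi =>
  let s := - ln (z t xi) in
  jordan_exp (BP xi) s *m ((L xi)%:C%C *: \sum_(1 <= k < m.+1) DPs k t xi)
    *m jordan_exp (BP xi) (- s)
  + jordan_exp (BP xi) s *m (((L xi)%:C%C *: RPs m t xi) *m invmx (renQ NPs m t xi))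
    *m jordan_exp (BP xi) (- s).

Lemma zoneP_near t xi : 0 < t < T -> z t xi < rhobar ->
  \forall h \near (0 : R), V (t + h, xi).
Proof.
move=> /andP[t0 tT] zr.
have c : (fun h : R => t + h) @ (0 : R) --> t.
  rewrite -[X in _ --> X]addr0; apply: cvgD; [exact: cvg_cst|exact: cvg_id].
have c2 : (fun h : R => z (t + h) xi) @ (0 : R) --> z t xi.
  by apply: cvgM; [exact: cvg_cst|exact: c].
near=> h; split => /=; last by apply: ltW; near: h; exact: (cvgr_lt _ c2).
apply/andP; split; first by near: h; exact: (cvgr_gt _ c).
by apply: ltW; near: h; exact: (cvgr_lt _ c).
Unshelve. all: by end_near. Qed.

Lemma mder_EP t xi : 0 < t ->
  mder (fun t => EP ell BP t xi) t (- (EP ell BP t xi *m ((t^-1)%:C%C *: BP xi))).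
Proof.
move=> t0.
have -> : (fun t => EP ell BP t xi) =
    (fun t => jordan_exp (BP xi) (- ln (z t xi))).
  by apply/funext => s; exact: EPE.
rewrite EPE.
have D1 : is_derive t (1 : R) (fun s : R => L xi * s) (L xi).
  by apply: is_derive_eq; rewrite /GRing.scale/= mulr1.
have D2 := @is_derive1_comp _ (@ln R) (fun s : R => L xi * s) t _ _
  (is_derive1_ln (zeta_gt0 xi t0)) D1.
have D3 : is_derive t (1 : R) (fun s => - ln (z s xi)) (- t^-1).
  apply: (is_derive_eq (is_deriveN D2)); rewrite /zeta.
  by field; rewrite !lt0r_neq0 ?jbr_gt0.
have jB := BP_is_jordan xi.
have := @mder_comp _ _ _ (jordan_exp (BP xi)) (fun s => - ln (z s xi)) t _ _
  (mder_jordan_exp jB (- ln (z t xi))) D3.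
rewrite jordan_exp_comm// -scalemxAr rmorphN scaleNr; exact.
Qed.

Lemma mcont_EP xi (D : set R) : (forall t, D t -> 0 < t) ->
  mcont D (fun t => EP ell BP t xi).
Proof. by move=> D0; apply: mder_mcont => t /D0; exact: mder_EP. Qed.

Lemma mder_renQ (W : set (R * 'rV[R]_d)) (N : nat -> fld) (dN : nat -> 'M[R[i]]_n) t xi :
  (\forall h \near (0 : R), W (t + h, xi)) ->
  (forall k, (1 <= k <= m)%N -> is_dt W (N k) t xi (dN k)) ->
  mder ((renQ N m)^~ xi) t (\sum_(1 <= k < m.+1) dN k).
Proof.
move=> nW HN; rewrite -[X in mder _ _ X]add0r; apply: mderD; first exact: mder_cst.
rewrite /index_iota subSS subn0.
have : forall k, k \in iota 1 m -> (1 <= k <= m)%N.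
  by move=> k; rewrite mem_iota add1n ltnS.
elim: (iota 1 m) => [|k r IH] Hr.
  rewrite big_nil (_ : (fun t => _) = fun=> 0); first exact: mder_cst.
  by apply/funext => s; rewrite big_nil.
rewrite big_cons (_ : (fun t => _) =
    fun s => N k s xi + \sum_(j <- r) N j s xi); last first.
  by apply/funext => s; rewrite big_cons.
apply: mderD.
  by apply: is_dt_mder nW (HN k _); apply: Hr; rewrite mem_head.
by apply: IH => j jr; apply: Hr; rewrite in_cons jr orbT.
Qed.

(** A rate strictly below [aP + 1], which leaves room to absorb logarithms. *)
Let b := (aP + 1) / 2.

Let b0 : 0 < b.
Proof. by rewrite divr_gt0. Qed.

Lemma sum_NPs_small : exists2 C : R, 0 <= C & forall t xi, V (t, xi) ->
  mxnorm (\sum_(1 <= k < m.+1) NPs k t xi) <= C * z t xi `^ b.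
Proof.
apply: (@sum_bound _ _ _ _ V NPs (fun t xi => z t xi `^ b)) => k k1.
have [r [C C0 HC]] := symbol_log_bound (NPs_sym HR k1).
have bk : b < k%:R * (aP + 1).
  apply: lt_le_trans (_ : aP + 1 <= _); first by rewrite /b; have := a1; lra.
  by rewrite ler_peMl// ?ler1n// ltW.
have [C' C'0 HC'] := powR_log_le r bk.
exists (C * C'); first exact: mulr_ge0.
move=> t xi Vt; apply: le_trans (HC t xi Vt) _.
by rewrite -mulrA ler_wpM2l// HC'// zoneP_zeta.
Qed.

Lemma sum_DPs_bound : exists2 C : R, 0 <= C & forall t xi, V (t, xi) ->
  mxnorm (\sum_(1 <= k < m.+1) DPs k t xi) <= C * z t xi `^ (aP - b / 2).
Proof.
apply: (@sum_bound _ _ _ _ V DPs (fun t xi => z t xi `^ (aP - b / 2))) => k k1.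
have [r [C C0 HC]] := symbol_log_bound (DPs_sym HR k1).
have bk : aP - b / 2 < k%:R * (aP + 1) - 1.
  apply: lt_le_trans (_ : aP + 1 - 1 <= _); first by have := b0; lra.
  by rewrite lerD2r ler_peMl// ?ler1n// ltW.
have [C' C'0 HC'] := powR_log_le r bk.
exists (C * C'); first exact: mulr_ge0.
move=> t xi Vt; apply: le_trans (HC t xi Vt) _.
by rewrite -mulrA ler_wpM2l// HC'// zoneP_zeta.
Qed.

(** On [E D E^-1] the exponential contributes only logarithms; on the remainder
    it may cost [z `^ (- 2 * beta)], which [m_large] pays for. *)
Lemma coefP_bound : exists2 C : R, 0 <= C & forall t xi, V (t, xi) ->
  mxnorm (invmx (renQ NPs m t xi)) <= 2 * mxnorm (1%:M : 'M[R[i]]_n) ->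
  mxnorm (coefP t xi) <= C * (L xi * z t xi `^ (b - 1)).
Proof.
have [CD CD0 HD] := sum_DPs_bound.
have [r [CR CR0 HCR]] := symbol_log_bound (RPs_sym HR m0).
have beta0 : 0 <= beta := le_trans (mxnorm_ge0 (BP 0)) (BPle 0).
have e1 : b - 1 < aP - b / 2.
  by rewrite /b; have := a1; lra.
have e2 : b - 1 < aP by rewrite /b; have := a1; lra.
have [C1 C10 H1] := powR_log_le (n + n) e1.
have [C2 C20 H2] := powR_log_le (n + (r + n)) e2.
have [u u0 Hu] : exists2 u : R, 0 <= u & forall (B : 'M[R[i]]_n) s, mxnorm B <= beta ->
    mxnorm (unip B s) <= u * (1 + `|s|) ^+ n.
  exists (@unip_const R n beta); first exact: unip_const_ge0.
  by move=> B s; exact: unip_growth.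
have [g g0 Hg] : exists2 g : R, 0 <= g & forall (B : 'M[R[i]]_n) s, mxnorm B <= beta ->
    mxnorm (jordan_exp B s) <= g * expR (beta * `|s|) * (1 + `|s|) ^+ n.
  exists (2 * n%:R ^+ 2 * @unip_const R n beta).
    by rewrite mulr_ge0 ?unip_const_ge0.
  by move=> B s; exact: jordan_exp_growth.
have [w w0 wE] : exists2 w : R, 0 <= w & 2 * mxnorm (1%:M : 'M[R[i]]_n) = w.
  by exists (2 * mxnorm (1%:M : 'M[R[i]]_n)); rewrite ?mulr_ge0 ?mxnorm_ge0.
rewrite wE.
exists (u * CD * u * C1 + g * (CR * w) * g * C2).
  by rewrite addr_ge0// !mulr_ge0.
move=> t xi Vt invQ; have z01 := zoneP_zeta Vt.
have /andP[z0 z1] := z01.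
have L0 : 0 <= L xi by rewrite ltW// jbr_gt0.
pose lam := 1 + `|ln (z t xi)|.
have lam0 : 0 <= lam by rewrite addr_ge0.
have ul s : `|s| = `|ln (z t xi)| -> mxnorm (unip (BP xi) s) <= u * lam ^+ n.
  by move=> sE; have := Hu _ s (BPle xi); rewrite sE.
have gl s : `|s| = `|ln (z t xi)| ->
    mxnorm (jordan_exp (BP xi) s) <= g * (z t xi `^ (- beta) * lam ^+ n).
  move=> sE; have := Hg _ s (BPle xi); rewrite sE -[X in _ <= X]mulrA.
  rewrite (ler0_norm (_ : ln (z t xi) <= 0)) ?ln_le0// mulrN -mulNr.
  by rewrite /powR (gt_eqF z0) /lam (ler0_norm (_ : ln (z t xi) <= 0)) ?ln_le0.
rewrite mulrDl; apply: le_trans (mxnormD _ _) _; apply: lerD.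
  rewrite jordan_exp_conj; first last.
  - apply/is_diag_mxP => i j ij; rewrite mxE summxE big_nat_cond big1 ?mulr0// => k.
    rewrite andbT => /andP[k1 _].
    by have /is_diag_mxP := DPs_diag HR k1 Vt; apply.
  - exact: BP_is_jordan.
  apply: le_trans (mxnormM _ _) _.
  apply: le_trans (_ : (u * lam ^+ n * (L xi * (CD * z t xi `^ (aP - b / 2))))
      * (u * lam ^+ n) <= _).
    apply: ler_pM; rewrite ?mxnorm_ge0//; last by apply: ul; rewrite normrN normrN.
    apply: le_trans (mxnormM _ _) _; apply: ler_pM; rewrite ?mxnorm_ge0//.
      by apply: ul; rewrite normrN.
    by rewrite mxnormZr ger0_norm// ler_wpM2l// HD.
  rewrite (_ : _ * _ = u * CD * u * L xi *
     (z t xi `^ (aP - b / 2) * lam ^+ (n + n))); last by rewrite exprD; ring.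
  rewrite (_ : _ * (L xi * _) = u * CD * u * L xi * (C1 * z t xi `^ (b - 1)));
    last by ring.
  by rewrite ler_wpM2l ?H1// !mulr_ge0.
apply: le_trans (mxnormM _ _) _.
apply: le_trans (_ : (g * (z t xi `^ (- beta) * lam ^+ n)
    * (L xi * (CR * (z t xi `^ (m%:R * (aP + 1) + aP) * lam ^+ r)) * w))
    * (g * (z t xi `^ (- beta) * lam ^+ n)) <= _).
  apply: ler_pM; rewrite ?mxnorm_ge0//; last by apply: gl; rewrite normrN normrN.
  apply: le_trans (mxnormM _ _) _; apply: ler_pM; rewrite ?mxnorm_ge0//.
    by apply: gl; rewrite normrN.
  apply: le_trans (mxnormM _ _) _; apply: ler_pM; rewrite ?mxnorm_ge0//.
  by rewrite mxnormZr ger0_norm// ler_wpM2l// HCR.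
have zz : z t xi `^ (- beta) * z t xi `^ (m%:R * (aP + 1) + aP) * z t xi `^ (- beta)
    <= z t xi `^ aP.
  rewrite -!powRD ?(gt_eqF z0) ?implybT//; apply: powR_anti => //.
  by have := m_large; lra.
rewrite (_ : _ * _ = g * (CR * w) * g * L xi *
   ((z t xi `^ (- beta) * z t xi `^ (m%:R * (aP + 1) + aP) * z t xi `^ (- beta))
    * lam ^+ (n + (r + n)))); last by rewrite !exprD; ring.
rewrite (_ : _ * C2 * (L xi * _) = g * (CR * w) * g * L xi * (C2 * z t xi `^ (b - 1)));
  last by ring.
rewrite ler_wpM2l ?mulr_ge0//; apply: le_trans (H2 _ z01).
by rewrite ler_wpM2r ?exprn_ge0.
Qed.

Lemma EP_unit t xi : EP ell BP t xi \in unitmx.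
Proof.
rewrite EPE.
by have [] := mulmx1_unit (jordan_expK (BP_is_jordan xi) (- ln (z t xi))).
Qed.

Lemma gaugeP_eq t xi : 0 < t < T -> z t xi < rhobar ->
  renQ NPs m t xi \in unitmx ->
  gauge_eq (A^~ xi) (gaugeP^~ xi) (coefP^~ xi) t.
Proof.
move=> tT zr Qu; have /andP[t0 tT'] := tT.
have near_V := zoneP_near tT zr.
have Vt : V (t, xi).
  by split; [apply/andP; split => //=; exact: ltW|exact: ltW].
have Mu := MP_unit HP Vt.
have [dM /(is_dt_mder near_V) dM_ eqM] := P_eq HP Vt.
have [dN dN_ eqN] := RPs_eq HR m0 Vt.
have dQ := mder_renQ near_V dN_.
have dE := mder_EP xi t0.
have L0 : (L xi)%:C%C != 0 :> R[i].
  by rewrite (fmorph_eq0 (real_complex R)) gt_eqF ?jbr_gt0.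
exists ((- (EP ell BP t xi *m ((t^-1)%:C%C *: BP xi)) *m renQ NPs m t xi
    + EP ell BP t xi *m \sum_(1 <= k < m.+1) dN k) *m MP t xi
    + (EP ell BP t xi *m renQ NPs m t xi) *m dM).
  exact: (mderM (mderM dE dQ) dM_).
rewrite /gaugeP /coefP -EPE.
pose X := (t^-1)%:C%C *: BP xi + (L xi)%:C%C *: RP t xi.
pose Y := (t^-1)%:C%C *: BP xi + (L xi)%:C%C *: \sum_(1 <= k < m.+1) DPs k t xi.
have -> : (L xi)%:C%C *: \sum_(1 <= k < m.+1) DPs k t xi = Y - (t^-1)%:C%C *: BP xi.
  by rewrite /Y addrC addKr.
apply: (@gauge_algebra _ _ _ _ _ _ _ X) => //.
- by rewrite EPE -{2}[- ln _]opprK jordan_expK//; exact: BP_is_jordan.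
- by rewrite /X -eqM mulmxDl !mulmxKV.
- have Lz : (L xi)%:C%C * ((z t xi)^-1)%:C%C = (t^-1)%:C%C :> R[i].
    rewrite -rmorphM /zeta invfM mulrA divff ?mul1r//.
    by rewrite gt_eqF ?jbr_gt0.
  have LX : (L xi)%:C%C *: (((z t xi)^-1)%:C%C *: BP xi + RP t xi) = X.
    by rewrite scalerDr scalerA Lz.
  have LY : (L xi)%:C%C *: (((z t xi)^-1)%:C%C *: BP xi
      + \sum_(1 <= k < m.+1) DPs k t xi) = Y.
    by rewrite scalerDr scalerA Lz.
  rewrite eqN scalerDr scalerDr scalerN -scaler_sumr.
  rewrite [X in _ *: (X *: _)](_ : _ = ((L xi)%:C%C)^-1); last by rewrite fmorphV.
  rewrite scalerA divff// scale1r.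
  rewrite [(L xi)%:C%C *: (renQ NPs m t xi *m _)]scalemxAr scalemxAl LX LY.
  by rewrite [_ - _ - _]addrAC addrK subrK.
Qed.

Lemma zoneP_renQ : exists2 rho1, 0 < rho1 <= rhobar & forall t xi,
  0 < t <= T -> z t xi < rho1 ->
  near_identity (renQ NPs m t xi).
Proof.
have [C C0 HC] := sum_NPs_small.
have [rho rho0 Hrho] := small_power C0 b0.
have rb0 : 0 < rhobar by case/andP: rb.
exists (Num.min rho rhobar).
  by rewrite lt_min rho0 rb0 ge_min lexx orbT.
move=> t xi tT; have t0 : 0 < t by case/andP: tT.
rewrite lt_min => /andP[zrho zrhobar].
have Vt : V (t, xi) by split => //; exact: ltW.
have small : mxnorm (\sum_(1 <= k < m.+1) NPs k t xi) <= 2^-1.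
  apply: le_trans (HC t xi Vt) _; apply: Hrho.
  by rewrite !ltW// zeta_gt0.
have [Qu Qinv] := neumann small; split => //.
apply: le_trans (mxnormD _ _) _; rewrite lerD2l; apply: le_trans small _.
by rewrite invf_le1// ler1n.
Qed.

(** Where [Z_P] meets [Z_I] the gauge changes from [gaugeP] to the identity; as
    [z = rho0] there, all factors of [gaugeP] have bounds independent of [xi]. *)
Lemma gaugeP_comparable (rho1 rho0 : R) : 0 < rho0 < rho1 -> rho1 <= rhobar ->
  (forall t xi, 0 < t <= T -> z t xi < rho1 ->
  near_identity (renQ NPs m t xi)) ->
  exists2 c : R, 1 <= c & forall t xi, 0 < t <= T -> z t xi = rho0 ->
    forall v : 'cV[R[i]]_n, mxnorm (gaugeP t xi *m v) <= c * mxnorm v /\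
      mxnorm v <= c * mxnorm (gaugeP t xi *m v).
Proof.
move=> /andP[rho00 rho01] rho1b HQ.
have [CM CM0 HM] := symbol_bound (MP_sym HP).
have [CN CN0 HN] := symbol_bound (MPV_sym HP).
have [g g0 Hg] : exists2 g : R, 0 <= g & forall xi s, `|s| = `|ln rho0| ->
    mxnorm (jordan_exp (BP xi) s) <= g.
  exists (2 * n%:R ^+ 2 * @unip_const R n beta * expR (beta * `|ln rho0|)
    * (1 + `|ln rho0|) ^+ n).
    apply: mulr_ge0; last by rewrite exprn_ge0 ?addr_ge0.
    apply: mulr_ge0; last exact: expR_ge0.
    apply: mulr_ge0; first by rewrite mulr_ge0.
    by apply: unip_const_ge0; exact: le_trans (mxnorm_ge0 (BP 0)) (BPle 0).
  by move=> xi s sE; have := jordan_exp_growth s (BPle xi); rewrite sE.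
have [w w0 wE] : exists2 w : R, 0 <= w & mxnorm (1%:M : 'M[R[i]]_n) = w.
  by exists (mxnorm (1%:M : 'M[R[i]]_n)); rewrite ?mxnorm_ge0.
rewrite /near_identity wE in HQ.
exists (1 + g * (w + 1) * CM + CN * (2 * w) * g).
  by rewrite -addrA lerDl addr_ge0// !mulr_ge0// addr_ge0.
move=> t xi tT zE v.
have Vt : V (t, xi) by split => //=; rewrite zE (le_trans (ltW rho01)).
have [Qu Qinv Qn] : [/\ renQ NPs m t xi \in unitmx,
     mxnorm (invmx (renQ NPs m t xi)) <= 2 * w & mxnorm (renQ NPs m t xi) <= w + 1].
  by apply: HQ => //; rewrite zE.
have Mn := HM t xi Vt; have Nn := HN t xi Vt.
rewrite powRr0 !mulr1 in Mn Nn.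
have En : mxnorm (EP ell BP t xi) <= g.
  by rewrite EPE; apply: Hg; rewrite normrN zE.
have E'n : mxnorm (jordan_exp (BP xi) (ln (z t xi))) <= g.
  by apply: Hg; rewrite zE.
have Gn : mxnorm (gaugeP t xi) <= g * (w + 1) * CM.
  apply: le_trans (mxnormM _ _) _; apply: ler_pM; rewrite ?mxnorm_ge0//.
  by apply: le_trans (mxnormM _ _) _; apply: ler_pM; rewrite ?mxnorm_ge0.
have vE : v = invmx (MP t xi) *m invmx (renQ NPs m t xi)
    *m jordan_exp (BP xi) (ln (z t xi)) *m (gaugeP t xi *m v).
  have : jordan_exp (BP xi) (ln (z t xi)) *m EP ell BP t xi = 1%:M.
    by rewrite EPE jordan_expK//; exact: BP_is_jordan.
  rewrite /gaugeP; move: (jordan_exp _ _) (EP _ _ _ _) => E' E EE.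
  rewrite -!mulmxA (mulmxA E' E) EE mul1mx.
  by rewrite mulKmx// mulKmx// (MP_unit HP Vt).
split.
  apply: le_trans (mxnormM _ _) _; rewrite ler_wpM2r ?mxnorm_ge0//.
  apply: le_trans Gn _; rewrite addrAC lerDr.
  by rewrite addr_ge0// !mulr_ge0.
rewrite {1}vE; apply: le_trans (mxnormM _ _) _; rewrite ler_wpM2r ?mxnorm_ge0//.
apply: le_trans (_ : CN * (2 * w) * g <= _); last first.
  by rewrite lerDr addr_ge0// !mulr_ge0// addr_ge0.
apply: le_trans (mxnormM _ _) _; apply: ler_pM; rewrite ?mxnorm_ge0//.
by apply: le_trans (mxnormM _ _) _; apply: ler_pM; rewrite ?mxnorm_ge0.
Qed.

Lemma mcont_gaugeP xi (rho0 : R) (D : set R) : rho0 <= rhobar ->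
  (forall t, D t -> 0 < t <= T /\ z t xi <= rho0) -> mcont D (gaugeP^~ xi).
Proof.
move=> rho0b HD.
have DV t : D t -> V (t, xi).
  by move=> /HD[tT zr]; split => //=; exact: le_trans rho0b.
apply: mcontM; last exact: continuous_on_slice (MP_sym HP).1 DV.
apply: mcontM.
  by apply: mcont_EP => t /HD[/andP[]].
apply: mcontD; first exact: mcont_cst.
have E : (fun s => \sum_(1 <= k < m.+1) NPs k s xi) =
   (fun s => \sum_(1 <= k < m.+1 | (1 <= k < m.+1)%N) NPs k s xi).
  by apply/funext => s; rewrite [LHS]big_nat.
rewrite E; apply: mcont_sum => k /andP[k1 _].
exact: continuous_on_slice (NPs_sym HR k1).1 DV.
Qed.

(** [rho1] makes [Q_P] invertible in the zone, and [C] may depend on [rho0] but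
    not on [xi].  [G] stands for the gauge of the whole strip, of which only the
    values in the zone and on its border are prescribed. *)
Lemma zoneP_estimates : exists2 rho1, 0 < rho1 <= rhobar & forall rho0, 0 < rho0 < rho1 ->
  exists2 C : R, 1 <= C & forall xi (G : R -> 'M[R[i]]_n),
    (forall t, 0 < t <= T -> z t xi < rho0 -> G t = gaugeP t xi) ->
    (forall t, 0 < t <= T -> z t xi = rho0 -> G t = 1%:M) ->
    [/\ forall t, 0 < t <= T -> z t xi < rho0 -> G t \in unitmx,
       interval_estimate T (A^~ xi) G 0 (rho0 / L xi) C &
       forall C', mcont `]0, T] (A^~ xi) -> two_sided_estimate T (A^~ xi) G C' -> has_limits T (A^~ xi) G].
Proof.
have [rho1 /andP[rho10 rho1b] HQ] := zoneP_renQ.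
exists rho1; first by rewrite rho10.
move=> rho0 /andP[rho00 rho01].
have [CK CK0 HK] := coefP_bound.
have [c c1 Hc] := gaugeP_comparable (introT andP (conj rho00 rho01)) rho1b HQ.
have Cb0 : 0 <= CK / b by rewrite divr_ge0// ltW.
have rho0_1 : rho0 <= 1.
  by apply: ltW; apply: lt_trans rho01 _; apply: le_lt_trans rho1b _; case/andP: rb.
exists (c ^+ 2 * expR (CK / b)).
  by rewrite mulr_ege1 ?expr_ge1// ?(le_trans ler01 c1)// -expR0 ler_expR.
move=> xi G GP G1.
have L0 : 0 < L xi by exact: jbr_gt0.
have zlt t : (z t xi < rho0) = (t < rho0 / L xi) by rewrite ltr_pdivlMr// mulrC.
have zle t : (z t xi <= rho0) = (t <= rho0 / L xi) by rewrite ler_pdivlMr// mulrC.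
pose kap t := CK * (L xi * z t xi `^ (b - 1)).
have dk (t : R) : 0 < t -> is_derive t (1 : R) (power_primitive (L xi) CK b) (kap t).
  by move=> t0; apply: is_derive_power_primitive; rewrite ?lt0r_neq0.
have kap0 t : 0 <= kap t by rewrite !mulr_ge0 ?powR_ge0// ltW.
have Kv t (v : 'cV[R[i]]_n) : 0 < t <= T -> z t xi < rho0 ->
    mxnorm (coefP t xi *m v) <= kap t * mxnorm v.
  move=> tT zr; apply: le_trans (mxnormM _ _) _; rewrite ler_wpM2r ?mxnorm_ge0//.
  have [_ Qi _] := HQ t xi tT (lt_trans zr rho01).
  apply: HK => //; split => //=; apply: ltW; apply: lt_trans zr _.
  exact: lt_le_trans rho1b.
have geq t : 0 < t < T -> z t xi < rho0 ->
    gauge_eq (A^~ xi) (gaugeP^~ xi) (coefP^~ xi) t.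
  move=> /andP[t0 tT] zr; have [Qu _ _] : near_identity (renQ NPs m t xi).
    by apply: HQ; rewrite ?t0 ?ltW// (lt_trans zr).
  apply: gaugeP_eq; rewrite ?t0//.
  by apply: lt_trans zr _; exact: lt_le_trans rho1b.
split.
- move=> t tT zr; rewrite GP//.
  have [Qu _ _] := HQ t xi tT (lt_trans zr rho01).
  rewrite !unitmx_mul EP_unit Qu/=; apply: (MP_unit HP); split => //=.
  by apply: ltW; apply: lt_trans zr _; exact: lt_le_trans rho1b.
- apply: (@interval_estimate_of_gauge _ _ T (A^~ xi) G (gaugeP^~ xi) (coefP^~ xi)
      (power_primitive (L xi) CK b) kap) => //.
  + apply: (@mcont_gaugeP xi rho0); first exact: le_trans (ltW rho01) rho1b.
    by move=> t [t0 _ tr tT]; rewrite t0 tT zle.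
  + apply: continuous_in_subspaceT => t /set_mem[t0 _ _ _].
    exact: is_derive_continuous (dk t t0).
  + move=> t t0 _ tr tT; have zr : z t xi < rho0 by rewrite zlt.
    split.
    * by apply: geq => //; rewrite t0.
    * exact: dk.
    * exact: kap0.
    * by rewrite GP// t0 ltW.
    * move=> v; apply: le_trans (normr_mxip_le _ _) _.
      rewrite -mxnorm_sqr expr2 mulrC mulrA; apply: ler_wpM2r; first exact: mxnorm_ge0.
      by apply: Kv => //; rewrite t0 ltW.
  + move=> t [t0 _ tr tT] v; have tT' : 0 < t <= T by rewrite t0.
    move: tr; rewrite -zle le_eqVlt => /predU1P[zE|zr].
      by rewrite G1// mul1mx; exact: Hc.
    by rewrite GP//; split; rewrite ler_peMl ?mxnorm_ge0.
  + move=> s t [s0 _ _ _] [t0 _ tr _]; rewrite lerBlDr.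
    apply: le_trans (_ : CK / b * 1 <= _).
      apply: ler_wpM2l => //; apply: powR_le1; first exact: ltW.
      apply/andP; split; first exact: mulr_gt0.
      by apply: le_trans rho0_1; have := tr; rewrite -zle.
    rewrite mulr1 lerDl; apply: mulr_ge0 => //; exact: powR_ge0.
- move=> C' cA est f u cf su fT.
  pose b' := Num.min T (rho0 / L xi).
  have b'0 : 0 < b' by rewrite /b' lt_min T0 divr_gt0.
  have b'T : b' <= T by rewrite /b' ge_min lexx.
  have tb t : 0 < t < b' -> [/\ 0 < t < T, 0 < t <= T & z t xi < rho0].
    move=> /andP[t0]; rewrite /b' lt_min => /andP[tT tr].
    by rewrite t0 tT (ltW tT) zlt.
  have JE : gint G f T = (fine (gint G f T))%:E.
    by rewrite fineK// ge0_fin_numE ?gint_ge0.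
  pose J := fine (gint G f T).
  have lim : exists v : 'cV[R[i]]_n, gaugeP t xi *m u t @[t --> 0^'+] --> v.
    apply: (@zone_limit _ _ (A^~ xi) (gaugeP^~ xi) (coefP^~ xi) f u
      (power_primitive (L xi) CK b) kap b' 0 (C' * (mxnorm (G b' *m u b') + J))
      `]0, T]%classic (fun x => (mxnorm (G x *m f x))%:E)) => //.
    + apply: (@mcont_gaugeP xi rho0); first exact: le_trans (ltW rho01) rho1b.
      move=> t; rewrite /= in_itv/= /b' le_min => /andP[t0 /andP[tT tr]].
      by rewrite t0 tT zle.
    + apply: mcontW cf => t; rewrite /= !in_itv/= => /andP[-> /le_trans]; exact.
    + by move=> t /tb[tT tT' zr]; exact: sder_mder tT (su t tT').
    + by move=> t /tb[tT tT' zr]; exact: geq.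
    + move=> t /tb[tT tT' zr]; have t0 : 0 < t by case/andP: tT.
      split; first exact: dk.
        by apply: mulr_ge0 => //; exact: powR_ge0.
      by move=> v; exact: Kv.
    + move=> t tb'; have [tT tT' zr] := tb t tb'; rewrite -GP//.
      have /andP[t0 tlt] := tb'.
      have := est f u cf su t b' J t0 (ltW tlt) b'T.
      by case=> //; rewrite -JE; exact: gint_le.
    + by move=> t; rewrite /= !in_itv/= => /andP[-> /ltW /le_trans]; exact.
    + by move=> t _; rewrite lee_fin mxnorm_ge0.
    + by move=> t /tb[_ tT' zr]; rewrite GP.
  have [v Hv] := lim; exists v; apply: cvg_trans Hv; apply: near_eq_cvg.
  near=> t; have t0 : 0 < t by near: t; exact: nbhs_right_gt.
  have tlt : t < b' by near: t; exact: nbhs_right_lt.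
  have [tT tT' zr] : [/\ 0 < t < T, 0 < t <= T & z t xi < rho0] by apply: tb; rewrite t0.
  by rewrite GP.
Unshelve. all: by end_near. Qed.

End ZoneP.

(** * The hyperbolic zone *)

Section RunningIntegral.
Context {R : realType}.
Notation mu := (@lebesgue_measure R).

Lemma Rintegral_primitive (f P : R -> R) (a b : R) : a <= b ->
  {within `[a, b], continuous f} -> continuous P ->
  (forall x, a < x < b -> is_derive x (1 : R) P (f x)) ->
  Rintegral mu `[a, b] f = P b - P a.
Proof.
rewrite le_eqVlt => /predU1P[<- _ _ _|ab cf cP dP].
  by rewrite set_itv1 Rintegral_set1 subrr.
rewrite /Rintegral (@continuous_FTC2 _ f P)//.
- split; first by move=> x; rewrite in_itv/= => /dP[].
    by apply: cvg_at_right_filter; exact: cP.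
  by apply: cvg_at_left_filter; exact: cP.
- by move=> x; rewrite in_itv/= => /dP[? E]; rewrite derive1E E.
Qed.

Lemma running_integral (f : R -> R) (a b : R) : a <= b ->
  {within `[a, b], continuous f} ->
  let F t := Rintegral mu `[a, t] f in
  [/\ F a = 0, {within `[a, b], continuous F} &
      forall t, a < t < b -> is_derive t (1 : R) F (f t)].
Proof.
move=> ab cf F; have [P cP dP] := antiderivative_cc ab cf.
have FE t : a <= t <= b -> F t = P t - P a.
  move=> /andP[at_ tb]; apply: Rintegral_primitive => //.
    apply: continuous_subspaceW cf => x; rewrite /= !in_itv/= => /andP[-> /le_trans].
    by apply.
  by move=> x /andP[ax xt]; apply: dP; rewrite ax (lt_le_trans xt).
split.
- by rewrite FE ?lexx// subrr.
- apply: (@subspace_eq_continuous _ _ _ (fun t => P t - P a)).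
    by move=> t /set_mem; rewrite /= in_itv/= => /FE.
  by apply: continuous_subspaceT => t; apply: cvgB; [exact: cP|exact: cvg_cst].
- move=> t /andP[at_ tb].
  have D := is_deriveB (dP t (introT andP (conj at_ tb))) (is_derive_cst (P a) t 1).
  rewrite subr0 in D; apply: (near_eq_is_derive _ D).
  near=> x; apply/esym/FE; apply/andP; split; apply: ltW.
    by near: x; exact: lt_nbhsr.
  by near: x; exact: lt_nbhsl.
Unshelve. all: by end_near. Qed.

End RunningIntegral.

Section ZoneH.
Context {R : realType} {d n : nat}.
Local Notation fld := (R -> 'rV[R]_d -> 'M[R[i]]_n).
Variables (ell : 'I_d -> R) (T rhobar : R) (lam : R -> 'M[R]_d).
Variables (A MH DH BH BHinf RH : fld) (aH : R) (DHs NHs RHs : nat -> fld).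
Variables (m : nat) (beta : R).
Hypothesis rb : 0 < rhobar < 1.
Hypothesis HH : hyp_H ell T rhobar lam A MH DH BH BHinf RH aH.
Hypothesis HR : renorm_H ell T rhobar lam DH BH RH DHs NHs RHs.
Hypothesis m0 : (0 < m)%N.

Local Notation L := (jbr ell).
Local Notation z := (zeta ell).
Local Notation V := (zoneH ell T rhobar).
Local Notation l1 := (ell_min ell + 1).

Hypothesis beta0 : 0 <= beta.
Hypothesis BHle : forall t xi, V (t, xi) -> mxnorm (BH t xi) <= beta.
Hypothesis l10 : 0 < l1.
Hypothesis m_large : 2 * beta < m%:R * l1.

Let rb0 : 0 < rhobar. Proof. by case/andP: rb. Qed.

Lemma zoneH_zeta t xi : V (t, xi) -> 1 <= z t xi.
Proof.
case=> _ /=; apply: le_trans; rewrite invf_ge1//.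
by case/andP: rb => _ /ltW.
Qed.

Lemma zoneH_near t xi : 0 < t < T -> rhobar^-1 < z t xi ->
  \forall h \near (0 : R), V (t + h, xi).
Proof.
move=> /andP[t0 tT] zr.
have c : (fun h : R => t + h) @ (0 : R) --> t.
  rewrite -[X in _ --> X]addr0; apply: cvgD; [exact: cvg_cst|exact: cvg_id].
have c2 : (fun h : R => z (t + h) xi) @ (0 : R) --> z t xi.
  by apply: cvgM; [exact: cvg_cst|exact: c].
near=> h; split => /=; last by apply: ltW; near: h; exact: (cvgr_gt _ c2).
apply/andP; split; first by near: h; exact: (cvgr_gt _ c).
by apply: ltW; near: h; exact: (cvgr_lt _ c).
Unshelve. all: by end_near. Qed.

Definition diagB (t : R) (xi : 'rV[R]_d) : 'M[R[i]]_n := diag_mx (\row_i BH t xi i i).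

Lemma mxnorm_diag_le (B : 'M[R[i]]_n) : mxnorm (diag_mx (\row_i B i i)) <= mxnorm B.
Proof.
rewrite ler_sqrt ?mxnorm2_ge0//.
apply: ler_sum => i _; apply: ler_sum => j _; rewrite !mxE.
case: eqVneq => [->|_]; first by rewrite mulr1n.
by rewrite mulr0n /= expr0n/= addr0 addr_ge0 ?sqr_ge0.
Qed.

Section FixedRho.
Variable rho0 : R.
Hypothesis rho0b : 0 < rho0 < rhobar.

Definition startH xi : R := (L xi)^-1 * rho0^-1.

Lemma startH_gt0 xi : 0 < startH xi.
Proof. by rewrite mulr_gt0// invr_gt0 ?jbr_gt0//; case/andP: rho0b. Qed.

Lemma startH_le t xi : (startH xi <= t) = (rho0^-1 <= z t xi).
Proof. by rewrite /startH mulrC ler_pdivrMr ?jbr_gt0// mulrC. Qed.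

Lemma startH_lt t xi : (startH xi < t) = (rho0^-1 < z t xi).
Proof. by rewrite /startH mulrC ltr_pdivrMr ?jbr_gt0// mulrC. Qed.

Lemma zoneH_of_start t xi : startH xi <= t -> t <= T -> V (t, xi).
Proof.
move=> st tT; split.
  by apply/andP; split => //=; exact: lt_le_trans (startH_gt0 xi) st.
rewrite /=; move: st; rewrite startH_le; apply: le_trans.
by rewrite lef_pV2 ?posrE//; case/andP: rho0b => // ? /ltW.
Qed.

Lemma bH_props i xi : startH xi <= T ->
  let c t := bH ell rho0 BH i t xi in
  [/\ c (startH xi) = 0, ccont `[startH xi, T] c &
    forall t, startH xi < t < T -> cder c t (t^-1%:C%C * BH t xi i i)].
Proof.
move=> sT c.
have cB : mcont `[startH xi, T] (BH^~ xi).
  apply: continuous_on_slice (BH_sym HH).1 _ => t; rewrite /= in_itv/= => /andP[].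
  exact: zoneH_of_start.
have cinv : {within `[startH xi, T], continuous (fun s : R => s^-1)}.
  apply: continuous_in_subspaceT => s /set_mem; rewrite /= in_itv/= => /andP[ss _].
  by apply: inv_continuous; rewrite gt_eqF// (lt_le_trans (startH_gt0 xi)).
have cf (f : R -> R) : {within `[startH xi, T], continuous f} ->
    {within `[startH xi, T], continuous (fun s => s^-1 * f s)}.
  by move=> cf x; apply: cvgM; [exact: cinv|exact: cf].
have [r0 cr dr] := running_integral sT (cf _ (cB i i).1).
have [i0 ci di] := running_integral sT (cf _ (cB i i).2).
split.
- by apply/eqP; rewrite eq_complex/= r0 i0 !eqxx.
- by split; [exact: cr|exact: ci].
- move=> t tT; split; rewrite /= ?ReM ?ImM/= mul0r ?subr0 ?addr0.
    exact: dr.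
  exact: di.
Qed.

(** The integrand is at most [beta / s], so that the integral is at most
    [beta * ln (z * rho0)], and [rho0 <= 1].  Hence [EH] and its inverse are at
    most of the size of [z `^ beta]. *)
Lemma bH_bound i t xi : startH xi <= t -> t <= T ->
  `|Re (bH ell rho0 BH i t xi)| <= beta * ln (z t xi).
Proof.
move=> st tT; have sT := le_trans st tT.
have [c0 [cr _] dc] := bH_props i sT.
have s0 := startH_gt0 xi.
have dln x : startH xi < x < t ->
    is_derive x (1 : R) (fun x : R => beta * ln x) (beta * x^-1).
  move=> /andP[sx _]; have x0 : 0 < x := lt_trans s0 sx.
  have D := is_deriveM (is_derive_cst beta x 1) (is_derive1_ln x0).
  by apply: (is_derive_eq D); rewrite /GRing.scale/= mulr0 addr0.
have cln : {within `[startH xi, t], continuous (fun x : R => beta * ln x)}.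
  apply: continuous_in_subspaceT => x /set_mem; rewrite /= in_itv/= => /andP[sx _].
  apply: cvgM; first exact: cvg_cst.
  by apply: continuous_ln; exact: lt_le_trans sx.
have cr' : {within `[startH xi, t], continuous (fun x => Re (bH ell rho0 BH i x xi))}.
  apply: continuous_subspaceW cr => x; rewrite /= !in_itv/= => /andP[-> /le_trans].
  by apply.
have dr x : startH xi < x < t ->
    is_derive x (1 : R) (fun x => Re (bH ell rho0 BH i x xi)) (x^-1 * Re (BH x xi i i)).
  move=> /andP[sx xt]; have [+ _] := dc x (introT andP (conj sx (lt_le_trans xt tT))).
  by rewrite ReM/= mul0r subr0.
have Bx x : startH xi < x < t -> `|x^-1 * Re (BH x xi i i)| <= beta * x^-1.
  move=> /andP[sx xt]; have x0 : 0 < x := lt_trans s0 sx.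
  rewrite normrM gtr0_norm ?invr_gt0// mulrC ler_wpM2r ?invr_ge0 ?(ltW x0)//.
  apply: le_trans (Re_le_mxnorm _ _ _) (BHle _).
  by apply: zoneH_of_start; [exact: ltW|rewrite ltW// (lt_le_trans xt)].
have up : Re (bH ell rho0 BH i t xi) <= beta * ln t - beta * ln (startH xi).
  have := @derive_ge0_le _ (fun x => beta * ln x - Re (bH ell rho0 BH i x xi))
    (fun x => beta * x^-1 - x^-1 * Re (BH x xi i i)) _ _ st.
  rewrite c0 subr0 => H; rewrite lerBrDr addrC -lerBrDr; apply: H.
  - by move=> x; apply: cvgB; [exact: cln|exact: cr'].
  - by move=> x sx; apply: is_deriveB; [exact: dln|exact: dr].
  - by move=> x /Bx; rewrite subr_ge0 => /ler_normlP[].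
have lo : - (beta * ln t - beta * ln (startH xi)) <= Re (bH ell rho0 BH i t xi).
  have := @derive_ge0_le _ (fun x => beta * ln x + Re (bH ell rho0 BH i x xi))
    (fun x => beta * x^-1 + x^-1 * Re (BH x xi i i)) _ _ st.
  rewrite c0 addr0 => H; rewrite opprB lerBlDr addrC; apply: H.
  - by move=> x; apply: cvgD; [exact: cln|exact: cr'].
  - by move=> x sx; apply: is_deriveD; [exact: dln|exact: dr].
  - by move=> x /Bx; rewrite -lerBlDr sub0r => /ler_normlP[+ _]; rewrite lerNl.
have zle : beta * ln t - beta * ln (startH xi) <= beta * ln (z t xi).
  have t0 : 0 < t := lt_le_trans s0 st.
  have r1 : 1 <= rho0^-1.
    case/andP: rho0b => r0 r1; rewrite invf_ge1//; apply: ltW.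
    by apply: lt_trans r1 _; case/andP: rb.
  rewrite -mulrBr ler_wpM2l// /startH /zeta !lnM ?posrE ?invr_gt0 ?jbr_gt0//; last first.
    by case/andP: rho0b.
  rewrite lnV ?posrE ?jbr_gt0// opprD opprK addrA.
  have := ln_ge0 r1; lra.
by rewrite ler_norml; apply/andP; split;
  [apply: le_trans lo; rewrite lerN2|apply: le_trans up _].
Qed.

Definition invEH : fld := fun t xi => diag_mx (\row_i cexp (bH ell rho0 BH i t xi)).

Lemma invEHK t xi : invEH t xi *m EH ell rho0 BH t xi = 1%:M.
Proof.
rewrite /invEH /EH mulmx_diag -(@diag_const_mx _ n 1); congr diag_mx.
by apply/rowP => i; rewrite !mxE cexpNK.
Qed.

Lemma mxnorm_diag_cexp (c : 'I_n -> R[i]) (e : R) : (forall i, `|Re (c i)| <= e) ->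
  mxnorm (diag_mx (\row_i cexp (c i))) <= n%:R * n%:R * 2 * expR e.
Proof.
move=> ce; apply: le_trans (mxnorm_le_sum _) _.
apply: le_trans (_ : \sum_(i < n) \sum_(j < n) 2 * expR e <= _).
  apply: ler_sum => i _; apply: ler_sum => j _; rewrite !mxE.
  case: eqVneq => [_|_]; last first.
    by rewrite mulr0n/= normr0 addr0 mulr_ge0 ?expR_ge0.
  rewrite mulr1n; have [cr ci] := cexp_le (c i).
  have le : expR (Re (c i)) <= expR e.
    by rewrite ler_expR; exact: le_trans (ler_norm _) (ce i).
  by rewrite mulr_natl mulr2n lerD ?(le_trans cr le)// (le_trans ci le).
rewrite !sumr_const card_ord -[leLHS]mulr_natl -[X in _ * X <= _]mulr_natl.
by rewrite !mulrA.
Qed.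

Lemma EH_bound t xi : startH xi <= t -> t <= T ->
  mxnorm (EH ell rho0 BH t xi) <= n%:R * n%:R * 2 * z t xi `^ beta /\
  mxnorm (invEH t xi) <= n%:R * n%:R * 2 * z t xi `^ beta.
Proof.
move=> st tT; have z0 : 0 < z t xi.
  apply: lt_le_trans ltr01 _; apply: zoneH_zeta; exact: zoneH_of_start.
rewrite /powR (gt_eqF z0); split.
  by apply: mxnorm_diag_cexp => i; rewrite ReN normrN; exact: bH_bound.
by apply: mxnorm_diag_cexp => i; exact: bH_bound.
Qed.

Lemma EH_start xi : startH xi <= T -> EH ell rho0 BH (startH xi) xi = 1%:M.
Proof.
move=> sT; rewrite /EH -(@diag_const_mx _ n 1); congr diag_mx.
by apply/rowP => i; rewrite !mxE; have [-> _ _] := bH_props i sT; rewrite oppr0 cexp0.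
Qed.

Lemma mder_EH t xi : startH xi < t < T ->
  mder ((EH ell rho0 BH)^~ xi) t (- (EH ell rho0 BH t xi *m (t^-1%:C%C *: diagB t xi))).
Proof.
move=> /andP[st tT]; have sT : startH xi <= T by exact: ltW (lt_trans st tT).
move=> i j; rewrite /EH /diagB -scalemxAr mulmx_diag !mxE.
have [->|ij] := eqVneq i j; last first.
  rewrite mulr0n mulr0 oppr0 (_ : (fun s => _) = fun=> 0); first exact: cder_cst.
  by apply/funext => s; rewrite !mxE (negbTE ij) mulr0n.
rewrite mulr1n (_ : (fun s => _) = fun s => cexp (- bH ell rho0 BH j s xi)); last first.
  by apply/funext => s; rewrite !mxE eqxx mulr1n.
have [_ _ /(_ t)] := bH_props j sT; rewrite st tT => /(_ isT) [br bi].
have dN : cder (fun s => - bH ell rho0 BH j s xi) t (- (t^-1%:C%C * BH t xi j j)).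
  split; under eq_fun do rewrite ?ReN ?ImN; rewrite ?ReN ?ImN.
    exact: is_deriveN.
  exact: is_deriveN.
have := cder_cexp dN; congr (cder _ _ _).
by rewrite mulNr mulrCA mulrC.
Qed.

Lemma mcont_EH xi (D : set R) : (forall t, D t -> startH xi <= t <= T) ->
  mcont D ((EH ell rho0 BH)^~ xi).
Proof.
move=> HD; have [sT|Ts] := leP (startH xi) T; last first.
  have D0 : D = set0.
    apply/seteqP; split => // t /HD/andP[st tT].
    by have := lt_le_trans Ts (le_trans st tT); rewrite ltxx.
  by rewrite D0; apply/mcont_withinP; exact: continuous_subspace0.
move=> i j; rewrite /EH.
apply: (ccont_ext (f := fun s => cexp (- bH ell rho0 BH i s xi) *+ (i == j))).
  by move=> s; rewrite !mxE.
case: eqVneq => [_|_]; last exact: ccont_cst.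
have [_ [cr ci] _] := bH_props i sT.
have subD : D `<=` `[startH xi, T] by move=> t /HD; rewrite /= in_itv.
apply: ccont_cexp; apply: (ccont_ext (f := fun s => - 1 * bH ell rho0 BH i s xi)).
  by move=> s; rewrite mulN1r.
apply: ccontM; first exact: ccont_cst.
by split; [exact: continuous_subspaceW subD cr|exact: continuous_subspaceW subD ci].
Qed.

(** The smallest of three rates of decay: of the higher diagonal terms, of [RH],
    and of the remainder of order [m] after conjugation by [EH]. *)
Let b := Num.min l1 (Num.min (- (aH + 1)) (m%:R * l1 - 2 * beta)).

Let b0 : 0 < b.
Proof. by rewrite !lt_min l10 subr_gt0 m_large andbT/=; have := aH_lt HH; lra. Qed.

Let b_le : [/\ b <= l1, aH <= - b - 1 & 2 * beta - m%:R * l1 <= - b].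
Proof.
have h1 : b <= l1 by rewrite ge_min lexx.
have h2 : b <= - (aH + 1) by rewrite !ge_min lexx !orbT.
have h3 : b <= m%:R * l1 - 2 * beta by rewrite !ge_min lexx !orbT.
by split; lra.
Qed.

Lemma sum_NHs_small : exists2 C : R, 0 <= C & forall t xi, V (t, xi) ->
  mxnorm (\sum_(1 <= k < m.+1) NHs k t xi) <= C * z t xi `^ (- l1).
Proof.
apply: (@sum_bound _ _ _ _ V NHs (fun t xi => z t xi `^ (- l1))) => k k1.
have [C C0 HC] := symbol_bound (NHs_sym HR k1).
exists C => // t xi Vt; apply: le_trans (HC t xi Vt) _; rewrite ler_wpM2l//.
apply: ler_powR; first exact: zoneH_zeta.
by rewrite mulNr lerN2 ler_peMl ?ler1n// ltW.
Qed.

Lemma sum_DHs_bound : exists2 C : R, 0 <= C & forall t xi, V (t, xi) ->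
  mxnorm (\sum_(2 <= k < m.+1) DHs k t xi) <= C * z t xi `^ (- b - 1).
Proof.
apply: (@sum_bound _ _ _ _ V DHs (fun t xi => z t xi `^ (- b - 1))) => k k2.
have k1 : (0 < k)%N by exact: ltnW.
have [C C0 HC] := symbol_bound (DHs_sym HR k1).
exists C => // t xi Vt; apply: le_trans (HC t xi Vt) _; rewrite ler_wpM2l//.
apply: ler_powR; first exact: zoneH_zeta.
rewrite lerD2r mulNr lerN2; have [bl _ _] := b_le; apply: le_trans bl _.
rewrite ler_peMl ?(ltW l10)// lerBrDr.
by have : (2%:R : R) <= k%:R by rewrite ler_nat.
Qed.

(** The coefficient of the system for [gaugeH *m U] is [skewH + restH]; the
    diagonal of [BH], which is part of the first diagonal term, is removed by
    [EH]. *)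
Definition skewH : fld := fun t xi => (0 +i* frakH ell lam t xi)%C *: DH t xi.

Definition restH : fld := fun t xi =>
  (L xi)%:C%C *: (diag_mx (\row_i RH t xi i i) + \sum_(2 <= k < m.+1) DHs k t xi)
  + EH ell rho0 BH t xi *m (((L xi)%:C%C *: RHs m t xi) *m invmx (renQ NHs m t xi))
    *m invEH t xi.

Definition gaugeH : fld :=
  fun t xi => EH ell rho0 BH t xi *m renQ NHs m t xi *m MH t xi.

(** The leading part is skew-adjoint and so does not change lengths. *)
Lemma mxip_skewH t xi (v : 'cV[R[i]]_n) : V (t, xi) -> mxip v (skewH t xi *m v) = 0.
Proof.
move=> Vt; have /diag_mxP[D DE] := DH_diag HH Vt.
rewrite /mxip big1// => i _; rewrite big1// => j _.
have := DH_real HH i i Vt; rewrite /skewH DE -scalemxAl mxE mul_diag_mx !mxE eqxx mulr1n.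
by case: (D 0 i) (v i j) => x y [v1 v2] /= ->; ring.
Qed.

Lemma restH_bound : exists2 C : R, 0 <= C & forall t xi, startH xi <= t -> t <= T ->
  mxnorm (invmx (renQ NHs m t xi)) <= 2 * mxnorm (1%:M : 'M[R[i]]_n) ->
  mxnorm (restH t xi) <= C * (L xi * z t xi `^ (- b - 1)).
Proof.
have [CD CD0 HD] := sum_DHs_bound.
have [CR CR0 HCR] := symbol_bound (RH_sym HH).
have [CM CM0 HCM] := symbol_bound (RHs_sym HR m0).
have [w w0 wE] : exists2 w : R, 0 <= w & 2 * mxnorm (1%:M : 'M[R[i]]_n) = w.
  by exists (2 * mxnorm (1%:M : 'M[R[i]]_n)); rewrite ?mulr_ge0 ?mxnorm_ge0.
have [g g0 gE] : exists2 g : R, 0 <= g & n%:R * n%:R * 2 = g.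
  by exists (n%:R * n%:R * 2); rewrite ?mulr_ge0.
rewrite wE; exists (CR + CD + g * (CM * w) * g).
  by rewrite addr_ge0 ?addr_ge0// !mulr_ge0.
move=> t xi st tT invQ; have Vt := zoneH_of_start st tT.
have z1 := zoneH_zeta Vt; have z0 : 0 < z t xi by apply: lt_le_trans z1.
have L0 : 0 <= L xi by rewrite ltW// jbr_gt0.
have [E1 E2] := EH_bound st tT; rewrite gE in E1 E2.
have [bl1 bl2 bl3] := b_le.
rewrite mulrDl; apply: le_trans (mxnormD _ _) _; apply: lerD.
  rewrite mxnormZr ger0_norm// mulrCA ler_wpM2l// mulrDl.
  apply: le_trans (mxnormD _ _) _; apply: lerD; last exact: HD.
  apply: le_trans (mxnorm_diag_le _) _; apply: le_trans (HCR t xi Vt) _.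
  by rewrite ler_wpM2l//; apply: ler_powR.
apply: le_trans (mxnormM _ _) _.
apply: le_trans (_ : (g * z t xi `^ beta * (L xi * (CM * z t xi `^ (- m%:R * l1 - 1)) * w))
    * (g * z t xi `^ beta) <= _).
  apply: ler_pM; rewrite ?mxnorm_ge0//.
  apply: le_trans (mxnormM _ _) _; apply: ler_pM; rewrite ?mxnorm_ge0//.
  apply: le_trans (mxnormM _ _) _; apply: ler_pM; rewrite ?mxnorm_ge0//.
  by rewrite mxnormZr ger0_norm// ler_wpM2l// HCM.
have zz : z t xi `^ beta * z t xi `^ (- m%:R * l1 - 1) * z t xi `^ beta
    <= z t xi `^ (- b - 1).
  rewrite -!powRD ?(gt_eqF z0) ?implybT//; apply: ler_powR => //.
  by rewrite mulNr; lra.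
rewrite (_ : _ * _ = g * (CM * w) * g * L xi *
   (z t xi `^ beta * z t xi `^ (- m%:R * l1 - 1) * z t xi `^ beta)); last by ring.
rewrite (_ : g * (CM * w) * g * (L xi * _) = g * (CM * w) * g * L xi * z t xi `^ (- b - 1));
  last by ring.
by rewrite ler_wpM2l ?mulr_ge0.
Qed.

Lemma gaugeH_eq t xi : startH xi < t < T -> renQ NHs m t xi \in unitmx ->
  gauge_eq (A^~ xi) (gaugeH^~ xi) (fun t => skewH t xi + restH t xi) t.
Proof.
move=> tT Qu; have /andP[st tT'] := tT.
have t0 : 0 < t := lt_trans (startH_gt0 xi) st.
have zr : rhobar^-1 < z t xi.
  move: st; rewrite startH_lt; apply: le_lt_trans.
  by rewrite lef_pV2 ?posrE//; case/andP: rho0b => // ? /ltW.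
have near_V : \forall h \near (0 : R), V (t + h, xi) by apply: zoneH_near; rewrite ?t0.
have Vt : V (t, xi) by exact: zoneH_of_start (ltW st) (ltW tT').
have Mu := MH_unit HH Vt.
have [dM /(is_dt_mder near_V) dM_ eqM] := H_eq HH Vt.
have [dN dN_ eqN] := RHs_eq HR m0 Vt.
have dQ := mder_renQ near_V dN_.
have dE := mder_EH tT.
have Ln : L xi != 0 by rewrite gt_eqF ?jbr_gt0.
have L0 : (L xi)%:C%C != 0 :> R[i] by rewrite (fmorph_eq0 (real_complex R)).
exists ((- (EH ell rho0 BH t xi *m ((t^-1)%:C%C *: diagB t xi)) *m renQ NHs m t xi
    + EH ell rho0 BH t xi *m \sum_(1 <= k < m.+1) dN k) *m MH t xi
    + (EH ell rho0 BH t xi *m renQ NHs m t xi) *m dM).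
  exact: (mderM (mderM dE dQ) dM_).
rewrite /gaugeH.
pose X := skewH t xi + (t^-1)%:C%C *: BH t xi + (L xi)%:C%C *: RH t xi.
pose Y := skewH t xi + (L xi)%:C%C *: \sum_(1 <= k < m.+1) DHs k t xi.
pose W := (t^-1)%:C%C *: diagB t xi.
have Lz : (L xi)%:C%C * ((z t xi)^-1)%:C%C = (t^-1)%:C%C :> R[i].
  by rewrite -rmorphM /zeta invfM mulrA divff ?mul1r.
have LH : (L xi)%:C%C *: ((0 +i* frakZ ell lam t xi)%C *: DH t xi) = skewH t xi.
  rewrite scalerA; congr (_ *: _); apply/eqP.
  by rewrite eq_complex/= !mul0r mulr0 subr0 addr0 /frakZ mulrA divff ?mul1r ?eqxx.
have YW : Y - W = skewH t xi + (L xi)%:C%C *: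
    (diag_mx (\row_i RH t xi i i) + \sum_(2 <= k < m.+1) DHs k t xi).
  rewrite /Y /W big_nat_recl// -addrA; congr (_ + _).
  rewrite (DHs_1 HR Vt) [RHS]scalerDr [X in X - _]scalerDr addrAC; congr (_ + _).
    apply/matrixP => i j; rewrite !mxE -Lz -mulrA -mulrBr; congr (_ * _).
    case: eqVneq => _; last by rewrite !mulr0n mulr0 subrr.
    by rewrite !mulr1n addrC addKr.
  by congr (_ *: _); rewrite [RHS]big_add1.
have YWdiag : EH ell rho0 BH t xi *m (Y - W) *m invEH t xi = Y - W.
  have D : is_diag_mx (Y - W).
    rewrite YW; apply/is_diag_mxP => i j ij; rewrite !mxE summxE.
    rewrite (_ : (i == j) = false) ?mulr0n ?add0r; last by apply/negbTE.
    have /is_diag_mxP := DH_diag HH Vt => ->//; rewrite mulr0 add0r.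
    rewrite big_nat_cond big1 ?mulr0// => k; rewrite andbT => /andP[k2 _].
    by have /is_diag_mxP := DHs_diag HR (ltnW k2) Vt; apply.
  have /diag_mxP[e ->] := D.
  rewrite /EH diag_mxC -mulmxA -/(EH ell rho0 BH t xi).
  by rewrite (mulmx1C (invEHK t xi)) mulmx1.
have -> : skewH t xi + restH t xi = EH ell rho0 BH t xi *m (Y - W) *m invEH t xi +
    EH ell rho0 BH t xi *m (((L xi)%:C%C *: RHs m t xi) *m invmx (renQ NHs m t xi))
    *m invEH t xi.
  by rewrite YWdiag YW /restH addrA.
apply: (@gauge_algebra _ _ _ _ _ _ _ X) => //.
- exact: invEHK.
- by rewrite /X -eqM mulmxDl !mulmxKV.
- have LX : (L xi)%:C%C *: ((0 +i* frakZ ell lam t xi)%C *: DH t xi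
      + ((z t xi)^-1)%:C%C *: BH t xi + RH t xi) = X.
    by rewrite !scalerDr LH [_ *: (_ *: BH t xi)]scalerA Lz.
  have LY : (L xi)%:C%C *: ((0 +i* frakZ ell lam t xi)%C *: DH t xi
      + \sum_(1 <= k < m.+1) DHs k t xi) = Y.
    by rewrite scalerDr LH.
  rewrite eqN scalerDr scalerDr scalerN -scaler_sumr.
  rewrite [X in _ *: (X *: _)](_ : _ = ((L xi)%:C%C)^-1); last by rewrite fmorphV.
  rewrite scalerA divff// scale1r.
  rewrite [(L xi)%:C%C *: (renQ NHs m t xi *m _)]scalemxAr scalemxAl LX LY.
  by rewrite [_ - _ - _]addrAC addrK subrK.
Qed.

Lemma EH_unit t xi : EH ell rho0 BH t xi \in unitmx.
Proof. by have [] := mulmx1_unit (invEHK t xi). Qed.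

(** [EH] is the identity at [startH xi], and the other two factors are bounded. *)
Lemma gaugeH_comparable :
  (forall t xi, 0 < t <= T -> rho0^-1 <= z t xi ->
  near_identity (renQ NHs m t xi)) ->
  exists2 c : R, 1 <= c & forall xi, startH xi <= T ->
    forall v : 'cV[R[i]]_n, mxnorm (gaugeH (startH xi) xi *m v) <= c * mxnorm v /\
      mxnorm v <= c * mxnorm (gaugeH (startH xi) xi *m v).
Proof.
move=> HQ.
have [CM CM0 HM] := symbol_bound (MH_sym HH).
have [CN CN0 HN] := symbol_bound (MHV_sym HH).
have [w w0 wE] : exists2 w : R, 0 <= w & mxnorm (1%:M : 'M[R[i]]_n) = w.
  by exists (mxnorm (1%:M : 'M[R[i]]_n)); rewrite ?mxnorm_ge0.
rewrite /near_identity wE in HQ.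
exists (1 + (w + 1) * CM + CN * (2 * w)).
  by rewrite -addrA lerDl addr_ge0// !mulr_ge0// addr_ge0.
move=> xi sT v; set t := startH xi.
have Vt : V (t, xi) by exact: zoneH_of_start.
have [Qu Qinv Qn] : [/\ renQ NHs m t xi \in unitmx,
     mxnorm (invmx (renQ NHs m t xi)) <= 2 * w & mxnorm (renQ NHs m t xi) <= w + 1].
  by apply: HQ; [rewrite startH_gt0|rewrite -startH_le].
have Mn := HM t xi Vt; have Nn := HN t xi Vt.
rewrite powRr0 !mulr1 in Mn Nn.
have GE : gaugeH t xi = renQ NHs m t xi *m MH t xi.
  by rewrite /gaugeH EH_start// mul1mx.
have vE : v = invmx (MH t xi) *m invmx (renQ NHs m t xi) *m (gaugeH t xi *m v).
  by rewrite GE -!mulmxA mulKmx// mulKmx// (MH_unit HH Vt).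
split.
  apply: le_trans (mxnormM _ _) _; rewrite ler_wpM2r ?mxnorm_ge0//.
  apply: le_trans (_ : (w + 1) * CM <= _).
    by rewrite GE; apply: le_trans (mxnormM _ _) _; apply: ler_pM; rewrite ?mxnorm_ge0.
  by rewrite addrAC lerDr addr_ge0// !mulr_ge0.
rewrite {1}vE; apply: le_trans (mxnormM _ _) _; rewrite ler_wpM2r ?mxnorm_ge0//.
apply: le_trans (_ : CN * (2 * w) <= _); last first.
  by rewrite lerDr addr_ge0// !mulr_ge0// addr_ge0.
by apply: le_trans (mxnormM _ _) _; apply: ler_pM; rewrite ?mxnorm_ge0.
Qed.

Lemma mcont_gaugeH xi (D : set R) :
  (forall t, D t -> startH xi <= t <= T) -> mcont D (gaugeH^~ xi).
Proof.
move=> HD.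
have DV t : D t -> V (t, xi) by move=> /HD/andP[]; exact: zoneH_of_start.
apply: mcontM; last exact: continuous_on_slice (MH_sym HH).1 DV.
apply: mcontM; first exact: mcont_EH.
apply: mcontD; first exact: mcont_cst.
have E : (fun s => \sum_(1 <= k < m.+1) NHs k s xi) =
   (fun s => \sum_(1 <= k < m.+1 | (1 <= k < m.+1)%N) NHs k s xi).
  by apply/funext => s; rewrite [LHS]big_nat.
rewrite E; apply: mcont_sum => k /andP[k1 _].
exact: continuous_on_slice (NHs_sym HR k1).1 DV.
Qed.

Lemma interval_estimate_H :
  (forall t xi, 0 < t <= T -> rho0^-1 <= z t xi ->
  near_identity (renQ NHs m t xi)) ->
  exists2 C : R, 1 <= C & forall xi (G : R -> 'M[R[i]]_n),
    (forall t, 0 < t <= T -> rho0^-1 < z t xi -> G t = gaugeH t xi) ->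
    (forall t, 0 < t <= T -> z t xi = rho0^-1 -> G t = 1%:M) ->
    interval_estimate T (A^~ xi) G (startH xi) T C.
Proof.
move=> HQ; have [CK CK0 HK] := restH_bound; have [c c1 Hc] := gaugeH_comparable HQ.
have Cb0 : 0 <= CK / b by rewrite divr_ge0// ltW.
exists (c ^+ 2 * expR (CK / b)).
  by rewrite mulr_ege1 ?expr_ge1// ?(le_trans ler01 c1)// -expR0 ler_expR.
move=> xi G GH G1.
have L0 : 0 < L xi by exact: jbr_gt0.
pose kap t := CK * (L xi * z t xi `^ (- b - 1)).
have dk (t : R) : 0 < t -> is_derive t (1 : R) (power_primitive (L xi) CK (- b)) (kap t).
  by move=> t0; apply: is_derive_power_primitive; rewrite ?oppr_eq0 ?lt0r_neq0.
have kap0 t : 0 <= kap t by apply: mulr_ge0 => //; apply: mulr_ge0 (ltW L0) (powR_ge0 _ _).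
have tE t : startH xi <= t -> t <= T -> 0 < t <= T /\ rho0^-1 <= z t xi.
  by move=> st ->; rewrite (lt_le_trans (startH_gt0 xi))// -startH_le.
apply: (@interval_estimate_of_gauge _ _ T (A^~ xi) G (gaugeH^~ xi)
  (fun t => skewH t xi + restH t xi) (power_primitive (L xi) CK (- b)) kap) => //.
- by apply: (@mcont_gaugeH xi) => t [_ st _ tT]; rewrite st.
- apply: continuous_in_subspaceT => t /set_mem[t0 _ _ _].
  exact: is_derive_continuous (dk t t0).
- move=> t t0 st _ tT; have [tT' zt] := tE t (ltW st) (ltW tT).
  have [Qu Qi _] := HQ t xi tT' zt.
  split.
  + by apply: gaugeH_eq => //; rewrite st.
  + exact: dk.
  + exact: kap0.
  + by apply: GH => //; rewrite -startH_lt.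
  + move=> v; rewrite mulmxDl mxipDr mxip_skewH ?add0r; last first.
      exact: zoneH_of_start (ltW st) (ltW tT).
    apply: le_trans (normr_mxip_le _ _) _.
    rewrite -mxnorm_sqr expr2 mulrC mulrA; apply: ler_wpM2r; first exact: mxnorm_ge0.
    apply: le_trans (mxnormM _ _) _; apply: ler_wpM2r; first exact: mxnorm_ge0.
    by apply: HK Qi; exact: ltW.
- move=> t [t0 st _ tT] v; have [tT' zt] := tE t st tT.
  move: st; rewrite le_eqVlt => /predU1P[sE|st].
    rewrite -sE in tT tT' *; rewrite G1 ?mul1mx//; first exact: Hc.
    by rewrite /startH /zeta mulrA divff ?mul1r// gt_eqF.
  by rewrite GH// -?startH_lt//; split; rewrite ler_peMl ?mxnorm_ge0.
- move=> s t [s0 ss _ sT] [t0 _ _ _]; rewrite /power_primitive invrN mulrN mulNr mulNr.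
  rewrite opprK addrC; apply: le_trans (_ : CK / b * 1 <= _); last by rewrite mulr1.
  apply: le_trans (_ : CK / b * (L xi * s) `^ (- b) <= _).
    by rewrite gerBl; apply: mulr_ge0 => //; exact: powR_ge0.
  apply: ler_wpM2l => //; rewrite -(powRr0 (L xi * s)); apply: ler_powR.
    exact: zoneH_zeta (zoneH_of_start ss sT).
  by rewrite oppr_le0 ltW.
Qed.

Lemma gaugeH_unit t xi : startH xi <= t -> t <= T -> renQ NHs m t xi \in unitmx ->
  gaugeH t xi \in unitmx.
Proof.
move=> st tT Qu; rewrite !unitmx_mul EH_unit Qu/=.
by apply: (MH_unit HH); exact: zoneH_of_start.
Qed.

End FixedRho.

Lemma zoneH_renQ : exists2 rho1, 0 < rho1 <= rhobar & forall t xi,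
  0 < t <= T -> rho1^-1 <= z t xi ->
  near_identity (renQ NHs m t xi).
Proof.
have [C C0 HC] := sum_NHs_small.
have [rho rho0 Hrho] := small_power C0 l10.
exists (Num.min rho rhobar).
  by rewrite lt_min rho0 rb0 ge_min lexx orbT.
have m0' : 0 < Num.min rho rhobar by rewrite lt_min rho0 rb0.
move=> t xi tT zr.
have z0 : 0 < z t xi by apply: lt_le_trans zr; rewrite invr_gt0.
have Vt : V (t, xi).
  by split => //=; apply: le_trans zr; rewrite lef_pV2 ?posrE// ge_min lexx orbT.
have small : mxnorm (\sum_(1 <= k < m.+1) NHs k t xi) <= 2^-1.
  apply: le_trans (HC t xi Vt) _.
  have -> : z t xi `^ (- l1) = ((z t xi)^-1) `^ l1.
    by rewrite -mulN1r powRrM powR_inv1// ltW.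
  apply: Hrho; rewrite invr_ge0 (ltW z0)/= -[leRHS]invrK lef_pV2 ?posrE ?invr_gt0//.
  by apply: le_trans zr; rewrite lef_pV2 ?posrE// ge_min lexx.
have [Qu Qinv] := neumann small; split => //.
apply: le_trans (mxnormD _ _) _; rewrite lerD2l; apply: le_trans small _.
by rewrite invf_le1// ler1n.
Qed.

(** The integral of [z `^ (- b - 1)] in [z] converges at infinity, so that [C] is
    independent of the length of the zone, which is unbounded in [xi]. *)
Lemma zoneH_estimates : exists2 rho1, 0 < rho1 <= rhobar & forall rho0, 0 < rho0 < rho1 ->
  exists2 C : R, 1 <= C & forall xi (G : R -> 'M[R[i]]_n),
    (forall t, 0 < t <= T -> rho0^-1 < z t xi -> G t = gaugeH rho0 t xi) ->
    (forall t, 0 < t <= T -> z t xi = rho0^-1 -> G t = 1%:M) ->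
    (forall t, 0 < t <= T -> rho0^-1 < z t xi -> G t \in unitmx) /\
    interval_estimate T (A^~ xi) G (startH rho0 xi) T C.
Proof.
have [rho1 /andP[rho10 rho1b] HQ] := zoneH_renQ.
exists rho1; first by rewrite rho10.
move=> rho0 /andP[rho00 rho01].
have rho0b : 0 < rho0 < rhobar by rewrite rho00 (lt_le_trans rho01).
have HQ0 t xi : 0 < t <= T -> rho0^-1 <= z t xi ->
  near_identity (renQ NHs m t xi).
  move=> tT zr; apply: HQ => //; apply: le_trans zr.
  by rewrite lef_pV2 ?posrE// ltW.
have [C C1 HC] := interval_estimate_H rho0b HQ0.
exists C => // xi G GH G1; split; last exact: HC.
move=> t tT zr; rewrite GH//; have [Qu _ _] := HQ0 t xi tT (ltW zr).
apply: (gaugeH_unit rho0b) => //; last by case/andP: tT.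
by rewrite startH_le ltW.
Qed.

End ZoneH.

(** * The intermediate zone and the passage from estimates to solutions *)

Section Assembly.
Context {R : realType} {d n : nat}.
Local Notation fld := (R -> 'rV[R]_d -> 'M[R[i]]_n).

Lemma ell_min_gt (ell : 'I_d -> R) : (0 < d)%N -> (forall i, -1 < ell i) ->
  0 < ell_min ell + 1.
Proof.
move=> d0 ell1; have [i _ imin] := @arg_minP _ _ _ (Ordinal d0) predT ell isT.
have : ell i <= ell_min ell.
  apply: lb_le_inf; first by exists (ell i), i.
  by move=> _ [j _ <-]; exact: imin.
by have := ell1 i; lra.
Qed.

Lemma interval_estimate_weaken (T : R) (a G : R -> 'M[R[i]]_n) lo hi C C' : C <= C' ->
  interval_estimate T a G lo hi C -> interval_estimate T a G lo hi C'.
Proof.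
move=> CC E f u cf su s t J s0 los st thi tT fJ.
have J0 : 0 <= J by rewrite -lee_fin; apply: le_trans fJ; exact: gint_ge0.
have [E1 E2] := E f u cf su s t J s0 los st thi tT fJ.
by split; [apply: le_trans E1 _|apply: le_trans E2 _];
  apply: ler_wpM2r => //; exact: addr_ge0 (mxnorm_ge0 _) J0.
Qed.

Section ZoneI.
Variables (ell : 'I_d -> R) (T rhobar : R) (A : fld).
Hypothesis T0 : 0 < T.
Hypothesis rb : 0 < rhobar < 1.
Hypothesis HI : forall rho, 0 < rho <= rhobar -> hyp_I ell T rho A.

Local Notation L := (jbr ell).
Local Notation z := (zeta ell).

(** For fixed [xi] every time in [`]0, T]] is in [zoneI] for small [rho]. *)
Lemma mcont_coefficient xi : mcont `]0, T] (A^~ xi).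
Proof.
have L0 : 0 < L xi by exact: jbr_gt0.
have cA a : 0 < a -> mcont `[a, T] (A^~ xi).
  move=> a0; pose rho := Num.min rhobar (Num.min (L xi * a) (L xi * T)^-1).
  have rho0 : 0 < rho.
    by rewrite !lt_min mulr_gt0//= invr_gt0 mulr_gt0// andbT; case/andP: rb.
  have rho_b : 0 < rho <= rhobar by rewrite rho0 ge_min lexx.
  have cLA : mcont `[a, T] (fun t => ((L xi)^-1)%:C%C *: A t xi).
    apply: (continuous_on_slice (HI rho_b).1) => t; rewrite /= in_itv/= => /andP[at_ tT].
    split; first by apply/andP; split => //=; exact: lt_le_trans at_.
    apply/andP; split => /=.
      apply: le_trans (_ : L xi * a <= _); last by rewrite /zeta ler_pM2l.
      by rewrite !ge_min lexx orbT.
    apply: le_trans (_ : L xi * T <= _); first by rewrite /zeta ler_pM2l.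
    rewrite -[leLHS]invrK lef_pV2 ?posrE ?invr_gt0 ?mulr_gt0//.
    by rewrite !ge_min lexx !orbT.
  apply: (@mcont_ext _ _ _ _ (fun t => (L xi)%:C%C *: (((L xi)^-1)%:C%C *: A t xi))).
    move=> t _; rewrite scalerA -rmorphM divff ?scale1r// gt_eqF//.
  by apply: mcontZ => //; exact: ccont_cst.
apply/mcont_withinP/subspace_continuousP => t; rewrite /= in_itv/= => /andP[t0 tT].
have t2 : 0 < t / 2 by rewrite divr_gt0.
have t2t : t / 2 < t by rewrite ltr_pdivrMr// ltr_pMr// ltr1n.
have /mcont_withinP/subspace_continuousP/(_ t) := cA _ t2.
rewrite /= in_itv/= (ltW t2t) tT => /(_ isT); apply: cvg_trans.
apply: cvg_app => B /= HB; near=> s.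
have s2 : t / 2 < s.
  near: s; apply: (@cvg_within _ (nbhs t)); exact: lt_nbhsr.
have : `]0, T]%classic s by near: s; exact: withinT.
rewrite /= in_itv/= => /andP[s0 sT].
have : `[t / 2, T]%classic s -> B s by near: s; exact: (@cvg_within _ (nbhs t)).
by apply; rewrite /= in_itv/= (ltW s2).
Unshelve. all: by end_near. Qed.

(** The integral of the coefficient is at most [C * z], and [z <= rho0^-1]. *)
Lemma zoneI_estimates (rho0 : R) : 0 < rho0 <= rhobar ->
  exists2 C : R, 1 <= C & forall xi (G : R -> 'M[R[i]]_n),
    (forall t, 0 < t <= T -> rho0 <= z t xi <= rho0^-1 -> G t = 1%:M) ->
    interval_estimate T (A^~ xi) G (rho0 / L xi) (startH ell rho0 xi) C.
Proof.
move=> rho_b; have rho00 : 0 < rho0 by case/andP: rho_b.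
have [C C0 HC] := symbol_bound (HI rho_b).
exists (1 ^+ 2 * expR (C * rho0^-1)).
  by rewrite expr1n mul1r -expR0 ler_expR mulr_ge0 ?invr_ge0 ?(ltW rho00).
move=> xi G G1; have L0 : 0 < L xi by exact: jbr_gt0.
have zE t : 0 < t -> rho0 / L xi <= t -> t <= startH ell rho0 xi ->
    rho0 <= z t xi <= rho0^-1.
  move=> t0; rewrite ler_pdivrMr// mulrC => lo.
  by rewrite /startH [_^-1 * _]mulrC ler_pdivlMr// mulrC => hi; apply/andP.
have KC t : 0 < t -> rho0 / L xi <= t -> t <= startH ell rho0 xi -> t <= T ->
    mxnorm (A t xi) <= C * L xi.
  move=> t0 lo hi tT.
  have zI : zoneI ell T rho0 (t, xi).
    by split; [apply/andP; split|exact: zE].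
  have := HC t xi zI; rewrite powRr0 mulr1 mxnormZr ger0_norm ?invr_ge0 ?(ltW L0)//.
  by rewrite ler_pdivrMl// mulrC.
have dk (t : R) : is_derive t (1 : R) (fun t : R => C * L xi * t) (C * L xi).
  by apply: is_derive_eq; rewrite /GRing.scale/= mulr1.
apply: (@interval_estimate_of_gauge _ _ T (A^~ xi) G (fun=> 1%:M) (A^~ xi)
  (fun t => C * L xi * t) (fun=> C * L xi)) => //.
- exact: mcont_cst.
- by apply: continuous_in_subspaceT => t _; exact: is_derive_continuous (dk t).
- move=> t t0 lo hi tT; split.
  + exists 0; first exact: mder_cst.
    by rewrite add0r mul1mx mulmx1.
  + exact: dk.
  + by rewrite mulr_ge0// ltW.
  + by rewrite G1 ?t0 ?(ltW tT)// zE// ltW.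
  + move=> v; apply: le_trans (normr_mxip_le _ _) _.
    rewrite -mxnorm_sqr expr2 mulrC mulrA; apply: ler_wpM2r; first exact: mxnorm_ge0.
    apply: le_trans (mxnormM _ _) _; apply: ler_wpM2r; first exact: mxnorm_ge0.
    by apply: KC => //; exact: ltW.
- move=> t [t0 lo hi tT] v; rewrite G1 ?t0 ?tT ?zE//.
  by rewrite mul1r.
- move=> s t [s0 _ _ _] [t0 lo hi _].
  apply: le_trans (_ : C * L xi * t <= _).
    by rewrite gerBl !mulr_ge0// ltW.
  rewrite -mulrA ler_wpM2l//.
  by have /andP[_] := zE t t0 lo hi.
Qed.

End ZoneI.

Section FromEstimates.
Variables (T C : R) (A G : fld).
Hypothesis T0 : 0 < T.
Hypothesis cA : forall xi, mcont `]0, T] (A^~ xi).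
Hypothesis Gunit : forall xi t, 0 < t <= T -> G t xi \in unitmx.
Hypothesis est : forall xi, two_sided_estimate T (A^~ xi) (G^~ xi) C.
Hypothesis lims : forall xi, has_limits T (A^~ xi) (G^~ xi).

Implicit Types (F U : R -> 'rV[R]_d -> 'cV[R[i]]_n).

Lemma is_solution_sol F U xi : is_solution T A F U ->
  sol T (A^~ xi) (F^~ xi) (U^~ xi).
Proof. by move=> [dU /(_ xi)[_ H]] t /H[HU <-]. Qed.

Lemma sol_is_solution F U : continuous_on (strip T) F ->
  (forall xi, sol T (A^~ xi) (F^~ xi) (U^~ xi)) -> is_solution T A F U.
Proof.
move=> cF sU; exists (fun t xi => A t xi *m U t xi + F t xi) => xi; split.
  apply/mcont_withinP; apply: mcontD.
    by apply: mcontM; [exact: cA|exact: sder_mcont (sU xi)].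
  by apply: continuous_on_slice cF _ => t; rewrite /= in_itv.
by move=> t tT; split => //; exact: (sU xi).
Qed.

Lemma strip_slice F xi : continuous_on (strip T) F -> mcont `]0, T] (F^~ xi).
Proof. by move=> cF; apply: continuous_on_slice cF _ => t; rewrite /= in_itv. Qed.

Lemma gint_fin F xi t : t <= T -> (intnorm (applyA G F) T xi < +oo)%E ->
  gint (G^~ xi) (F^~ xi) t = (fine (gint (G^~ xi) (F^~ xi) t))%:E.
Proof.
move=> tT FT; rewrite fineK// ge0_fin_numE ?gint_ge0//.
by apply: le_lt_trans FT; exact: gint_le.
Qed.

Lemma asymptotics_of_estimates : asymptotics_holds T A G.
Proof.
exists C => u F cF; split.
  have /choice[U HU] : forall xi, exists v : R -> 'cV[R[i]]_n,
      v T = u xi /\ sol T (A^~ xi) (F^~ xi) v.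
    by move=> xi; apply: sol_exists => //; exact: strip_slice.
  exists (fun t xi => U xi t); split.
  - by apply: sol_is_solution => // xi; exact: (HU xi).2.
  - by move=> xi; exact: (HU xi).1.
  - move=> U' sU' U'T t xi tT.
    have E : (U'^~ xi) T = U xi T by rewrite /= U'T (HU xi).1.
    have H := sol_unique (@Gunit xi) (@est xi) (is_solution_sol (xi := xi) sU') (HU xi).2 E tT.
    exact: H.
move=> U sU UT FT.
have /choice[uA HuA] : forall xi, exists v : 'cV[R[i]]_n,
    G t xi *m U t xi @[t --> 0^'+] --> v.
  by move=> xi; apply: (@lims xi _ _ (strip_slice xi cF) (is_solution_sol (xi := xi) sU)); exact: FT.
exists uA; split; first exact: HuA.
move=> xi t0 /[dup] tT /andP[_ t0T].
have E := gint_fin t0T (FT xi).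
have leE : (gint (G^~ xi) (F^~ xi) t0 <= (fine (gint (G^~ xi) (F^~ xi) t0))%:E)%E.
  by rewrite -E.
have := limit_le (@est xi) (strip_slice xi cF) (is_solution_sol (xi := xi) sU) (HuA xi) tT
  leE.
rewrite -lee_fin EFinM EFinD -E; exact: id.
Qed.

Lemma scattering_of_estimates : scattering_holds T A G.
Proof.
exists C => uA F cF FT; split.
  have /choice[U HU] : forall xi, exists v : R -> 'cV[R[i]]_n,
      sol T (A^~ xi) (F^~ xi) v /\ (G t xi *m v t @[t --> 0^'+] --> uA xi).
    move=> xi; apply: (scattering_solution_exists T0 (cA xi) (@Gunit xi) (@est xi) (@lims xi)).
      exact: strip_slice.
    exact: FT.
  exists (fun t xi => U xi t); split.
  - by apply: sol_is_solution => // xi; exact: (HU xi).1.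
  - by move=> xi; exact: (HU xi).2.
  - move=> U' sU' U'A t xi tT.
    exact: (scattering_solution_unique (@Gunit xi) (@est xi) (is_solution_sol (xi := xi) sU')
      (HU xi).1 (U'A xi) (HU xi).2 tT).
move=> U sU UA xi t0 /[dup] tT /andP[_ t0T].
have E := gint_fin t0T (FT xi).
have leE : (gint (G^~ xi) (F^~ xi) t0 <= (fine (gint (G^~ xi) (F^~ xi) t0))%:E)%E.
  by rewrite -E.
have := le_limit (@est xi) (strip_slice xi cF) (is_solution_sol (xi := xi) sU) (UA xi) tT
  leE.
rewrite -lee_fin EFinM EFinD -E; exact: id.
Qed.

End FromEstimates.

End Assembly.

(** * Orders of renormalization *)

Section Orders.
Context {R : realType}.
Implicit Types (S : set R) (c : R).

(** For [S] the set of the norms of [B_P], each step of the renormalization gains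
    [z `^ c] with [c = a_P + 1], while conjugation by [E_P] loses at most
    [z `^ (- 2 * sup S)]; similarly for [B_H].  As [sup set0 = 0], the empty zone
    needs no case of its own. *)
Definition order_above c S : nat := (Num.truncn (2 * sup S / c)).+1.

Lemma order_aboveP c S m : 0 < c -> (order_above c S <= m)%N ->
  2 * sup S < m%:R * c.
Proof.
move=> c0 Sm; rewrite -ltr_pdivrMr//; apply: lt_le_trans (truncnS_gt _) _.
by rewrite ler_nat.
Qed.

Lemma sup_nonneg S : (forall x, S x -> 0 <= x) -> has_ubound S -> 0 <= sup S.
Proof.
move=> S0 bS; have [->|/set0P[x Sx]] := eqVneq S set0; first by rewrite sup0.
by apply: le_trans (S0 _ Sx) _; exact: ub_le_sup.
Qed.

End Orders.

(* rhobar is a value of rho_0 for which the hypotheses on Z_P and Z_H hold, and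
   hence hold for all smaller ones by restriction. *)
Theorem theorem2p26 (R : realType) (d n : nat) (hd : (0 < d)%N) (hn : (0 < n)%N) :
  exists (mP0 : R -> ('rV[R]_d -> 'M[R[i]]_n) -> nat)
         (mH0 : R -> set (R * 'rV[R]_d) -> (R -> 'rV[R]_d -> 'M[R[i]]_n) -> nat),
  forall (T : R) (ell : 'I_d -> R) (alpha c0 rhobar : R)
    (lam : R -> 'M[R]_d) (lam0 : 'M[R]_d) (lams : R -> 'M[R]_d)
    (A MP : R -> 'rV[R]_d -> 'M[R[i]]_n) (BP : 'rV[R]_d -> 'M[R[i]]_n)
    (RP : R -> 'rV[R]_d -> 'M[R[i]]_n) (aP : R)
    (MH DH BH BHinf RH : R -> 'rV[R]_d -> 'M[R[i]]_n) (aH : R)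
    (DPs NPs RPs DHs NHs RHs : nat -> R -> 'rV[R]_d -> 'M[R[i]]_n),
  0 < T -> (forall i, -1 < ell i) -> 0 < alpha -> 0 < c0 -> 0 < rhobar < 1 ->
  coefficient_hyp ell T alpha c0 lam lam0 lams ->
  (forall rho, 0 < rho <= rhobar -> hyp_I ell T rho A) ->
  hyp_P ell T rhobar A MP BP RP aP ->
  hyp_H ell T rhobar lam A MH DH BH BHinf RH aH ->
  semi_strictly_hyperbolic ell T rhobar DH ->
  renorm_P ell T rhobar BP RP aP DPs NPs RPs ->
  renorm_H ell T rhobar lam DH BH RH DHs NHs RHs ->
  forall mP mH : nat,
  (mP0 aP BP <= mP)%N -> (0 < mH)%N ->
  (mH0 (ell_min ell) (zoneH ell T rhobar) BH <= mH)%N ->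
  exists2 rho1 : R, 0 < rho1 &
  forall rho0 : R, 0 < rho0 < rho1 ->
    let G := gaugeA ell rho0 MP BP NPs mP MH BH NHs mH in
    asymptotics_holds T A G /\ scattering_holds T A G.
Proof.
exists (fun aP BP => order_above (aP + 1) (range (fun xi => mxnorm (BP xi)))),
  (fun l V BH => order_above (l + 1) [set mxnorm (BH p.1 p.2) | p in V]).
move=> T ell alpha c0 rhobar lam lam0 lams A MP BP RP aP MH DH BH BHinf RH aH
  DPs NPs RPs DHs NHs RHs T0 ell1 _ _ rb _ HI HP HH _ NP NH mP mH mPle mH0 mHle.
have aP0 : 0 < aP + 1 by have := aP_gt HP; lra.
have l0 := ell_min_gt hd ell1.
have [rb0 rb1] := andP rb.
have L0 xi : 0 < jbr ell xi by exact: jbr_gt0.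
have bddP : has_ubound (range (fun xi => mxnorm (BP xi))).
  have [C C0 HC] := symbol_bound (BP_sym HP).
  exists C => _ [xi _ <-].
  pose t := Num.min T (rhobar / jbr ell xi).
  have t0 : 0 < t by rewrite lt_min T0 divr_gt0.
  have zt : zoneP ell T rhobar (t, xi).
    split; first by rewrite /strip/= t0 ge_min lexx.
    by rewrite /= /zeta mulrC -ler_pdivlMr// ge_min lexx orbT.
  by have := HC t xi zt; rewrite powRr0 mulr1.
have BPle xi : mxnorm (BP xi) <= sup (range (fun xi => mxnorm (BP xi))).
  by apply: ub_le_sup => //; exists xi.
have bddH : has_ubound [set mxnorm (BH p.1 p.2) | p in zoneH ell T rhobar].
  have [C C0 HC] := symbol_bound (BH_sym HH).
  by exists C => _ [[t xi] /HC + <-]; rewrite powRr0 mulr1.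
have BHle t xi : zoneH ell T rhobar (t, xi) ->
    mxnorm (BH t xi) <= sup [set mxnorm (BH p.1 p.2) | p in zoneH ell T rhobar].
  by move=> Vt; apply: ub_le_sup => //; exists (t, xi).
have mP0 : (0 < mP)%N by exact: leq_trans mPle.
have [rhoP /andP[rhoP0 rhoPb] estP] := zoneP_estimates T0 rb HP NP mP0 BPle
  (ltW (order_aboveP aP0 mPle)).
have betaH0 : 0 <= sup [set mxnorm (BH p.1 p.2) | p in zoneH ell T rhobar].
  by apply: sup_nonneg => // _ [p _ <-]; exact: mxnorm_ge0.
have [rhoH /andP[rhoH0 rhoHb] estH] := zoneH_estimates rb HH NH mH0 betaH0 BHle l0
  (order_aboveP l0 mHle).
exists (Num.min rhoP rhoH); first by rewrite lt_min rhoP0.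
move=> rho0 /andP[rho00]; rewrite lt_min => /andP[rhoPlt rhoHlt] G.
have rho_b : 0 < rho0 <= rhobar by rewrite rho00 ltW// (lt_le_trans rhoPlt).
have rho_inv : rho0 < rho0^-1.
  have rho1 : rho0 < 1 by case/andP: rho_b => _ /le_lt_trans; exact.
  by rewrite (lt_trans rho1)// invf_gt1.
have rho_P : 0 < rho0 < rhoP by rewrite rho00.
have rho_H : 0 < rho0 < rhoH by rewrite rho00.
have [CP CP1 {}estP] := estP rho0 rho_P.
have [CI CI1 estI] := zoneI_estimates HI rho_b.
have [CH CH1 {}estH] := estH rho0 rho_H.
pose C := Num.max CP (Num.max CI CH).
have CPC : CP <= C by rewrite le_max lexx.
have CIC : CI <= C by rewrite !le_max lexx !orbT.
have CHC : CH <= C by rewrite !le_max lexx !orbT.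
have cA xi : mcont `]0, T] (A^~ xi) by exact: mcont_coefficient T0 rb HI xi.
have GP t xi : zeta ell t xi < rho0 -> G t xi = gaugeP ell MP BP NPs mP t xi.
  by rewrite /G /gaugeA => ->.
have GI t xi : rho0 <= zeta ell t xi <= rho0^-1 -> G t xi = 1%:M.
  by move=> /andP[z1 z2]; rewrite /G /gaugeA ltNge z1/= z2.
have GH t xi : rho0^-1 < zeta ell t xi -> G t xi = gaugeH ell MH BH NHs mH rho0 t xi.
  move=> z1; rewrite /G /gaugeA ltNge (ltW (lt_trans rho_inv z1))/=.
  by rewrite leNgt z1.
(* On both borders the gauge is the identity, as they belong to [Z_I]. *)
have GrhoP t xi : zeta ell t xi = rho0 -> G t xi = 1%:M.
  by move=> zt; apply: GI; rewrite zt lexx ltW.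
have GrhoH t xi : zeta ell t xi = rho0^-1 -> G t xi = 1%:M.
  by move=> zt; apply: GI; rewrite zt lexx ltW.
have {}estP xi := estP xi (G^~ xi) (fun t _ => GP t xi) (fun t _ => GrhoP t xi).
have {}estH xi := estH xi (G^~ xi) (fun t _ => GH t xi) (fun t _ => GrhoH t xi).
have {}estI xi := estI xi (G^~ xi) (fun t _ => GI t xi).
have est xi : two_sided_estimate T (A^~ xi) (G^~ xi) (3 * C ^+ 3).
  have [_ eP _] := estP xi; have [_ eH] := estH xi.
  apply: (two_sided_of_intervals _ _ (interval_estimate_weaken CPC eP)
    (interval_estimate_weaken CIC (estI xi)) (interval_estimate_weaken CHC eH)).
    by rewrite /startH mulrC ler_pM2l ?invr_gt0// ltW.
  exact: le_trans CPC.
have Gunit xi t : 0 < t <= T -> G t xi \in unitmx.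
  move=> tT; have [unitP _ _] := estP xi; have [unitH _] := estH xi.
  have [/unitP|zP] := ltP (zeta ell t xi) rho0; first exact.
  have [/unitH|zH] := ltP rho0^-1 (zeta ell t xi); first exact.
  by rewrite GI ?zP// unitmx1.
have lims xi : has_limits T (A^~ xi) (G^~ xi).
  by have [_ _ H] := estP xi; exact: H (cA xi) (est xi).
split.
  exact: (asymptotics_of_estimates T0 cA Gunit est lims).
exact: (scattering_of_estimates T0 cA Gunit est lims).
Qed.
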